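(* There is an algorithm for Steiner Tree Enumeration that, after $O(nm)$ preprocessing time, outputs all minimal Steiner trees of $(G,W)$, each exactly once, with $O(n+m)$ delay and using $O(n^2)$ space, where $n=|V(G)|$ and $m=|E(G)|$. Moreover, without the additional preprocessing time, the algorithm can be implemented so that it runs in $O(n+m)$ amortized time per solution and $O(n+m)$ space.
   Context: Graphs have no self-loops. For an undirected graph $G=(V,E)$ and a terminal set $W\subseteq V$, a Steiner subgraph of $(G,W)$ is a subgraph of $G$ that contains a path between every pair of vertices of $W$; it is minimal if no proper subgraph of it is a Steiner subgraph of $(G,W)$. Every minimal Steiner subgraph is a tree, called a minimal Steiner tree. Steiner Tree Enumeration: given an undirected graph $G=(V,E)$ and $W\subseteq V$, output all minimal Steiner trees of $(G,W)$ without duplication. The delay of an enumeration algorithm is the maximum running time between two consecutive outputs, also counting the time before the first output (after preprocessing, if a preprocessing phase is allowed) and after the last output. Running in $f$ amortized time per solution means the total running time is $O(N\cdot f)$, where $N$ is the number of solutions. Space is counted in words of $O(\log n)$ bits.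
   Formalization: In the amortized bound the number N of solutions is read as max(N,1), since for W not connected in G there are no solutions and a total running time of O(N(n+m)) = 0 is impossible. *)

(* Defs.v *)
From Stdlib Require List.
From mathcomp Require Export all_boot.

Set Implicit Arguments.
Unset Strict Implicit.
Unset Printing Implicit Defensive.

(** * Graphs and minimal Steiner trees

    A graph with vertex set V = {0, .., n-1} is given by its edge set
    E : {set {set 'I_n}}; its edges are unordered pairs of distinct vertices. *)

Definition is_graph n (E : {set {set 'I_n}}) : bool :=
  [forall e in E, #|e| == 2].

(** A pair (vertex set, edge set); it is a subgraph of (V, E) when
    [subgraph_of E] holds. *)
Definition subgraph n : Type := ({set 'I_n} * {set {set 'I_n}})%type.

Definition subgraph_of n (E : {set {set 'I_n}}) (H : subgraph n) : bool :=
  (H.2 \subset E) && [forall e in H.2, e \subset H.1].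

Definition adjacent n (H : subgraph n) : rel 'I_n :=
  [rel u v | [set u; v] \in H.2].

(** The two membership tests only matter for the path of length 0: every vertex
    of a longer path is an end of an edge. *)
Definition contains_path n (H : subgraph n) (u v : 'I_n) : bool :=
  [&& u \in H.1, v \in H.1 & connect (adjacent H) u v].

Definition steiner n (E : {set {set 'I_n}}) (W : {set 'I_n})
    (H : subgraph n) : bool :=
  subgraph_of E H && [forall u in W, forall v in W, contains_path H u v].

Definition proper_subgraph n (H' H : subgraph n) : bool :=
  [&& H'.1 \subset H.1, H'.2 \subset H.2 & H' != H].

Definition minimal_steiner n (E : {set {set 'I_n}}) (W : {set 'I_n})
    (H : subgraph n) : bool :=
  steiner E W H &&
  [forall H' : subgraph n, proper_subgraph H' H ==> ~~ steiner E W H'].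

Definition minimal_steiner_trees n (E : {set {set 'I_n}}) (W : {set 'I_n}) :
    {set subgraph n} :=
  [set H | minimal_steiner E W H].

(** * Word RAM

    A deterministic random access machine, programmed in a structured language.
    It has a memory of [sz] words, addressed 0, .., sz-1, and registers (a
    program only mentions finitely many of them); a word is a natural number
    smaller than [wlim].  An operation whose result is not a word, or an access
    outside of the memory, has no semantics: such a run is stuck.  The output
    goes to a write-only tape. *)

Inductive binop := OpAdd | OpSub | OpMul | OpDiv | OpLt | OpEq.

Inductive expr :=
| Const of nat
| Reg of nat
| Read of expr
| Bin of binop & expr & expr.

Inductive cmd :=
| Skip
| Assign of nat & expr
| Store of expr & expr
| Write of expr
| Emit
| Seq of cmd & cmd
| If of expr & cmd & cmd
| While of expr & cmd.

(** [pending] holds the words written since the last [Emit]; [outs] lists, in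
    chronological order, the emitted solutions with their times of emission. *)
Record state := State {
  regs : nat -> nat;
  memory : nat -> nat;
  clock : nat;
  pending : seq nat;
  outs : seq (nat * seq nat)
}.

Definition binop_val (o : binop) (x y : nat) : nat :=
  match o with
  | OpAdd => x + y
  | OpSub => x - y
  | OpMul => x * y
  | OpDiv => x %/ y
  | OpLt => x < y
  | OpEq => x == y
  end.

Section Semantics.

Variables wlim sz : nat.

Definition word (x : nat) : option nat := if x < wlim then Some x else None.

Fixpoint eval (s : state) (e : expr) : option nat :=
  match e with
  | Const k => word k
  | Reg i => Some (regs s i)
  | Read a =>
      if eval s a is Some i then (if i < sz then word (memory s i) else None)
      else None
  | Bin o a b =>
      if eval s a is Some x then
        if eval s b is Some y then word (binop_val o x y) else None
      else None
  end.

Fixpoint cost (e : expr) : nat :=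
  match e with
  | Const _ | Reg _ => 1
  | Read a => (cost a).+1
  | Bin _ a b => (cost a + cost b).+1
  end.

Definition upd (f : nat -> nat) (i v : nat) : nat -> nat :=
  fun j => if j == i then v else f j.

Definition tick (k : nat) (s : state) : state :=
  State (regs s) (memory s) (clock s + k) (pending s) (outs s).

Definition set_reg (i v : nat) (s : state) : state :=
  State (upd (regs s) i v) (memory s) (clock s) (pending s) (outs s).

Definition set_mem (i v : nat) (s : state) : state :=
  State (regs s) (upd (memory s) i v) (clock s) (pending s) (outs s).

Definition write (v : nat) (s : state) : state :=
  State (regs s) (memory s) (clock s) (rcons (pending s) v) (outs s).

Definition emit (s : state) : state :=
  State (regs s) (memory s) (clock s) [::]
        (rcons (outs s) (clock s, pending s)).

(** [exec c s s']: started in [s], the program [c] halts in [s']; the clock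
    counts one unit for each command and each expression node evaluated. *)
Inductive exec : cmd -> state -> state -> Prop :=
| ExSkip s :
    exec Skip s (tick 1 s)
| ExAssign s i e v :
    eval s e = Some v ->
    exec (Assign i e) s (set_reg i v (tick (cost e).+1 s))
| ExStore s a e i v :
    eval s a = Some i -> i < sz -> eval s e = Some v ->
    exec (Store a e) s (set_mem i v (tick (cost a + cost e).+1 s))
| ExWrite s e v :
    eval s e = Some v ->
    exec (Write e) s (write v (tick (cost e).+1 s))
| ExEmit s :
    exec Emit s (emit (tick 1 s))
| ExSeq s s1 s2 c1 c2 :
    exec c1 s s1 -> exec c2 s1 s2 ->
    exec (Seq c1 c2) s s2
| ExIfTrue s s' e v c1 c2 :
    eval s e = Some v -> v <> 0 -> exec c1 (tick (cost e).+1 s) s' ->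
    exec (If e c1 c2) s s'
| ExIfFalse s s' e c1 c2 :
    eval s e = Some 0 -> exec c2 (tick (cost e).+1 s) s' ->
    exec (If e c1 c2) s s'
| ExWhileTrue s s1 s2 e v c :
    eval s e = Some v -> v <> 0 ->
    exec c (tick (cost e).+1 s) s1 -> exec (While e c) s1 s2 ->
    exec (While e c) s s2
| ExWhileFalse s e c :
    eval s e = Some 0 ->
    exec (While e c) s (tick (cost e).+1 s).

Lemma exec_det c s s1 s2 : exec c s s1 -> exec c s s2 -> s1 = s2.
Proof.
move=> h; elim: h s2 => {c s s1}.
all: intros; match goal with H : exec _ _ _ |- _ => inversion H; subst; clear H end.
all: repeat match goal with
  | IH : forall t, exec ?c ?s t -> ?u = t, K : exec ?c ?s ?t |- _ =>
      have := IH _ K; clear K; move=> ?; subst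
  end; congruence.
Qed.

End Semantics.

(** The input occupies the first memory words, and hence counts as space; all
    other words and registers are initially 0. *)
Definition init (inp : seq nat) : state :=
  State (fun=> 0) (nth 0 inp) 0 [::] [::].

(** Words of c * (floor(log2 n) + 1) bits. *)
Definition wlim_log (c n : nat) : nat := 2 ^ (c * (trunc_log 2 n).+1).

(** * Encodings *)

Definition lists_vertices n (A : {set 'I_n}) (vs : seq 'I_n) : bool :=
  perm_eq vs (enum A).

Definition lists_edges n (F : {set {set 'I_n}}) (es : seq ('I_n * 'I_n)) : bool :=
  perm_eq [seq [set e.1; e.2] | e <- es] (enum F).

Definition edge_words n (es : seq ('I_n * 'I_n)) : seq nat :=
  flatten [seq [:: val e.1; val e.2] | e <- es].

(** The instance (V, E), W: the numbers n, |E| and |W|, the list of the edges,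
    the list of the terminals.  The order of the lists and the orientation of
    the edges are arbitrary. *)
Definition encodes_instance n (E : {set {set 'I_n}}) (W : {set 'I_n})
    (inp : seq nat) : Prop :=
  exists es ws,
    [/\ lists_edges E es, lists_vertices W ws &
        inp = [:: n; size es; size ws] ++ edge_words es ++ map val ws].

(** The vertices are listed along with the edges because a tree may be a single
    vertex. *)
Definition encodes_subgraph n (H : subgraph n) (out : seq nat) : Prop :=
  exists vs es,
    [/\ lists_vertices H.1 vs, lists_edges H.2 es &
        out = size vs :: map val vs ++ edge_words es].

Definition enumerates_trees n (E : {set {set 'I_n}}) (W : {set 'I_n})
    (os : seq (nat * seq nat)) : Prop :=
  exists2 Hs : seq (subgraph n),
    perm_eq Hs (enum (minimal_steiner_trees E W)) &
    List.Forall2 (fun H o => encodes_subgraph H o.2) Hs os.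

(** From time [t0] on, at most [d] time units elapse before the first output,
    between consecutive outputs, and between the last output and halting at
    time [t1]. *)
Definition delay_le (d t0 : nat) (os : seq (nat * seq nat)) (t1 : nat) : bool :=
  path (fun t t' => t <= t' <= t + d) t0 (rcons (map fst os) t1).

(* Main.v *)
Require Import Defs.
From Stdlib Require Import Classical PeanoNat Lia.
From mathcomp Require Import all_boot zify.

(** Root the trees at a terminal [r].  In a minimal Steiner tree every vertex
    [u <> r] has exactly one parent, the neighbour of [u] which is joined to [r]
    without passing through [u], and the tree is determined by its parents.  It is
    explored in phases: from the first terminal not met so far, follow the parents
    until a vertex met before.  The minimal Steiner trees are thus the leaves of a
    decision tree, whose nodes choose the parent of the current vertex among the
    live neighbours, those joined to the vertices of the previous phases by a walk
    that avoids the current phase.  Every live choice extends to a solution, so no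
    branch is explored in vain.

    To reach the next leaf, go back to the last position with an untried live
    neighbour, take it, and complete the tree greedily, with one search for all
    phases.  The last such position of a phase is found in linear time by a single
    search that starts from the previous phases and unblocks the positions of the
    phase from the last one on.  Each phase records whether it can still be
    changed, so this search is done for the right phase only.  The delay is
    therefore linear from the start, in linear space, and no preprocessing is
    needed; one program proves both parts. *)

Set Implicit Arguments.
Unset Strict Implicit.
Unset Printing Implicit Defensive.

(** * A language with arrays, compiled to the word RAM *)

(** The obstacle is to know, for every phase, whether it can still be changed, without one search
    per phase. For a phase just built, whose lists are complete, this is a bridge test: contract the
    previous positions; the phase is frozen exactly when each of its parent edges is a bridge.
    Tarjan's low points decide this, and the one search that completes the tree computes them for
    all its phases at once. Once lists are partly consumed the test no longer suffices, so the
    single phase that was modified gets its flag from a second search with released positions.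
    Minimality is not checked by pruning: a minimal Steiner tree inside the tree of a full
    configuration has the same parents, hence equals it. The enumeration rests on one invariant: the
    trees output so far are exactly the solutions that leave the current configuration at an
    alternative already tried. Running times are conjuncts of the loop invariants, paid by a
    potential of the search. The amortized bound is the delay times the number of outputs plus
    one. *)

Inductive hexp :=
| HC of nat
| HV of nat
| HR of nat & hexp
| HB of binop & hexp & hexp.

Inductive hcmd :=
| HSkip
| HSet of nat & hexp
| HSto of nat & hexp & hexp
| HWr of hexp
| HEm
| HSeq of hcmd & hcmd
| HIf of hexp & hcmd & hcmd
| HWh of hexp & hcmd.

Record hst := HSt {
  rg : nat -> nat;
  ar : nat -> nat -> nat;
  ck : nat;
  pd : seq nat;
  ou : seq (nat * seq nat)
}.

Fixpoint hev (s : hst) (e : hexp) : nat :=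
  match e with
  | HC k => k
  | HV i => rg s i
  | HR k a => ar s k (hev s a)
  | HB o a b => binop_val o (hev s a) (hev s b)
  end.

(* Array 0 is the input, read at its own address; the cells of the arrays
   1, .., 16 are interleaved after it. *)
Fixpoint comp_exp (e : hexp) : expr :=
  match e with
  | HC k => Const k
  | HV i => Reg i.+1
  | HR 0 a => Read (comp_exp a)
  | HR k.+1 a => Read (Bin OpAdd (Reg 0)
                  (Bin OpAdd (Bin OpMul (Const 16) (comp_exp a)) (Const k)))
  | HB o a b => Bin o (comp_exp a) (comp_exp b)
  end.

Fixpoint compile (c : hcmd) : cmd :=
  match c with
  | HSkip => Skip
  | HSet i e => Assign i.+1 (comp_exp e)
  | HSto k a e => Store (Bin OpAdd (Reg 0)
        (Bin OpAdd (Bin OpMul (Const 16) (comp_exp a)) (Const k.-1))) (comp_exp e)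
  | HWr e => Write (comp_exp e)
  | HEm => Emit
  | HSeq c1 c2 => Seq (compile c1) (compile c2)
  | HIf e c1 c2 => If (comp_exp e) (compile c1) (compile c2)
  | HWh e c1 => While (comp_exp e) (compile c1)
  end.

Fixpoint hcost (e : hexp) : nat :=
  match e with
  | HC _ | HV _ => 1
  | HR 0 a => (hcost a).+1
  | HR _.+1 a => hcost a + 7
  | HB _ a b => (hcost a + hcost b).+1
  end.

Lemma hcostE e : cost (comp_exp e) = hcost e.
Proof.
elim: e => //= [[|k] a IH|o a -> b -> //] /=; last by rewrite IH; lia.
by rewrite IH.
Qed.

(** [Nat.eqb] rather than [==], so that [cbn] resolves an update at a literal register or array
    number during symbolic execution. *)
Definition updn (f : nat -> nat) (i v : nat) : nat -> nat :=
  fun j => if Nat.eqb j i then v else f j.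

Definition upda (f : nat -> nat -> nat) (k i v : nat) : nat -> nat -> nat :=
  fun j => if Nat.eqb j k then upd (f k) i v else f j.

Definition htick (k : nat) (s : hst) : hst :=
  HSt (rg s) (ar s) (ck s + k) (pd s) (ou s).

Section HighLevel.

Variables wl B M : nat.

(** Sufficient for the compiled expression not to be stuck. Subtraction, division and comparisons
    need no bound, since their values stay in the word range of their operands. Literals are at most
    16, the largest constant of the address computation. *)
Fixpoint hok (s : hst) (e : hexp) : Prop :=
  match e with
  | HC k => k <= 16
  | HV _ => True
  | HR k a => [/\ hok s a, k <= 16 & hev s a < (if k is 0 then B else M)]
  | HB o a b => [/\ hok s a, hok s b &
      match o with
      | OpAdd => hev s a + hev s b < wl
      | OpMul => hev s a * hev s b < wl
      | _ => True
      end]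
  end.

Inductive hexec : hcmd -> hst -> hst -> Prop :=
| XSkip s : hexec HSkip s (htick 1 s)
| XSet s i e : hok s e ->
    hexec (HSet i e) s
      (HSt (updn (rg s) i (hev s e)) (ar s) (ck s + (hcost e).+1) (pd s) (ou s))
| XSto s k a e : 0 < k <= 16 -> hok s a -> hev s a < M -> hok s e ->
    hexec (HSto k a e) s
      (HSt (rg s) (upda (ar s) k (hev s a) (hev s e))
           (ck s + (hcost a + hcost e + 7)) (pd s) (ou s))
| XWr s e : hok s e ->
    hexec (HWr e) s
      (HSt (rg s) (ar s) (ck s + (hcost e).+1) (rcons (pd s) (hev s e)) (ou s))
| XEm s :
    hexec HEm s
      (HSt (rg s) (ar s) (ck s + 1) [::] (rcons (ou s) (ck s + 1, pd s)))
| XSeq s s1 s2 c1 c2 : hexec c1 s s1 -> hexec c2 s1 s2 -> hexec (HSeq c1 c2) s s2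
| XIfT s s' e c1 c2 : hok s e -> hev s e <> 0 ->
    hexec c1 (htick (hcost e).+1 s) s' -> hexec (HIf e c1 c2) s s'
| XIfF s s' e c1 c2 : hok s e -> hev s e = 0 ->
    hexec c2 (htick (hcost e).+1 s) s' -> hexec (HIf e c1 c2) s s'
| XWhT s s1 s2 e c : hok s e -> hev s e <> 0 ->
    hexec c (htick (hcost e).+1 s) s1 -> hexec (HWh e c) s1 s2 ->
    hexec (HWh e c) s s2
| XWhF s e c : hok s e -> hev s e = 0 -> hexec (HWh e c) s (htick (hcost e).+1 s).

(** Computes through straight-line code; a loop is left as an execution, to be entered with an
    invariant by [wp_while]. *)
Fixpoint wp (c : hcmd) (Q : hst -> Prop) (s : hst) : Prop :=
  match c with
  | HSkip => Q (htick 1 s)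
  | HSet i e => hok s e /\
      Q (HSt (updn (rg s) i (hev s e)) (ar s) (ck s + (hcost e).+1) (pd s) (ou s))
  | HSto k a e => [/\ 0 < k <= 16, hok s a, hev s a < M & hok s e /\
      Q (HSt (rg s) (upda (ar s) k (hev s a) (hev s e))
             (ck s + (hcost a + hcost e + 7)) (pd s) (ou s))]
  | HWr e => hok s e /\
      Q (HSt (rg s) (ar s) (ck s + (hcost e).+1) (rcons (pd s) (hev s e)) (ou s))
  | HEm => Q (HSt (rg s) (ar s) (ck s + 1) [::] (rcons (ou s) (ck s + 1, pd s)))
  | HSeq c1 c2 => wp c1 (wp c2 Q) s
  | HIf e c1 c2 => [/\ hok s e, hev s e <> 0 -> wp c1 Q (htick (hcost e).+1 s) &
                       hev s e = 0 -> wp c2 Q (htick (hcost e).+1 s)]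
  | HWh _ _ => exists2 s', hexec c s s' & Q s'
  end.

Lemma wpE c Q s : wp c Q s <-> exists2 s', hexec c s s' & Q s'.
Proof.
elim: c Q s => [|i e|k a e|e||c1 IH1 c2 IH2|e c1 IH1 c2 IH2|e c1 IH] Q s /=.
- by split=> [h|[s' h]]; [eexists; [constructor|] | inversion h; subst].
- by split=> [[h1 h]|[s' h]]; [eexists; [constructor|] | inversion h; subst].
- split=> [[? ? ? [? h]]|[s' h]]; first by eexists; [constructor|].
  by inversion h; subst.
- by split=> [[h1 h]|[s' h]]; [eexists; [constructor|] | inversion h; subst].
- by split=> [h|[s' h]]; [eexists; [constructor|] | inversion h; subst].
- split.
    by move=> /IH1 [s1 h1 /IH2 [s2 h2 h]]; exists s2 => //; apply: XSeq h1 h2.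
  move=> [s' h]; inversion h; subst => hQ.
  by apply/IH1; exists s1 => //; apply/IH2; exists s'.
- split.
    move=> [ho h1 h2]; case: (eqVneq (hev s e) 0) => [e0|/eqP e0].
      by have /IH2 [s' ? ?] := h2 e0; exists s' => //; apply: XIfF.
    by have /IH1 [s' ? ?] := h1 e0; exists s' => //; apply: XIfT.
  move=> [s' h]; inversion h; subst => hQ; split=> // e0; try by [].
    by apply/IH1; exists s'.
  by apply/IH2; exists s'.
- by [].
Qed.

Lemma wp_conseq c (Q Q' : hst -> Prop) s :
  wp c Q s -> (forall s', hexec c s s' -> Q s' -> Q' s') -> wp c Q' s.
Proof. by move=> /wpE [s' h q] H; apply/wpE; exists s' => //; apply: H. Qed.

(** Total correctness, with [f] as variant. Time needs no rule of its own: it appears in the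
    invariants as a bound on [ck]. *)
Lemma wp_while e c (I : hst -> Prop) (f : hst -> nat) (Q : hst -> Prop) s :
  I s ->
  (forall s, I s ->
    [/\ hok s e,
        hev s e <> 0 -> wp c (fun s' => I s' /\ f s' < f s) (htick (hcost e).+1 s) &
        hev s e = 0 -> Q (htick (hcost e).+1 s)]) ->
  wp (HWh e c) Q s.
Proof.
move=> Is H; apply/wpE; have [k le_k] := ubnP (f s).
elim: k s le_k Is => // k IH s le_k Is.
have [ho h1 h2] := H _ Is; case: (eqVneq (hev s e) 0) => [e0|/eqP e0].
  by eexists; [apply: XWhF | apply: h2].
have /wpE [s1 x1 [I1 lt1]] := h1 e0.
have [|s2 x2 q2] := IH s1 _ I1; first by lia.
by exists s2 => //; apply: XWhT x2.
Qed.

Fixpoint wregs (c : hcmd) : seq nat :=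
  match c with
  | HSet i _ => [:: i]
  | HSeq c1 c2 | HIf _ c1 c2 => wregs c1 ++ wregs c2
  | HWh _ c1 => wregs c1
  | _ => [::]
  end.

Fixpoint warrs (c : hcmd) : seq nat :=
  match c with
  | HSto k _ _ => [:: k]
  | HSeq c1 c2 | HIf _ c1 c2 => warrs c1 ++ warrs c2
  | HWh _ c1 => warrs c1
  | _ => [::]
  end.

Fixpoint silent (c : hcmd) : bool :=
  match c with
  | HWr _ | HEm => false
  | HSeq c1 c2 | HIf _ c1 c2 => silent c1 && silent c2
  | HWh _ c1 => silent c1
  | _ => true
  end.

(** Syntactic framing keeps the specifications short: what a command never assigns is recovered from
    its text. *)
Lemma frame_rg c s s' : hexec c s s' ->
  forall i, i \notin wregs c -> rg s' i = rg s i.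
Proof.
elim=> {c s s'} //=.
- by move=> s i e _ j; rewrite inE /updn => /eqP ne; case: Nat.eqb_spec.
- by move=> s s1 s2 c1 c2 _ h1 _ h2 i; rewrite mem_cat negb_or => /andP[/h1 <- /h2].
- by move=> s s' e c1 c2 _ _ _ h i; rewrite mem_cat negb_or => /andP[/h ->].
- by move=> s s' e c1 c2 _ _ _ h i; rewrite mem_cat negb_or => /andP[_ /h ->].
- by move=> s s1 s2 e c _ _ _ h1 _ h2 i hi; rewrite h2 // h1.
Qed.

Lemma frame_ar c s s' : hexec c s s' ->
  forall k, k \notin warrs c -> ar s' k = ar s k.
Proof.
elim=> {c s s'} //=.
- by move=> s k a e _ _ _ _ j; rewrite inE /upda => /eqP ne; case: Nat.eqb_spec.
- by move=> s s1 s2 c1 c2 _ h1 _ h2 i; rewrite mem_cat negb_or => /andP[/h1 <- /h2].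
- by move=> s s' e c1 c2 _ _ _ h i; rewrite mem_cat negb_or => /andP[/h ->].
- by move=> s s' e c1 c2 _ _ _ h i; rewrite mem_cat negb_or => /andP[_ /h ->].
- by move=> s s1 s2 e c _ _ _ h1 _ h2 i hi; rewrite h2 // h1.
Qed.

Lemma frame_out c s s' : hexec c s s' -> silent c -> pd s' = pd s /\ ou s' = ou s.
Proof.
elim=> {c s s'} //=.
- by move=> s s1 s2 c1 c2 _ h1 _ h2 /andP[/h1 [<- <-] /h2].
- by move=> s s' e c1 c2 _ _ _ h /andP[/h [-> ->] _].
- by move=> s s' e c1 c2 _ _ _ h /andP[_ /h [-> ->]].
- by move=> s s1 s2 e c _ _ _ h1 _ h2 hs; have [-> ->] := h2 hs; apply: h1.
Qed.

Lemma hexec_clock c s s' : hexec c s s' -> ck s <= ck s'.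
Proof. by elim=> {c s s'} //= *; lia. Qed.

(** * Simulation of the language with arrays by the word RAM *)

Section Simulation.

Variable sz : nat.
Hypotheses (wl16 : 16 < wl) (sz_ge : B + 16 * M <= sz) (wl_ge : B + 16 * M <= wl).

(** Register 0 of the machine is reserved for the base address [B], hence the shift of the
    registers. The clocks agree exactly, so time bounds transfer without loss. *)
Definition sim (h : hst) (s : state) : Prop :=
  [/\ (forall i, regs s i.+1 = rg h i) /\ regs s 0 = B,
      (forall i, i < B -> memory s i = ar h 0 i) /\
      (forall k i, k < 16 -> i < M -> memory s (B + (16 * i + k)) = ar h k.+1 i),
      (forall i, regs s i < wl) /\ (forall i, memory s i < wl) &
      [/\ clock s = ck h, pending s = pd h & outs s = ou h]].

Lemma wordE x : x < wl -> word wl x = Some x.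
Proof. by rewrite /word => ->. Qed.

Lemma sim_tick h s k : sim h s -> sim (htick k h) (tick k s).
Proof. by case=> [r1 m1 w1 [c1 p1 o1]]; split=> //=; split=> //=; rewrite c1. Qed.

Lemma sim_addr h s (e : expr) x k : sim h s -> eval wl sz s e = Some x -> x < M ->
  k < 16 ->
  eval wl sz s (Bin OpAdd (Reg 0) (Bin OpAdd (Bin OpMul (Const 16) e) (Const k)))
  = Some (B + (16 * x + k)).
Proof.
move=> [[_ r0] _ _ _] he hx hk /=; rewrite he r0 !(wordE, wl16) //; lia.
Qed.

Lemma sim_eval h s e : sim h s -> hok h e ->
  eval wl sz s (comp_exp e) = Some (hev h e) /\ hev h e < wl.
Proof.
move=> S; case: (S) => [[r1 r0] [m0 m1] [wr wm] _].
elim: e => [k|i|k a IH|o a IHa b IHb] /=.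
- by move=> hk; rewrite wordE; [split=> //; lia | lia].
- by move=> _; rewrite r1 -r1; split=> //.
- case: k => [|k] [/IH [ea la] k16 lt_a].
    rewrite /= ea -m0 //; split=> //; rewrite wordE //; case: ifP => //; lia.
  have := sim_addr S ea lt_a k16; rewrite /comp_exp -/comp_exp => eA.
  have -> : forall x, eval wl sz s (Read x) = if eval wl sz s x is Some i then
    (if i < sz then word wl (memory s i) else None) else None by [].
  rewrite eA -m1 //; split=> //; rewrite wordE //; case: ifP => //; lia.
- move=> [/IHa [ea la] /IHb [eb lb] ho]; rewrite ea eb.
  suff lt : binop_val o (hev h a) (hev h b) < wl by rewrite wordE.
  case: o ho => //= _; try lia.
  by apply: leq_ltn_trans la; apply: leq_div.
Qed.

Lemma sim_exec c h h' s : hexec c h h' -> sim h s ->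
  exists2 s', exec wl sz (compile c) s s' & sim h' s'.
Proof.
move=> x; elim: x s => {c h h'}.
- by move=> h s S; eexists; [constructor | apply: sim_tick].
- move=> h i e he s S; have [ee le] := sim_eval S he.
  eexists; first by constructor; exact: ee.
  case: S => [[r1 r0] m1 [wr wm] [c1 p1 o1]]; split=> //=; last 2 first.
  + by split=> // j; rewrite /upd; case: ifP.
  + by split=> //; rewrite c1 hcostE.
  by split=> // j; rewrite /upd /updn eqSS; case: eqP; case: Nat.eqb_spec.
- move=> h k a e hk ha lt he s S.
  have [ea la] := sim_eval S ha; have [ee le] := sim_eval S he.
  have k16 : k.-1 < 16 by lia.
  eexists; first by apply: ExStore (sim_addr S ea lt k16) _ ee; lia.
  case: S => [[r1 r0] [m0 m1] [wr wm] [c1 p1 o1]]; split=> //=; last 2 first.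
  + by split=> // j; rewrite /upd; case: ifP.
  + by split=> //=; rewrite c1 !hcostE; lia.
  split.
    move=> i iB; rewrite /upda /upd; case: eqP => [|_]; first by lia.
    by case: Nat.eqb_spec => [e0|_]; [lia | exact: m0].
  move=> k' i k'16 iM; rewrite /upda /upd.
  case: Nat.eqb_spec => [<-|ne] /=.
    rewrite -m1 //; case: eqP => [e1|ne1]; case: eqP => [e2|ne2] //; lia.
  case: eqP => [e1|_]; [lia | exact: m1].
- move=> h e he s S; have [ee le] := sim_eval S he.
  eexists; first by constructor; exact: ee.
  by case: S => [r1 m1 w1 [c1 p1 o1]]; split=> //=; split=> //=; rewrite ?c1 ?hcostE ?p1.
- move=> h s S; eexists; first by constructor.
  by case: S => [r1 m1 w1 [c1 p1 o1]]; split=> //=; split=> //=; rewrite ?c1 ?p1 ?o1.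
- move=> h h1 h2 c1 c2 _ IH1 _ IH2 s /IH1 [s1 x1 /IH2 [s2 x2 S2]].
  by exists s2 => //; apply: ExSeq x1 x2.
- move=> h h' e c1 c2 he ne _ IH s S; have [ee _] := sim_eval S he.
  have /IH [s' x' S'] := sim_tick (hcost e).+1 S; exists s' => //.
  by apply: (ExIfTrue _ ee ne); rewrite hcostE.
- move=> h h' e c1 c2 he ne _ IH s S; have [ee _] := sim_eval S he.
  have /IH [s' x' S'] := sim_tick (hcost e).+1 S; exists s' => //.
  by rewrite ne in ee; apply: (ExIfFalse _ ee); rewrite hcostE.
- move=> h h1 h2 e c he ne _ IH1 _ IH2 s S; have [ee _] := sim_eval S he.
  have /IH1 [s1 x1 /IH2 [s2 x2 S2]] := sim_tick (hcost e).+1 S; exists s2 => //.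
  by apply: (ExWhileTrue ee ne) x2; rewrite hcostE.
- move=> h e c he ne s S; have [ee _] := sim_eval S he.
  rewrite ne in ee; eexists; first by apply: ExWhileFalse ee.
  by rewrite hcostE; apply: sim_tick.
Qed.

End Simulation.
End HighLevel.

(** * Minimal Steiner trees as rooted trees *)

Lemma connect_invariant (T : finType) (e : rel T) (P : T -> Prop) x y :
  connect e x y -> P x -> (forall a b, P a -> e a b -> P b) -> P y.
Proof.
move=> /connectP [p]; elim: p x => [|z p IH] x /= => [_ -> //|/andP[exz ep] ey Px H].
by apply: (IH z) => //; apply: H exz.
Qed.

Section SteinerTrees.

Variables (n : nat) (E : {set {set 'I_n}}) (W : {set 'I_n}) (r : 'I_n).
Hypothesis rW : r \in W.

Definition avoid (T : subgraph n) (u : 'I_n) : rel 'I_n :=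
  [rel x y | [&& x != u, y != u & [set x; y] \in T.2]].

(* In a tree [T], the vertex [v] is the parent of [u] when [T] is rooted at [r]. *)
Definition dec (T : subgraph n) (u v : 'I_n) : bool :=
  ([set u; v] \in T.2) && connect (avoid T u) v r.

Lemma adjacent_sym (T : subgraph n) : connect_sym (adjacent T).
Proof. by apply: sym_connect_sym => x y; rewrite /adjacent /= setUC. Qed.

Lemma avoid_sym (T : subgraph n) u : connect_sym (avoid T u).
Proof. by apply: sym_connect_sym => x y; rewrite /avoid /= setUC andbCA. Qed.

Lemma steinerP (T : subgraph n) :
  reflect [/\ T.2 \subset E,
              forall x y, [set x; y] \in T.2 -> x \in T.1 /\ y \in T.1,
              forall e, e \in T.2 -> e \subset T.1 &
              forall u v, u \in W -> v \in W -> contains_path T u v]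
          (steiner E W T).
Proof.
apply: (iffP andP) => [[/andP[sE /forallP sV] /forall_inP cW]|[sE _ sV cW]].
  have sV' e : e \in T.2 -> e \subset T.1 by move=> he; have /implyP := sV e; apply.
  split=> // [x y /sV' /subsetP h|u v uW vW].
    by split; apply: h; rewrite !inE eqxx ?orbT.
  by have /forall_inP := cW u uW; apply.
split; first by rewrite /subgraph_of sE; apply/forall_inP.
by apply/forall_inP => u uW; apply/forall_inP => v vW; apply: cW.
Qed.

Lemma minimal_proper T T' : minimal_steiner E W T -> steiner E W T' ->
  T'.1 \subset T.1 -> T'.2 \subset T.2 -> T' = T.
Proof.
move=> /andP[_ /forallP mT] sT' s1 s2; apply: contraTeq sT' => ne.
by have /implyP := mT T'; apply; rewrite /proper_subgraph s1 s2.
Qed.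

(** The part of [T] inside the component of [r] is still a Steiner subgraph, because [r] is a
    terminal; minimality makes it all of [T]. *)
Lemma minimal_connected T x :
  minimal_steiner E W T -> x \in T.1 -> connect (adjacent T) x r.
Proof.
move=> mT xT; have /andP[/steinerP [sE sV sV' cW] _] := mT.
pose K := [set y | connect (adjacent T) y r].
pose T' : subgraph n := (T.1 :&: K, [set e in T.2 | e \subset K]).
suff /(congr1 fst) /setP /(_ x) : T' = T by rewrite !inE xT.
apply: minimal_proper mT _ _ _; last 2 first.
- exact: subsetIl.
- by apply/subsetP => e; rewrite inE => /andP[].
apply/steinerP; split=> /=.
- by apply: subset_trans sE; apply/subsetP => e; rewrite inE => /andP[].
- move=> y z; rewrite inE => /andP[/sV [yT zT] /subsetP h].
  by rewrite !inE yT zT; move: (h y) (h z); rewrite !inE !eqxx ?orbT /= => -> // ->.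
- by move=> e; rewrite inE => /andP[/sV' h1 h2]; rewrite subsetI h1.
move=> u v uW vW; have /and3P[uT vT uv] := cW _ _ uW vW.
have /and3P[_ _ ur] := cW _ _ uW rW; have /and3P[_ _ vr] := cW _ _ vW rW.
apply/and3P; split; rewrite ?inE ?uT ?vT //.
suff [] : v \in K /\ connect (adjacent T') u v by [].
apply: (@connect_invariant _ _ (fun b => b \in K /\ connect (adjacent T') u b) _ _ uv).
  by rewrite inE.
move=> a b [aK ua] ab.
have bK : b \in K.
  rewrite !inE in aK *; apply: connect_trans aK.
  by rewrite adjacent_sym; apply: connect1.
split=> //; apply: connect_trans ua _; apply: connect1.
by rewrite /adjacent /= inE; apply/andP; split=> //; apply/subsetP => z; rewrite !inE => /orP[] /eqP->;
   move: aK bK; rewrite !inE.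
Qed.

(** The second vertex of a duplicate-free path is a parent of [x], since the rest of the path avoids
    [x]. The relation is a parameter so that this serves both for all paths of [T] and for paths
    that already avoid some vertex. *)
Lemma dec_step T (e : rel 'I_n) x : subrel e (adjacent T) -> connect e x r -> x != r ->
  exists v, [/\ e x v, dec T x v & connect e v r].
Proof.
move=> sub /connectP [p ep er] xr; move: er; case/shortenP: ep => p' ep' up' _ er.
case: p' ep' up' er xr => [|v p'] /=; first by move=> _ _ ->; rewrite eqxx.
move=> /andP[exv ep'] /andP[xp' up'] er _; exists v; split=> //; last first.
  by apply/connectP; exists p'.
apply/andP; split; first exact: sub.
apply/connectP; exists p' => //; rewrite inE negb_or in xp'.
case/andP: xp' => xv xp'; elim: p' v ep' xp' xv {exv up' er} => //= z p' IH v.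
move=> /andP[evz ep']; rewrite inE negb_or => /andP[xz xp'] xv.
by rewrite /avoid /= eq_sym xv eq_sym xz (sub _ _ evz : [set v; z] \in T.2) IH.
Qed.

Lemma dec_exists T u : minimal_steiner E W T -> u \in T.1 -> u != r ->
  exists v, dec T u v.
Proof.
move=> mT uT ur; have := minimal_connected mT uT.
by move=> /(@dec_step T (adjacent T) u (fun _ _ h => h)) /(_ ur) [v [_ ? _]]; exists v.
Qed.

Lemma avoid_sub T u : subrel (avoid T u) (adjacent T).
Proof. by move=> x y /and3P[]. Qed.

(* Otherwise the edge [u v'] can be deleted: [v'] is joined to [u] through [r] and [v]. *)
Lemma dec_uniq T u v v' : minimal_steiner E W T -> u != r -> dec T u v -> dec T u v' -> v = v'.
Proof.
move=> mT ur /andP[uv vr] /andP[uv' v'r]; have /andP[/steinerP [sE sV sV' cW] _] := mT.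
apply: contraTeq isT => ne.
(* [v'] cannot be [u] itself: a walk that avoids [u] has no first step out of [u]. *)
case: (eqVneq u v') => [euv'|uv'ne].
  rewrite -euv' in v'r; have [w [/and3P[]]] := dec_step (@avoid_sub T u) v'r ur.
  by rewrite eqxx.
pose T' : subgraph n := (T.1, T.2 :\ [set u; v']).
suff e : T' = T by move: uv'; rewrite -{1}e /= !inE eqxx.
apply: minimal_proper mT _ _ _; rewrite ?subsetDl //=.
have sub : subrel (avoid T u) (adjacent T').
  move=> x y /and3P[xu yu xy]; rewrite /adjacent /= !inE xy andbT.
  apply/eqP => /setP /(_ u); rewrite !inE eqxx /=.
  by rewrite ![u == _]eq_sym (negbTE xu) (negbTE yu).
have uv1 : connect (adjacent T') u v'.
  apply: (@connect_trans _ _ v).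
    apply: connect1; rewrite /adjacent /= !inE uv andbT; apply/eqP => /setP /(_ v').
    rewrite !inE eqxx orbT [v' == v]eq_sym (negbTE ne) orbF.
    by rewrite eq_sym (negbTE uv'ne).
  apply: (@connect_trans _ _ r); first exact: connect_sub (fun x y h => connect1 (sub x y h)) _ _ vr.
  rewrite adjacent_sym; exact: connect_sub (fun x y h => connect1 (sub x y h)) _ _ v'r.
apply/steinerP; split=> /=.
- by apply: subset_trans sE; apply: subsetDl.
- by move=> x y; rewrite inE => /andP[_ /sV].
- by move=> e; rewrite inE => /andP[_ /sV'].
move=> x y xW yW; have /and3P[xT yT xy] := cW _ _ xW yW; apply/and3P; split=> //.
(* Each use of the deleted edge on the path is replaced by the detour [uv1]. *)
apply: connect_sub xy => a b ab; rewrite /= in ab.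
case: (eqVneq [set a; b] [set u; v']) => [eab|ne'].
  have : a \in [set u; v'] by rewrite -eab !inE eqxx.
  have : b \in [set u; v'] by rewrite -eab !inE eqxx orbT.
  have : u \in [set a; b] by rewrite eab !inE eqxx.
  have : v' \in [set a; b] by rewrite eab !inE eqxx orbT.
  rewrite !inE => h1 h2 /orP[] /eqP eb /orP[] /eqP ea; subst a b => //.
  - by rewrite adjacent_sym.
by apply: connect1; rewrite /adjacent /= !inE ne'.
Qed.

(** By uniqueness of parents, a simple walk from [q j] to [r] starts with [q j.+1], and so on up to
    [q k], which it was supposed to avoid. *)
Lemma dec_avoids T s k (q : nat -> 'I_n) :
  minimal_steiner E W T -> (forall j, s <= j <= k -> q j != r) ->
  (forall j, s <= j < k -> dec T (q j) (q j.+1)) ->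
  forall j, s <= j <= k -> ~~ connect (avoid T (q k)) (q j) r.
Proof.
move=> mT qr dq j hj; have [d le_d] := ubnP (k - j); elim: d j hj le_d => // d IH j hj le_d.
apply/negP => cj.
have [v [av dv cv]] := dec_step (@avoid_sub T (q k)) cj (qr _ hj).
have [e|ne] := eqVneq j k; first by case/and3P: av; rewrite e eqxx.
have : v = q j.+1 by apply: dec_uniq mT (qr _ hj) dv _; apply: dq; lia.
by move=> ev; subst v; move: cv; apply/negP; apply: IH; lia.
Qed.

(** The walk of [T] from the parent [a] to [r] avoids [q k], hence by [dec_avoids] the whole phase
    up to [q k]. So a parent used by a solution is live, and discarding choices that are not live
    loses nothing. *)
Lemma dec_live T s k (q : nat -> 'I_n) a (Z : 'I_n -> Prop) :
  minimal_steiner E W T -> (forall j, s <= j <= k -> q j != r) ->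
  (forall j, s <= j < k -> dec T (q j) (q j.+1)) -> dec T (q k) a -> Z r ->
  (forall x y, [set x; y] \in E -> Z y ->
     (forall j, s <= j <= k -> x <> q j) -> Z x) -> Z a.
Proof.
move=> mT qr dq /andP[_ da] Zr Zc; have na := dec_avoids mT qr dq.
have /andP[/steinerP [/subsetP sE _ _ _] _] := mT.
rewrite avoid_sym in da.
suff [] : connect (avoid T (q k)) a r /\ Z a by [].
apply: (@connect_invariant _ _ (fun b => connect (avoid T (q k)) b r /\ Z b) _ _ da) => // x y [xr Zx] xy.
have yr : connect (avoid T (q k)) y r.
  by apply: connect_trans xr; rewrite avoid_sym; apply: connect1.
split=> //; apply: Zc (Zx) _.
  by rewrite setUC; apply: sE; case/and3P: xy.
by move=> j hj ey; have := na j hj; rewrite -ey yr.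
Qed.

Lemma exists_minimal H : steiner E W H ->
  exists T, [/\ minimal_steiner E W T, T.1 \subset H.1 & T.2 \subset H.2].
Proof.
have [d le_d] := ubnP (#|H.1| + #|H.2|); elim: d H le_d => // d IH H le_d sH.
case: (boolP (minimal_steiner E W H)) => [mH|]; first by exists H; split.
rewrite /minimal_steiner sH /= negb_forall => /existsP [H'].
rewrite negb_imply negbK => /andP[/and3P[s1 s2 ne] sH'].
have lt : #|H'.1| + #|H'.2| < #|H.1| + #|H.2|.
  have h1 := subset_leq_card s1; have h2 := subset_leq_card s2.
  rewrite ltn_neqAle leq_add // andbT; apply: contra ne => /eqP e.
  have e1 : H'.1 = H.1 by apply/eqP; rewrite eqEcard s1 -(leq_add2r #|H'.2|) e leq_add2l.
  have e2 : H'.2 = H.2 by apply/eqP; rewrite eqEcard s2 -(leq_add2l #|H'.1|) e leq_add2r.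
  by rewrite [H']surjective_pairing e1 e2 -surjective_pairing.
have [|T [mT t1 t2]] := IH H' _ sH'; first exact: leq_trans lt le_d.
by exists T; split=> //; [apply: subset_trans s1 | apply: subset_trans s2].
Qed.

(** * Parent assignments and the trees they describe *)

Section Configuration.

Variables (L : nat) (q c : nat -> 'I_n).

Definition tree_vertices : seq 'I_n := r :: [seq q k | k <- iota 0 L].
Definition tree_edges : seq ('I_n * 'I_n) := [seq (q k, c k) | k <- iota 0 L].
Definition tree_of : subgraph n :=
  ([set x in tree_vertices], [set e in [seq [set e.1; e.2] | e <- tree_edges]]).

Definition agree (T : subgraph n) (k : nat) : Prop :=
  forall j, j < k -> dec T (q j) (c j).

Hypothesis q_root : forall k, k < L -> q k != r.
Hypothesis q_inj : forall i j, i < L -> j < L -> q i = q j -> i = j.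
Hypothesis c_edge : forall k, k < L -> [set q k; c k] \in E.
Hypothesis c_in : forall k, k < L -> c k = r \/ exists2 j, j < L & c k = q j.
(** Acyclicity of the parents, as an induction principle from parents to children. *)
Hypothesis c_root : forall Z : 'I_n -> Prop, Z r ->
  (forall k, k < L -> Z (c k) -> Z (q k)) -> forall k, k < L -> Z (q k).
Hypothesis q_term : forall k, k < L -> q k \in W \/ exists2 j, j < k & c j = q k.
Hypothesis W_in : forall w, w \in W -> w = r \/ exists2 k, k < L & w = q k.

Lemma tree_vertexP x :
  reflect (x = r \/ exists2 k, k < L & x = q k) (x \in tree_of.1).
Proof.
rewrite !inE; apply: (iffP orP) => [[/eqP|/mapP [k]]|[->|[k kL ->]]].
- by left.
- by rewrite mem_iota => /andP[_ kL] ->; right; exists k.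
- by left.
- by right; apply/mapP; exists k; rewrite ?mem_iota.
Qed.

Lemma tree_edgeP e :
  reflect (exists2 k, k < L & e = [set q k; c k]) (e \in tree_of.2).
Proof.
rewrite !inE; apply: (iffP mapP) => [[p]|[k kL ->]].
  by move=> /mapP [k]; rewrite mem_iota => /andP[_ kL] -> ->; exists k.
by exists (q k, c k) => //; apply/mapP; exists k; rewrite ?mem_iota.
Qed.

Lemma tree_steiner : steiner E W tree_of.
Proof.
have qT k : k < L -> q k \in tree_of.1 by move=> kL; apply/tree_vertexP; right; exists k.
have cT k : k < L -> c k \in tree_of.1 by move=> kL; apply/tree_vertexP; apply: c_in.
have conn x : x \in tree_of.1 -> connect (adjacent tree_of) x r.
  move=> /tree_vertexP [->|[k kL ->]]; first exact: connect0.
  move: k kL; apply: (c_root (Z := fun x => connect (adjacent tree_of) x r)).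
    exact: connect0.
  move=> k kL; apply: connect_trans; apply: connect1.
  by apply/tree_edgeP; exists k.
have sV e : e \in tree_of.2 -> e \subset tree_of.1.
  move=> /tree_edgeP [k kL ->]; apply/subsetP => x; rewrite in_set2 => /orP[] /eqP ->.
    exact: qT.
  exact: cT.
apply/steinerP; split=> //.
- by apply/subsetP => e /tree_edgeP [k kL ->]; apply: c_edge.
- by move=> x y /sV /subsetP h; split; apply: h; rewrite !inE eqxx ?orbT.
have WT w : w \in W -> w \in tree_of.1 by move=> /W_in h; apply/tree_vertexP.
move=> u v uW vW; apply/and3P; split; try exact: WT.
by apply: connect_trans (conn u (WT _ uW)) _; rewrite adjacent_sym; apply/conn/WT.
Qed.

Lemma agree_vertex T k : steiner E W T -> agree T k -> k < L -> q k \in T.1.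
Proof.
move=> /steinerP [_ sV _ cW] aT kL; case: (q_term kL) => [qW|[j jk ej]].
  by case/and3P: (cW _ _ qW qW).
by rewrite -ej; have /andP[/sV []] := aT _ jk.
Qed.

Lemma agree_dec T k : minimal_steiner E W T -> agree T k -> k < L ->
  exists v, dec T (q k) v.
Proof.
move=> mT aT kL; apply: dec_exists (mT) _ (q_root kL).
by case/andP: (mT) => sT _; apply: agree_vertex.
Qed.

(** A solution with the prescribed parents contains [tree_of], which is already a Steiner
    subgraph. *)
Lemma agree_eq T : minimal_steiner E W T -> agree T L -> T = tree_of.
Proof.
move=> mT aT; have /andP[sT _] := mT; have /steinerP [_ sV _ cW] := sT.
symmetry; apply: minimal_proper mT tree_steiner _ _; apply/subsetP => x.
  move=> /tree_vertexP [->|[k kL ->]]; first by case/and3P: (cW _ _ rW rW).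
  by apply: (agree_vertex sT) => // j jk; apply: aT; lia.
by move=> /tree_edgeP [k kL ->]; case/andP: (aT _ kL).
Qed.

(* The vertices below [q k] in the tree are only joined to the others through
   [q k]. *)
Lemma tree_dec_uniq k v : k < L -> dec tree_of (q k) v -> v = c k.
Proof.
move=> kL /andP[/tree_edgeP [j jL ej] cv].
have h1 : q k \in [set q j; c j] by rewrite -ej !inE eqxx.
have h2 : v \in [set q j; c j] by rewrite -ej !inE eqxx orbT.
have h3 : q j \in [set q k; v] by rewrite ej !inE eqxx.
have h4 : c j \in [set q k; v] by rewrite ej !inE eqxx orbT.
case: (eqVneq (q k) (q j)) => [eq|ne].
  have ekj := q_inj kL jL eq; subst j; move: h2 h4; rewrite !inE.
  by case/orP=> /eqP -> //; case/orP=> /eqP ->.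
move: h1 h2 h3; rewrite !inE (negbTE ne) /= eq_sym => /eqP ec _.
rewrite eq_sym (negbTE ne) /= => /eqP ev; exfalso.
(* [D x] says that [q k] is among [x] and its iterated parents. This is preserved along edges that
   avoid [q k], but fails at [r]. *)
pose D x := forall G : 'I_n -> Prop, (forall i, i < L -> G (q i) -> G (c i)) ->
  G x -> G (q k).
suff Dr : D r.
  have /eqP := q_root kL; apply; apply: (Dr (fun x => x = r)) => // i iL e.
  by have := q_root iL; rewrite e eqxx.
apply: (@connect_invariant _ _ D _ _ cv).
  by move=> G Gc Gv; rewrite -ec; apply: Gc => //; rewrite ev.
move=> x y Dx /and3P[xk yk /tree_edgeP [i iL ei]].
have h5 : x \in [set q i; c i] by rewrite -ei !inE eqxx.
have h6 : y \in [set q i; c i] by rewrite -ei !inE eqxx orbT.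
have h7 : q i \in [set x; y] by rewrite ei !inE eqxx.
have h8 : c i \in [set x; y] by rewrite ei !inE eqxx orbT.
move=> G Gc Gy; case: (eqVneq (q i) y) => [e1|ne1].
  subst y; move: h5; rewrite !inE => /orP[] /eqP e2; first by apply: Dx => //; rewrite e2.
  by apply: Dx => //; rewrite e2; apply: Gc.
move: h7; rewrite !inE (negbTE ne1) orbF => /eqP e1; subst x.
move: h6; rewrite !inE eq_sym (negbTE ne1) /= => /eqP e2.
(* Step from [x] to its parent [y]: [G] enlarged by [x] is still closed under parents, and [x] is
   not [q k]. *)
case: (Dx (fun z => G z \/ z = q i)); last by move=> e; rewrite e eqxx in xk.
- move=> i' iL' [Gi'|/(q_inj iL' iL) ->]; left; last by rewrite -e2.
  exact: Gc.
- by right.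
- by [].
Qed.

Lemma dec_sub (T T' : subgraph n) u v : T.2 \subset T'.2 -> dec T u v -> dec T' u v.
Proof.
move=> /subsetP s2 /andP[uv vr]; apply/andP; split; first exact: s2.
apply: connect_sub vr => x y /and3P[xu yu xy]; apply: connect1.
by rewrite /avoid /= xu yu s2.
Qed.

(** Take a minimal Steiner subgraph [T] of the tree. Its parents are parents in the tree, where they
    are unique, so position by position [T] agrees with the configuration, and it is the whole
    tree. *)
Lemma tree_minimal : minimal_steiner E W tree_of.
Proof.
have [T [mT s1 s2]] := exists_minimal tree_steiner.
suff aT : agree T L by rewrite -(agree_eq mT aT).
suff H k : k <= L -> agree T k by apply: H.
elim: k => // k IH kL j; rewrite ltnS leq_eqVlt => /orP[/eqP ->|jk]; last first.
  by apply: IH jk; lia.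
have [v dv] := agree_dec mT (IH (ltnW kL)) kL.
by have := tree_dec_uniq kL (dec_sub s2 dv) => <-.
Qed.

Lemma tree_dec k : k < L -> dec tree_of (q k) (c k).
Proof.
move=> kL; have qT : q k \in tree_of.1 by apply/tree_vertexP; right; exists k.
have [v dv] := dec_exists tree_minimal qT (q_root kL).
by rewrite -(tree_dec_uniq kL dv).
Qed.

Lemma tree_encoded :
  lists_vertices tree_of.1 tree_vertices /\ lists_edges tree_of.2 tree_edges.
Proof.
have uv : uniq tree_vertices.
  rewrite /tree_vertices /=; apply/andP; split.
    apply/mapP => [[k]]; rewrite mem_iota => /andP[_ kL] e.
    by have := q_root kL; rewrite e eqxx.
  rewrite map_inj_in_uniq ?iota_uniq // => i j.
  by rewrite !mem_iota => /andP[_ iL] /andP[_ jL]; apply: q_inj.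
have ue : uniq [seq [set e.1; e.2] | e <- tree_edges].
  rewrite -map_comp map_inj_in_uniq ?iota_uniq // => i j.
  rewrite !mem_iota => /andP[_ iL] /andP[_ jL] /= e; rewrite add0n in iL jL.
  apply/eqP/negPn/negP => ne.
  have qne : q i != q j by apply: contra ne => /eqP /(q_inj iL jL) ->.
  have h1 : q i \in [set q j; c j] by rewrite -e !inE eqxx.
  have h2 : q j \in [set q i; c i] by rewrite e !inE eqxx.
  move: h1 h2; rewrite !inE (negbTE qne) [q j == q i]eq_sym (negbTE qne) /=.
  move=> /eqP e1 /eqP e2.
  (* Two positions with the same edge would be each other's parents; but the walk from [q j] to [r]
     that avoids [q i] starts with the parent of [q j], which is [q i]. *)
  have /andP[_ di] := tree_dec iL; rewrite -e2 in di.
  have [v [av dv cv]] := dec_step (@avoid_sub _ _) di (q_root jL).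
  have ev := tree_dec_uniq jL dv; case/and3P: av => _.
  by rewrite ev e1 eqxx.
by split; (apply: uniq_perm; [|exact: enum_uniq|move=> x; rewrite mem_enum in_set]).
Qed.

End Configuration.
End SteinerTrees.

(** * Linked lists and depth-first search *)

Lemma updE f i v j : upd f i v j = if j == i then v else f j.
Proof. by []. Qed.

Lemma upd_same f i v : upd f i v i = v.
Proof. by rewrite /upd eqxx. Qed.

Lemma upd_other f i v j : j <> i -> upd f i v j = f j.
Proof. by rewrite /upd => /eqP /negbTE ->. Qed.

Lemma sum_ord_update n (f g : nat -> nat) x : x < n ->
  (forall v, v < n -> v <> x -> f v = g v) ->
  \sum_(v < n) f v + g x = \sum_(v < n) g v + f x.
Proof.
move=> xn e; rewrite (bigD1 (Ordinal xn)) //= [in RHS](bigD1 (Ordinal xn)) //=.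
rewrite (eq_bigr (fun v : 'I_n => g v)); first by lia.
by move=> i /eqP ne; apply: e => // ei; apply: ne; apply: val_inj.
Qed.

Section Lists.

Variables HD NX : nat -> nat.

Fixpoint lst_fuel (k c : nat) : seq nat :=
  if k is k'.+1 then if c == 0 then [::] else HD c :: lst_fuel k' (NX c) else [::].

(* The list starting at the cell [c]; the links are decreasing, so that [c] steps
   are enough. *)
Definition lst (c : nat) : seq nat := lst_fuel c c.

Variable m2 : nat.
Hypothesis NX_lt : forall c, 0 < c <= m2 -> NX c < c.

Lemma lst_fuelE k c : c <= k -> c <= m2 -> lst_fuel k c = lst c.
Proof.
rewrite /lst; have [d le_d] := ubnP c; elim: d c k le_d => // d IH [|c] [|k] //= le_d ck cm.
have lt : NX c.+1 < c.+1 by apply: NX_lt; lia.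
by rewrite (IH _ k) ?(IH _ c) //; lia.
Qed.

Lemma lst_cons c : 0 < c <= m2 -> lst c = HD c :: lst (NX c).
Proof.
case: c => // c cm; rewrite {1}/lst /= lst_fuelE //; have := NX_lt cm; lia.
Qed.

End Lists.

Lemma lst_ext HD NX HD' NX' m2 c : (forall c, 0 < c <= m2 -> NX c < c) ->
  (forall c, 0 < c <= m2 -> HD' c = HD c /\ NX' c = NX c) -> c <= m2 ->
  lst HD' NX' c = lst HD NX c.
Proof.
move=> lt e cm; rewrite /lst.
suff H k : lst_fuel HD' NX' k c = lst_fuel HD NX k c by apply: H.
elim: k c cm => // k IH [|c] //= cm.
have [-> ->] : HD' c.+1 = HD c.+1 /\ NX' c.+1 = NX c.+1 by apply: e; lia.
by rewrite IH //; have := lt c.+1; lia.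
Qed.

(** * Invariants of the search: marks, potential and low points *)

Section Search.

Variables (n m2 : nat) (HD NX HE : nat -> nat).
Hypothesis NX_lt : forall c, 0 < c <= m2 -> NX c < c.
Hypothesis HD_lt : forall c, 0 < c <= m2 -> HD c < n.
Hypothesis HE_le : forall v, v < n -> HE v <= m2.

Definition nb (v : nat) : seq nat := lst HD NX (HE v).

Hypothesis nb_sym : forall x y, x < n -> y \in nb x -> y < n /\ x \in nb y.

Definition low_count (P : nat -> nat) : nat := \sum_(v < n) (P v < 2).

(** One unit for each cell still to be scanned. A vertex not yet entered also holds 2 units for its
    push and pop, and [size (nb v)] more: if it is a blocked position, these pay for one run over
    its list of remaining choices before it is released. *)
Definition wt (P T : nat -> nat) (v : nat) : nat :=
  size (lst HD NX (T v)) + (if P v < 2 then 2 + size (nb v) else 0).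

Definition pot (P T : nat -> nat) : nat := \sum_(v < n) wt P T v.

(** The mark [P x] is 0 for an unvisited vertex, 1 for a blocked one, 2 for a source, and from 3 on
    a discovery number. [A] holds the search parents, [T x] the next cell to scan in the list of
    [x], [S] the stack. When the stack is empty, [b_stk] and [b_scan] say that no vertex reached has
    an unvisited neighbour. *)
Record base (P A T S : nat -> nat) (sp cnt : nat) : Prop := {
  b_sp : forall i, i < sp -> S i < n /\ 2 <= P (S i);
  b_room : sp + low_count P <= n;
  b_cnt : cnt + low_count P <= n + 3;
  b_cnt3 : 3 <= cnt;
  b_T : forall x, x < n -> T x <= m2;
  b_sub : forall x y, x < n -> y \in lst HD NX (T x) -> y \in nb x;
  b_unv : forall x, x < n -> P x < 2 -> T x = HE x;
  b_scan : forall x y, x < n -> 2 <= P x -> y \in nb x ->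
    P y <> 0 \/ y \in lst HD NX (T x);
  b_stk : forall x, x < n -> 2 <= P x -> T x <> 0 -> exists2 i, i < sp & S i = x;
  b_par : forall x, x < n -> 3 <= P x -> [/\ A x < n, A x \in nb x & 2 <= P (A x) < P x];
  b_lt : forall x, x < n -> P x < cnt
}.

(** The parent edge of [v] separates it from the sources: [I] is the subtree of [v], left only
    through that edge, and the last clause says that [v] is [x] or an iterated parent of [x], for
    each [x] in [I]. *)
Definition bridge (P A : nat -> nat) (v : nat) : Prop :=
  exists I : nat -> Prop, [/\ I v, forall x, I x -> x < n /\ 3 <= P x,
    forall x y, I x -> y \in nb x -> ~ I y -> x = v /\ y = A v &
    forall x, I x -> forall G : nat -> Prop,
      (forall y, y < n -> 3 <= P y -> G y -> G (A y)) -> G x -> G v].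

(** Reachability of [v] from the sources without its parent edge, in the form of an intersection of
    closed sets. *)
Definition nonbridge (P A : nat -> nat) (v : nat) : Prop :=
  forall Z : nat -> Prop, (forall x, x < n -> P x = 2 -> Z x) ->
    (forall x y, x < n -> y \in nb x -> Z y -> ~ (x = v /\ y = A v) -> Z x) -> Z v.

(** Tarjan's low points. All sources share the mark 2, as if they were contracted, so the order in
    [l_ord] is strict only above 2. While [S i] is on the stack, the vertices numbered from
    [P (S i)] on are its descendants ([l_int]). [l_low] makes [Lw (S i)] answer only for vertices
    numbered before the later stack entries; the others are charged to those entries until they are
    popped. *)
Record lowinv (P A Lw T S : nat -> nat) (sp : nat) : Prop := {
  l_no1 : forall x, x < n -> P x <> 1;
  l_ord : forall i j, i < j -> j < sp ->
    P (S i) <= P (S j) /\ (3 <= P (S j) -> P (S i) < P (S j));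
  l_par : forall j, j < sp -> 3 <= P (S j) -> 0 < j /\ S j.-1 = A (S j);
  l_int : forall i x, i < sp -> 3 <= P (S i) -> x < n -> P (S i) <= P x ->
    x = S i \/ P (S i) <= P (A x);
  l_le : forall i, i < sp -> 3 <= P (S i) -> 0 < Lw (S i) <= P (S i);
  l_wit : forall i, i < sp -> 3 <= P (S i) -> Lw (S i) < P (S i) ->
    exists x y, [/\ x < n, P (S i) <= P x, y \in nb x, y <> A x & P y = Lw (S i)];
  l_low : forall i x y, i < sp -> 3 <= P (S i) -> x < n -> P (S i) <= P x ->
    (forall j, i < j < sp -> P x < P (S j)) -> y \in nb x -> y <> A x ->
    y \in lst HD NX (T x) \/ Lw (S i) <= P y;
  l_done : forall v, v < n -> 3 <= P v -> (forall i, i < sp -> S i <> v) ->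
    (Lw v < P v -> nonbridge P A v) /\ (P v <= Lw v -> bridge P A v)
}.

Lemma nb_lt x y : x < n -> y \in nb x -> y < n.
Proof. by move=> xn /(nb_sym xn) []. Qed.

Lemma bridge_stable P A P' A' v :
  (forall x, P x <> 0 -> P' x = P x /\ A' x = A x) -> P v <> 0 ->
  bridge P A v -> bridge P' A' v.
Proof.
move=> st Pv [I [Iv I3 Ie Ic]]; exists I; have [_ eA] := st _ Pv; split=> //.
- by move=> x /I3 [xn Px]; have [-> _] : P' x = P x /\ A' x = A x by apply: st; lia.
- by rewrite eA.
- move=> x Ix G Gc; apply: Ic => // y yn Py.
  have [eP <-] : P' y = P y /\ A' y = A y by apply: st; lia.
  by apply: Gc; lia.
Qed.

Lemma nonbridge_stable P A P' A' v :
  (forall x, P x <> 0 -> P' x = P x /\ A' x = A x) -> P v <> 0 ->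
  nonbridge P A v -> nonbridge P' A' v.
Proof.
move=> st Pv nB Z Z2 Zc; apply: nB => [x xn Px|x y xn xy Zy ne].
  by apply: Z2 => //; have [-> _] : P' x = P x /\ A' x = A x by apply: st; lia.
by apply: Zc xy Zy _ => //; have [_ ->] := st _ Pv.
Qed.

Lemma pot_visit P T w k : w < n -> P w < 2 -> 2 <= k ->
  pot (upd P w k) T + (2 + size (nb w)) = pot P T.
Proof.
move=> wn Pw k2; have e := @sum_ord_update n (wt P T) (wt (upd P w k) T) w wn.
have e1 : wt (upd P w k) T w = size (lst HD NX (T w)).
  by rewrite /wt upd_same ltnNge k2 addn0.
have e2 : wt P T w = size (lst HD NX (T w)) + (2 + size (nb w)) by rewrite /wt Pw.
rewrite /pot; move: e; rewrite e1 e2.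
have h : forall v, v < n -> v <> w -> wt P T v = wt (upd P w k) T v.
  by move=> v _ ne; rewrite /wt upd_other.
by move=> /(_ h); lia.
Qed.

Section Step.

Variables (P A Lw T S : nat -> nat) (sp cnt : nat).
Hypothesis sp_gt0 : 0 < sp.
Hypothesis Hb : base P A T S sp cnt.

Let v := S sp.-1.

Lemma top_lt : v < n. Proof. by have [|] := b_sp Hb (i := sp.-1) => //; lia. Qed.
Lemma top_P : 2 <= P v. Proof. by have [|] := b_sp Hb (i := sp.-1) => //; lia. Qed.

Lemma base_pop : T v = 0 -> base P A T S sp.-1 cnt.
Proof.
move=> Tv; case: (Hb) => h1 h2 h3 h4 h5 h5' h6 h7 h8 h9 h10; split=> //.
- by move=> i hi; apply: h1; lia.
- by lia.
- move=> x xn Px Tx; have [i hi ei] := h8 _ xn Px Tx; exists i => //.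
  by have [e|] := eqVneq i sp.-1; [subst i; rewrite -ei in Tx; case: Tx | lia].
Qed.

(** The low point is attained by an edge from the subtree of [v] to a vertex [y] with a smaller
    number. Tree edges join [y] to a source through numbers below [P v], and inside the subtree they
    lead up to [v]. *)
Lemma low_nonbridge : lowinv P A Lw T S sp -> 3 <= P v -> Lw v < P v -> nonbridge P A v.
Proof.
move=> Hl Pv Lv Z Z2 Zc; have vn := top_lt; have hi : sp.-1 < sp by lia.
have [x [y [xn Px xy ne Py]]] := l_wit Hl hi Pv Lv.
have yn := nb_lt xn xy; have L0 := l_le Hl hi Pv; have N1 := l_no1 Hl yn.
rewrite -/v in Px Py L0.
have below z : z < n -> 2 <= P z < P v -> Z z.
  have [d le_d] := ubnP (P z); elim: d z le_d => // d IH z le_d zn Pz.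
  have [e2|ne2] := eqVneq (P z) 2; first exact: Z2.
  have [|An Ab PA] := b_par Hb zn; first by lia.
  apply: (Zc z (A z)) => //; first by apply: IH; lia.
  by move=> [e _]; subst z; lia.
have above z : z < n -> P v <= P z -> Z z -> Z v.
  have [d le_d] := ubnP (P z); elim: d z le_d => // d IH z le_d zn Pz Zz.
  have [|An Ab PA] := b_par Hb zn; first by lia.
  have [e|Pa] := l_int Hl hi Pv zn Pz; first by rewrite e in Zz.
  apply: (IH (A z)) => //; first by lia.
  have [_ zA] := nb_sym zn Ab; apply: (Zc (A z) z) => // [[e1 e2]].
  have [|_ _] := b_par Hb vn; first by lia.
  by rewrite -e2; lia.
apply: (above x) => //; apply: (Zc x y) => //; first by apply: below => //; lia.
by move=> [e1 e2]; subst x.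
Qed.

(** As [v] is on top of the stack, the vertices numbered from [P v] on form its subtree, and their
    lists are exhausted because only stack vertices have cells left. With a low point not below
    [P v], the parent edge is the only way out. *)
Lemma low_bridge : lowinv P A Lw T S sp -> T v = 0 -> 3 <= P v -> P v <= Lw v ->
  bridge P A v.
Proof.
move=> Hl Tv Pv Lv; have vn := top_lt; have hi : sp.-1 < sp by lia.
exists (fun x => x < n /\ P v <= P x); split=> //.
- by move=> x [xn Px]; split=> //; lia.
- move=> x y [xn Px] xy ny; have yn := nb_lt xn xy.
  have Py : P y < P v by rewrite ltnNge; apply/negP => h; apply: ny.
  have Tx : T x = 0.
    apply/eqP/negPn/negP => /eqP Tx; have [|i hi' ei] := b_stk Hb xn _ Tx; first by lia.
    have [e|ne] := eqVneq i sp.-1; first by apply: Tx; rewrite -ei e.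
    have [|_] := l_ord Hl (_ : i < sp.-1) hi; first by lia.
    by rewrite ei -/v; lia.
  have eA : y = A x.
    have hj' j : sp.-1 < j < sp -> P x < P (S j) by lia.
    apply: NNPP => ne; have [|] := l_low Hl hi Pv xn Px hj' xy ne; first by rewrite Tx.
    by rewrite -/v; lia.
  have [e|] := l_int Hl hi Pv xn Px; first by rewrite eA e.
  by rewrite -eA -/v; lia.
move=> x [xn Px] G Gc; have [d le_d] := ubnP (P x); elim: d x le_d xn Px => // d IH x le_d xn Px Gx.
have [|An Ab PA] := b_par Hb xn; first by lia.
have [e|Pa] := l_int Hl hi Pv xn Px; first by rewrite e in Gx.
by apply: (IH (A x)); [lia | | | apply: Gc => //; lia].
Qed.

Lemma low_pop_root : lowinv P A Lw T S sp -> T v = 0 -> P v = 2 ->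
  lowinv P A Lw T S sp.-1.
Proof.
move=> Hl Tv Pv; case: (Hl) => g1 g2 g3 g4 g5 g6 g7 g8; split=> //.
- by move=> i j ij hj; apply: g2 => //; lia.
- by move=> j hj; apply: g3; lia.
- by move=> i x hi; apply: g4; lia.
- by move=> i hi; apply: g5; lia.
- by move=> i hi; apply: g6; lia.
- move=> i x y hi Pi xn Px hj; apply: g7 => //; first by lia.
  move=> j hj'; have [e|ne] := eqVneq j sp.-1; last by apply: hj; lia.
  have hi0 : sp.-1 < sp by lia.
  by have [a _] := g2 _ _ hi hi0; rewrite -/v in a; lia.
- move=> x xn Px hx; apply: g8 => // i hi e; have [ei|ne] := eqVneq i sp.-1.
    by move: Px; rewrite -e ei -/v Pv.
  by apply: (hx i) => //; lia.
Qed.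

Lemma low_pop Lw' : lowinv P A Lw T S sp -> T v = 0 -> 3 <= P v ->
  (forall x, x <> A v -> Lw' x = Lw x) -> Lw' (A v) = minn (Lw (A v)) (Lw v) ->
  lowinv P A Lw' T S sp.-1.
Proof.
move=> Hl Tv Pv eL eLA; have vn := top_lt; have hi0 : sp.-1 < sp by lia.
have [sp1 eu] := l_par Hl hi0 Pv; rewrite -/v in eu.
have [An Ab PA] := b_par Hb vn Pv.
case: (Hl) => g1 g2 g3 g4 g5 g6 g7 g8.
have ne_i i : i < sp.-2 -> 3 <= P (S i) -> S i <> A v.
  move=> hi Pi e; have hs : sp.-2 < sp by lia.
  by have [a b] := g2 _ _ hi hs; rewrite eu -e in a b; lia.
have ei i : i < sp.-1 -> ~ i < sp.-2 -> i = sp.-2 by lia.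
have L_le i : i < sp.-1 -> 3 <= P (S i) -> Lw' (S i) <= Lw (S i).
  move=> hi Pi; have [e|/eqP ne] := eqVneq (S i) (A v); last by rewrite eL.
  by rewrite e eLA geq_minl.
split=> //.
- by move=> i j ij hj; apply: g2 => //; lia.
- by move=> j hj; apply: g3; lia.
- by move=> i x hi; apply: g4; lia.
- move=> i hi Pi; have := g5 i _ Pi; have := L_le i hi Pi.
  have [e|/eqP ne] := eqVneq (S i) (A v); last by rewrite eL //; lia.
  have := g5 _ hi0 Pv; rewrite -/v e eLA; lia.
- move=> i hi Pi Li; have [e|/eqP ne] := eqVneq (S i) (A v); last first.
    by rewrite eL // in Li *; apply: g6 => //; lia.
  rewrite e eLA in Li *.
  have [lt|le] := ltnP (Lw v) (Lw (A v)); last first.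
    move: Li; rewrite (minn_idPl le) -e => Li; apply: g6 => //; lia.
  have := g5 i _ Pi; rewrite e => /(_ (leq_trans hi (leq_pred _))) hA.
  have [|x [y [xn Px xy ne Py]]] := g6 _ hi0 Pv; first by rewrite -/v; lia.
  exists x, y; rewrite -/v in Px Py; split=> //; lia.
- move=> i x y hi Pi xn Px hj xy ne.
  (* A vertex in the subtree of [v] is now charged to the parent of [v], the new top of the stack,
     which has absorbed the low point of [v]. *)
  have [hx|hx] := leqP (P v) (P x).
    have hi2 : i = sp.-2.
      apply: ei hi _ => lt; have lt2 : i < sp.-2 < sp.-1 by lia.
      by have := hj _ lt2; rewrite eu; lia.
    subst i; rewrite eu.
    have hj' j : sp.-1 < j < sp -> P x < P (S j) by lia.
    have [h|h] := g7 sp.-1 x y hi0 Pv xn hx hj' xy ne; first by left.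
    by right; rewrite eLA; apply: leq_trans (geq_minr _ _) h.
  have hi' : i < sp by lia.
  have hj' j : i < j < sp -> P x < P (S j).
    move=> hj'; have [->|nj] := eqVneq j sp.-1; first exact: hx.
    by apply: hj; lia.
  have [h|h] := g7 i x y hi' Pi xn Px hj' xy ne; first by left.
  by right; apply: leq_trans h; apply: L_le.
- move=> x xn Px hx; have [->|/eqP nx] := eqVneq x v.
    rewrite eL; last by move=> e; rewrite -e in PA; lia.
    by split=> h; [apply: low_nonbridge | apply: low_bridge].
  rewrite eL; last by rewrite -eu => e; apply: (hx sp.-2) => //; lia.
  apply: g8 => // i hi e; have [ei'|ne] := eqVneq i sp.-1; first by apply: nx; rewrite -e ei'.
  by apply: (hx i) => //; lia.
Qed.

Section Scan.

Hypothesis Tv : T v <> 0.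
Let c := T v.
Let w := HD c.

Lemma cell_ok : 0 < c <= m2.
Proof. by have := b_T Hb top_lt; rewrite /c; lia. Qed.

Lemma lst_cell : lst HD NX (T v) = w :: lst HD NX (NX c).
Proof. exact: lst_cons NX_lt _ cell_ok. Qed.

Lemma w_lt : w < n. Proof. exact: HD_lt cell_ok. Qed.

Lemma base_scan : P w <> 0 -> base P A (upd T v (NX c)) S sp cnt.
Proof.
move=> Pw; case: (Hb) => h1 h2 h3 h4 h5 h5' h6 h7 h8 h9 h10; split=> //.
- move=> x xn; rewrite updE; case: eqP => // _; last exact: h5.
  by have := NX_lt cell_ok; have := cell_ok; lia.
- by move=> x y xn; rewrite updE; case: eqP => [->|_] hy; apply: h5';
    rewrite ?top_lt ?lst_cell ?inE ?hy ?orbT.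
- move=> x xn Px; rewrite upd_other; first exact: h6.
  by move=> e; subst x; have := top_P; lia.
- move=> x y xn Px xy; have [|] := h7 _ _ xn Px xy; first by left.
  rewrite updE; case: eqP => [->|_]; last by right.
  by rewrite lst_cell inE => /orP[/eqP ->|]; [left | right].
- move=> x xn Px; rewrite updE; case: eqP => [->|_]; last exact: h8.
  by exists sp.-1; [lia|].
Qed.

Lemma low_count_new : P w = 0 -> low_count P = (low_count (upd P w cnt)).+1.
Proof.
move=> Pw; have c3 := b_cnt3 Hb.
have e := @sum_ord_update n (fun v => P v < 2 : nat) (fun v => upd P w cnt v < 2 : nat) w w_lt.
rewrite /= upd_same Pw in e; rewrite /low_count.
have {}e := e (fun x _ ne => congr1 (fun y => nat_of_bool (y < 2)) (esym (upd_other P cnt ne))).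
by have ec : (cnt < 2) = false by [lia]; rewrite ec addn0 addn1 in e.
Qed.

Lemma base_new : P w = 0 ->
  base (upd P w cnt) (upd A w v) (upd T v (NX c)) (upd S sp w) sp.+1 cnt.+1.
Proof.
move=> Pw; have lc := low_count_new Pw; have wn := w_lt; have vn := top_lt; have Pv := top_P.
case: (Hb) => h1 h2 h3 h4 h5 h5' h6 h7 h8 h9 h10.
have vw : v <> w by move=> e; rewrite e in Pv; lia.
split=> //.
- move=> i hi; rewrite (updE S); case: eqP => [_|ne]; first by rewrite upd_same; lia.
  have [a b] : S i < n /\ 2 <= P (S i) by apply: h1; lia.
  by split=> //; rewrite upd_other // => e; rewrite e in b; lia.
- by lia.
- by lia.
- by lia.
- move=> x xn; rewrite updE; case: eqP => // _; last exact: h5.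
  by have := NX_lt cell_ok; have := cell_ok; lia.
- by move=> x y xn; rewrite updE; case: eqP => [->|_] hy; apply: h5';
    rewrite ?top_lt ?lst_cell ?inE ?hy ?orbT.
- move=> x xn; rewrite (updE P); case: eqP => [_|ne Px]; first by lia.
  by rewrite upd_other; [exact: h6 | move=> e; subst x; lia].
- move=> x y xn; rewrite (updE P); case: eqP => [-> _|ne Px] xy.
    by right; rewrite upd_other; [rewrite h6 // Pw | exact: nesym].
  rewrite updE; case: eqP => [_|ney]; first by left; lia.
  have [|] := h7 _ _ xn Px xy; first by left.
  rewrite updE; case: eqP => [->|_]; last by right.
  by rewrite lst_cell inE => /orP[/eqP //|]; right.
- move=> x xn; rewrite (updE P); case: eqP => [-> _ _|ne Px].
    by exists sp; [lia | rewrite upd_same].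
  have ex : (exists2 i, i < sp & S i = x) -> exists2 i, i < sp.+1 & upd S sp w i = x.
    by move=> [i hi <-]; exists i; [lia | rewrite upd_other //; lia].
  rewrite updE; case: eqP => [->|_ Tx]; last by apply: ex; apply: h8.
  by move=> _; exists sp.-1; [lia | rewrite upd_other //; lia].
- move=> x xn; rewrite (updE P w cnt x); case: eqP => [-> _|ne Px].
    rewrite upd_same upd_other //; split=> //; last by have := h10 _ vn; lia.
    by have [] // := nb_sym vn (y := w); apply: h5' => //; rewrite lst_cell mem_head.
  have [a b e] := h9 _ xn Px; rewrite [upd A _ _ _]upd_other //; split=> //.
  by rewrite upd_other // => e'; rewrite e' Pw in e.
- move=> x xn; rewrite updE; case: eqP => [_|_]; first by lia.
  by have := h10 _ xn; lia.
Qed.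

Lemma pot_scan : pot P (upd T v (NX c)) + 1 = pot P T.
Proof.
have e := @sum_ord_update n (wt P T) (wt P (upd T v (NX c))) v top_lt.
have e1 : wt P (upd T v (NX c)) v = size (lst HD NX (NX c)).
  by rewrite /wt upd_same ltnNge top_P addn0.
have e2 : wt P T v = (size (lst HD NX (NX c))).+1.
  by rewrite /wt lst_cell ltnNge top_P addn0.
rewrite /pot; move: e; rewrite e1 e2.
have h : forall x, x < n -> x <> v -> wt P T x = wt P (upd T v (NX c)) x.
  by move=> x _ ne; rewrite /wt upd_other.
by move=> /(_ h); lia.
Qed.

Lemma pot_new : P w = 0 -> pot (upd P w cnt) (upd T v (NX c)) + 3 <= pot P T.
Proof.
move=> Pw; have := pot_scan; have := b_cnt3 Hb.
by have := @pot_visit P (upd T v (NX c)) w cnt w_lt; rewrite Pw; lia.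
Qed.

Lemma w_nb : w \in nb v.
Proof. by apply: (b_sub Hb top_lt); rewrite lst_cell mem_head. Qed.

Lemma low_scan Lw' : lowinv P A Lw T S sp -> P w <> 0 ->
  (forall x, x <> v -> Lw' x = Lw x) -> (w = A v -> Lw' v = Lw v) ->
  (w <> A v -> Lw' v = minn (Lw v) (P w)) ->
  lowinv P A Lw' (upd T v (NX c)) S sp.
Proof.
move=> Hl Pw eL eA nA; have vn := top_lt; case: (Hl) => g1 g2 g3 g4 g5 g6 g7 g8.
have L_le i : Lw' (S i) <= Lw (S i).
  have [->|/eqP ne] := eqVneq (S i) v; last by rewrite eL.
  by case: (eqVneq w (A v)) => [/eA ->|/eqP /nA ->] //; apply: geq_minl.
split=> //.
- move=> i hi Pi; have := g5 i hi Pi; have := L_le i.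
  have [->|/eqP ne] := eqVneq (S i) v; last by rewrite eL.
  by case: (eqVneq w (A v)) => [/eA ->|/eqP /nA ->]; lia.
- move=> i hi Pi; have [e|/eqP ne] := eqVneq (S i) v; last by rewrite eL //; apply: g6.
  have := g6 i hi Pi; rewrite e; case: (eqVneq w (A v)) => [/eA -> //|/eqP ne].
  rewrite nA //; have [lt|le] := ltnP (P w) (Lw v); last by apply.
  by move=> _ _; exists v, w; split=> //; exact: w_nb.
- move=> i x y hi Pi xn Px hj xy ne.
  have [|h] := g7 i x y hi Pi xn Px hj xy ne; last first.
    by right; apply: leq_trans h; apply: L_le.
  rewrite updE; case: eqP => [ex|_]; last by left.
  subst x; rewrite lst_cell inE => /orP[/eqP ey|]; last by left.
  right; have : i = sp.-1.
    by apply/eqP/negPn/negP => ni; have := hj sp.-1; rewrite -/v; lia.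
  by move=> ->; rewrite -/v ey nA -?ey // geq_minr.
- move=> x xn Px hx; rewrite eL; first exact: g8.
  by move=> e; apply: (hx sp.-1) => //; lia.
Qed.

(** [cnt] exceeds every number given so far: the new vertex is a leaf whose low point is its own
    number, and the edge leading to it cannot lower another low point. *)
Lemma low_new : lowinv P A Lw T S sp -> P w = 0 ->
  lowinv (upd P w cnt) (upd A w v) (upd Lw w cnt) (upd T v (NX c)) (upd S sp w) sp.+1.
Proof.
move=> Hl Pw; have vn := top_lt; case: (Hl) => g1 g2 g3 g4 g5 g6 g7 g8.
have Sw i : i < sp -> S i <> w by move=> hi e; have [_] := b_sp Hb hi; rewrite e Pw.
have eS i : i < sp -> upd S sp w i = S i by move=> hi; rewrite upd_other //; lia.
have eP i : i < sp -> upd P w cnt (S i) = P (S i) by move=> hi; rewrite upd_other //; exact: Sw.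
have ePx x : P x <> 0 -> upd P w cnt x = P x by move=> Px; rewrite upd_other // => e; subst x.
have c3 := b_cnt3 Hb.
have Pc x : x < n -> P x < cnt by move=> xn; apply: (b_lt Hb).
have Sn i : i < sp -> S i < n by move=> hi; case: (b_sp Hb hi).
have gew x : x < n -> cnt <= upd P w cnt x -> x = w.
  by move=> xn; rewrite updE; case: eqP => // _; have := Pc x xn; lia.
have vw : v <> w by apply: Sw; lia.
have P'v : upd P w cnt v = P v by apply: eP; lia.
have top i : i < sp -> P (S i) <= P v.
  move=> hi; have [e|ne] := eqVneq i sp.-1; first by rewrite e.
  have h1 : i < sp.-1 by lia.
  have h2 : sp.-1 < sp by lia.
  by have [] := g2 _ _ h1 h2.
split.
- by move=> x xn; rewrite updE; case: eqP => _; [lia | exact: g1].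
- move=> i j ij; rewrite ltnS leq_eqVlt => /orP[/eqP ej|hj].
    subst j; rewrite upd_same upd_same eS // eP //; have := Pc _ (Sn i ij); lia.
  rewrite !eS ?eP //; try lia.
  by apply: g2.
- move=> j; rewrite ltnS leq_eqVlt => /orP[/eqP ej|hj].
    by subst j; rewrite !upd_same eS //; lia.
  rewrite eS // eP // => Pj; have [h1 h2] := g3 j hj Pj; rewrite eS; last by lia.
  by rewrite h2 upd_other //; apply: Sw.
- move=> i x; rewrite ltnS leq_eqVlt => /orP[/eqP ei|hi].
    by subst i; rewrite !upd_same => _ xn /(gew x xn); left.
  rewrite eS // eP // => Pi xn; have [->|/eqP xw] := eqVneq x w.
    by rewrite !upd_same P'v; right; apply: top.
  rewrite upd_other // [upd A _ _ _]upd_other // => Px.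
  have [|h] := g4 i x hi Pi xn Px; first by left.
  by right; rewrite ePx //; lia.
- move=> i; rewrite ltnS leq_eqVlt => /orP[/eqP ei|hi].
    by subst i; rewrite !upd_same; lia.
  rewrite eS // eP // upd_other; first by apply: g5.
  exact: Sw.
- move=> i; rewrite ltnS leq_eqVlt => /orP[/eqP ei|hi].
    by subst i; rewrite !upd_same; lia.
  rewrite eS // eP // upd_other; last exact: Sw.
  move=> Pi Li; have [x [y [xn Px xy ne Py]]] := g6 i hi Pi Li.
  have := g5 i hi Pi => hL.
  exists x, y; split=> //.
  + by rewrite ePx //; lia.
  + by rewrite upd_other // => e; subst x; lia.
  + by rewrite ePx //; lia.
- move=> i x y; rewrite ltnS leq_eqVlt => /orP[/eqP ei|hi].
    subst i; rewrite !upd_same => _ xn /(gew x xn) -> _ hy _; left.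
    by rewrite upd_other; [rewrite (b_unv Hb w_lt) ?Pw | exact: nesym].
  rewrite eS // eP // [upd Lw _ _ _]upd_other; last exact: Sw.
  move=> Pi xn; have [->|/eqP xw] := eqVneq x w.
    by rewrite upd_same => _ /(_ sp); rewrite !upd_same; lia.
  rewrite upd_other // [upd A _ _ _]upd_other // => Px hj xy ne.
  have hL := g5 i hi Pi.
  have hj' j : i < j < sp -> P x < P (S j).
    by move=> hj'; have := hj j; rewrite eS ?eP; lia.
  have [|h] := g7 i x y hi Pi xn Px hj' xy ne.
  + rewrite updE; case: eqP => [ex|_]; last by left.
    subst x; rewrite lst_cell inE => /orP[/eqP ey|]; last by left.
    by right; rewrite ey upd_same; have := Pc _ (Sn i hi); lia.
  + by right; rewrite ePx //; lia.
- move=> x xn; rewrite (updE P); case: eqP => [-> _ /(_ sp)|ne Px hx].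
    by rewrite upd_same; case=> //; lia.
  rewrite upd_other //.
  have [|h1 h2] := g8 x xn Px.
    by move=> i hi e; apply: (hx i); [lia | rewrite eS].
  have st z : P z <> 0 -> upd P w cnt z = P z /\ upd A w v z = A z.
    by move=> Pz; rewrite ePx // upd_other // => e; subst z.
  split=> h.
    by apply: (nonbridge_stable st); [lia | apply: h1].
  by apply: (bridge_stable st); [lia | apply: h2].
Qed.

End Scan.
End Step.
End Search.

(** * The enumeration program *)

(* Registers: [vR] is the root, [vL] the number of positions, [vT] the address of
   the terminals.  Arrays: the neighbours of [v] form the list of the [aHD] along
   the links [aNX] from the cell [aHE v], where cell 0 ends a list; [aSE], [aCU],
   [aFS], [aRP] and [aFL] hold the current configuration. *)
Notation vN := 0 (only parsing).
Notation vM := 1 (only parsing).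
Notation vW := 2 (only parsing).
Notation vR := 3 (only parsing).
Notation vL := 4 (only parsing).
Notation vS := 5 (only parsing).
Notation vSp := 6 (only parsing).
Notation vCnt := 7 (only parsing).
Notation vU := 8 (only parsing).
Notation vC := 9 (only parsing).
Notation vV := 10 (only parsing).
Notation vI := 11 (only parsing).
Notation vX := 12 (only parsing).
Notation vF := 13 (only parsing).
Notation vOk := 14 (only parsing).
Notation vJ := 15 (only parsing).
Notation vS0 := 16 (only parsing).
Notation vGo := 17 (only parsing).
Notation vK := 18 (only parsing).
Notation vT := 19 (only parsing).

Notation aIn := 0 (only parsing).
Notation aHD := 1 (only parsing).
Notation aNX := 2 (only parsing).
Notation aHE := 3 (only parsing).
Notation aPT := 4 (only parsing).
Notation aPR := 5 (only parsing).
Notation aPA := 6 (only parsing).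
Notation aLO := 7 (only parsing).
Notation aST := 8 (only parsing).
Notation aSE := 9 (only parsing).
Notation aCU := 10 (only parsing).
Notation aFS := 11 (only parsing).
Notation aRP := 12 (only parsing).
Notation aFL := 13 (only parsing).

Notation "c1 ;; c2" := (HSeq c1 c2) (at level 80, right associativity).
Notation "i <-- e" := (HSet i e) (at level 75, no associativity).

Definition plus1 e := HB OpAdd e (HC 1).
Definition minus1 e := HB OpSub e (HC 1).
Definition lt_ a b := HB OpLt a b.
Definition eq_ a b := HB OpEq a b.
Definition not_ a := HB OpEq a (HC 0).
(* With truncated subtraction, [a - (1 - b)] is [a && b] on truth values. *)
Definition and_ a b := HB OpSub a (not_ b).

(** Iterative depth-first search, with [aPT] keeping the scanning position of each vertex in place
    of recursion. The graph is simple, so skipping the parent in the low point update skips exactly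
    the parent edge. A blocked vertex has a nonzero mark and is never entered. *)
Definition drain : hcmd :=
  HWh (HV vSp) (
    vU <-- HR aST (minus1 (HV vSp)) ;;
    vK <-- HR aPT (HV vU) ;;
    HIf (HV vK)
      (HSto aPT (HV vU) (HR aNX (HV vK)) ;;
       vV <-- HR aHD (HV vK) ;;
       HIf (HR aPR (HV vV))
         (HIf (eq_ (HV vV) (HR aPA (HV vU))) HSkip
            (HIf (lt_ (HR aPR (HV vV)) (HR aLO (HV vU)))
               (HSto aLO (HV vU) (HR aPR (HV vV))) HSkip))
         (HSto aPR (HV vV) (HV vCnt) ;;
          HSto aLO (HV vV) (HV vCnt) ;;
          HSto aPA (HV vV) (HV vU) ;;
          HSto aST (HV vSp) (HV vV) ;;
          vCnt <-- plus1 (HV vCnt) ;;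
          vSp <-- plus1 (HV vSp)))
      (vSp <-- minus1 (HV vSp) ;;
       HIf (lt_ (HC 2) (HR aPR (HV vU)))
         (HIf (lt_ (HR aLO (HV vU)) (HR aLO (HR aPA (HV vU))))
            (HSto aLO (HR aPA (HV vU)) (HR aLO (HV vU))) HSkip)
         HSkip)).

Arguments updn f i v !j /.
Arguments upda f k i v !j /.

(** * Rules of symbolic execution and cost accounting *)

Lemma wp_seqI wl B M c1 c2 Q s :
  wp wl B M c1 (wp wl B M c2 Q) s -> wp wl B M (HSeq c1 c2) Q s.
Proof. by []. Qed.

Lemma wp_skipI wl B M (Q : hst -> Prop) s : Q (htick 1 s) -> wp wl B M HSkip Q s.
Proof. by []. Qed.

Lemma wp_setI wl B M i e (Q : hst -> Prop) s : hok wl B M s e ->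
  Q (HSt (updn (rg s) i (hev s e)) (ar s) (ck s + (hcost e).+1) (pd s) (ou s)) ->
  wp wl B M (HSet i e) Q s.
Proof. by split. Qed.

Lemma wp_stoI wl B M k a e (Q : hst -> Prop) s : 0 < k <= 16 -> hok wl B M s a ->
  hev s a < M -> hok wl B M s e ->
  Q (HSt (rg s) (upda (ar s) k (hev s a) (hev s e))
         (ck s + (hcost a + hcost e + 7)) (pd s) (ou s)) ->
  wp wl B M (HSto k a e) Q s.
Proof. by move=> *; split. Qed.

Lemma wp_wrI wl B M e (Q : hst -> Prop) s : hok wl B M s e ->
  Q (HSt (rg s) (ar s) (ck s + (hcost e).+1) (rcons (pd s) (hev s e)) (ou s)) ->
  wp wl B M (HWr e) Q s.
Proof. by split. Qed.

Lemma wp_emI wl B M (Q : hst -> Prop) s :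
  Q (HSt (rg s) (ar s) (ck s + 1) [::] (rcons (ou s) (ck s + 1, pd s))) ->
  wp wl B M HEm Q s.
Proof. by []. Qed.

Lemma wp_ifI wl B M e c1 c2 (Q : hst -> Prop) s : hok wl B M s e ->
  (hev s e <> 0 -> wp wl B M c1 Q (htick (hcost e).+1 s)) ->
  (hev s e = 0 -> wp wl B M c2 Q (htick (hcost e).+1 s)) ->
  wp wl B M (HIf e c1 c2) Q s.
Proof. by move=> *; split. Qed.

Ltac okt := solve [repeat split; try done; try lia].

Ltac hs := cbn [hok hev hcost rg ar ck pd ou htick plus1 minus1 lt_ eq_ not_ and_
  binop_val updn upda Nat.eqb].

Ltac wstep :=
  lazymatch goal with
  | |- wp _ _ _ (HSeq _ _) _ _ => apply: wp_seqI; wstep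
  | |- wp _ _ _ HSkip _ _ => apply: wp_skipI; hs
  | |- wp _ _ _ (HSet _ _) _ _ => apply: wp_setI; hs; [try okt | ]
  | |- wp _ _ _ (HSto _ _ _) _ _ =>
      apply: wp_stoI; hs; [by [] | try okt | try lia | try okt | ]
  | |- wp _ _ _ (HWr _) _ _ => apply: wp_wrI; hs; [try okt | ]
  | |- wp _ _ _ HEm _ _ => apply: wp_emI; hs
  | |- wp _ _ _ (HIf _ _ _) _ _ => apply: wp_ifI; hs; [try okt | | ]
  end.

(** The unit of the time budgets, generous for the constant work that it pays. Opaque, so that
    arithmetic treats budgets as atoms until [tlia] expands them. *)
Definition ticks (k : nat) : nat := 200 * k.
Lemma ticksE k : ticks k = 200 * k. Proof. by []. Qed.
Global Opaque ticks.

Ltac tlia :=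
  repeat match goal with
  | |- context [ticks ?k] => rewrite (ticksE k)
  | H : context [ticks ?k] |- _ => rewrite (ticksE k) in H
  end; lia.

Lemma nat_of_bool_neq0 (b : bool) : nat_of_bool b <> 0 -> b.
Proof. by case: b. Qed.

Lemma nat_of_bool_eq0 (b : bool) : nat_of_bool b = 0 -> ~~ b.
Proof. by case: b. Qed.

Section Program.

Variables (wl B M n m2 : nat) (HD NX HE : nat -> nat).
Hypothesis wl_ge : B + n + m2 + 100 < wl.
Hypothesis M_ge : n + m2 + 1 < M.
Hypothesis NX_lt : forall c, 0 < c <= m2 -> NX c < c.
Hypothesis HD_lt : forall c, 0 < c <= m2 -> HD c < n.
Hypothesis HE_le : forall v, v < n -> HE v <= m2.
Notation nb := (nb HD NX HE).
Notation base := (base n m2 HD NX HE).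
Notation lowinv := (lowinv n HD NX HE).
Notation pot := (pot n HD NX HE).
Hypothesis nb_sym : forall x y, x < n -> y \in nb x -> y < n /\ x \in nb y.
Hypothesis nb_uniq : forall x, x < n -> uniq (nb x).
Hypothesis nb_sum : \sum_(v < n) size (nb v) <= m2.

Definition adjacency (s : hst) : Prop :=
  [/\ ar s aHD = HD, ar s aNX = NX, ar s aHE = HE & rg s vN = n].

(** [g] switches the low points on. They are claimed only when no vertex is blocked; with positions
    blocked and released later, the search remains correct but its low points are not
    interpreted. *)
Record drained (s : hst) (g : Prop) : Prop := {
  dr_base : base (ar s aPR) (ar s aPA) (ar s aPT) (ar s aST) (rg s vSp) (rg s vCnt);
  dr_low : g -> lowinv (ar s aPR) (ar s aPA) (ar s aLO) (ar s aPT) (ar s aST) (rg s vSp)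
}.

Definition grows (P A P' A' : nat -> nat) : Prop :=
  (forall x, P x <> 0 -> P' x = P x /\ A' x = A x) /\
  (forall x, P x = 0 -> P' x = 0 \/ 3 <= P' x).

Lemma grows_new P A P' A' w k v : grows P A P' A' -> P' w = 0 -> 3 <= k ->
  grows P A (upd P' w k) (upd A' w v).
Proof.
move=> [h1 h2] Pw k3; split=> x Px.
  have [e1 e2] := h1 _ Px; have ne : x <> w by move=> e; apply: Px; rewrite -e1 e.
  by rewrite !upd_other.
by rewrite updE; case: eqP => [_|_]; [right | exact: h2].
Qed.

(** The potential plus the stack height is both the variant and the reserve of time: a scan lowers
    the potential by 1, a pop lowers the stack by 1, and entering a vertex adds 1 to the stack
    against at least 3 of potential. *)
Lemma drain_spec s g : adjacency s -> drained s g ->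
  wp wl B M drain (fun s' => [/\ drained s' g, rg s' vSp = 0,
    grows (ar s aPR) (ar s aPA) (ar s' aPR) (ar s' aPA) &
    ck s' + ticks (pot (ar s' aPR) (ar s' aPT)) <=
    ck s + ticks (pot (ar s aPR) (ar s aPT) + rg s vSp) + 2]) s.
Proof.
move=> adj dr.
pose I s' := [/\ adjacency s', drained s' g,
    grows (ar s aPR) (ar s aPA) (ar s' aPR) (ar s' aPA) &
    ck s' + ticks (pot (ar s' aPR) (ar s' aPT) + rg s' vSp) <=
    ck s + ticks (pot (ar s aPR) (ar s aPT) + rg s vSp)].
apply: (@wp_while _ _ _ _ _ I (fun s' => pot (ar s' aPR) (ar s' aPT) + rg s' vSp)).
  by split=> //; split=> // x Px; left.
move=> {dr adj} s1 [[eHD eNX eHE eN] [Hb Hl] gr tm]; split; [by [] | | ]; last first.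
  move=> /= sp0; rewrite sp0 in Hb Hl tm; split; [by split=> /=; rewrite sp0 | by [] | by [] | ].
  by move: tm => /=; tlia.
case: s1 eHD eNX eHE eN Hb Hl gr tm => rg1 ar1 ck1 pd1 ou1.
cbn [rg ar ck pd ou htick hev hcost] => eHD eNX eHE eN Hb Hl gr tm sp0.
have sp1 : 0 < rg1 vSp by lia.
set v := ar1 aST (rg1 vSp - 1).
have ev : ar1 aST (rg1 vSp).-1 = v by rewrite /v subn1.
have vn : v < n by rewrite -ev; apply: top_lt Hb.
have Pv : 2 <= ar1 aPR v by rewrite -ev; apply: top_P Hb.
have room := b_room Hb; have cn := b_cnt Hb.
have vltM : v < M by lia.
have ePT : ar1 aPT v <= m2 by apply: (b_T Hb).
do 2 wstep; rewrite -/v.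
wstep => Tv.
- have Tv' : ar1 aPT (ar1 aST (rg1 vSp).-1) <> 0 by rewrite ev.
  have cok := cell_ok sp1 Hb Tv'; rewrite ev in cok.
  have wn := w_lt HD_lt sp1 Hb Tv'; rewrite ev in wn.
  have e1 := base_scan NX_lt sp1 Hb Tv'; rewrite ev in e1.
  have e2 := base_new NX_lt HD_lt nb_sym sp1 Hb Tv'; rewrite ev in e2.
  have p1 := pot_scan NX_lt sp1 Hb Tv'; rewrite ev in p1.
  have p2 := pot_new NX_lt HD_lt sp1 Hb Tv'; rewrite ev in p2.
  have l1 Lw' := low_scan (Lw := ar1 aLO) (Lw' := Lw') NX_lt sp1 Hb Tv'; rewrite ev in l1.
  have l2 := low_new (Lw := ar1 aLO) NX_lt HD_lt sp1 Hb Tv'; rewrite ev in l2.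
  do 2 wstep; rewrite eNX eHD.
  set w := HD (ar1 aPT v) in wn e1 e2 p2 l1 l2 *.
  wstep => Pw.
  + wstep => [/nat_of_bool_neq0 /eqP eA|/nat_of_bool_eq0 /eqP nA]; wstep.
      split; last by hs; tlia.
      split; hs; [by split | | by [] | by tlia].
      split; hs; [exact: e1 | move=> hg; apply: l1 => //; first exact: Hl].
    * move=> /nat_of_bool_neq0 lt; wstep; split; last by hs; tlia.
      split; hs; [by split | | by [] | by tlia].
      split; hs; [exact: e1 | move=> hg; apply: l1 => //; first exact: Hl].
      - by move=> x ne; rewrite upd_other.
      - by move=> _; rewrite upd_same; lia.
    * move=> /nat_of_bool_eq0 ge; wstep; split; last by hs; tlia.
      split; hs; [by split | | by [] | by tlia].
      split; hs; [exact: e1 | move=> hg; apply: l1 => //; first exact: Hl].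
      by move=> _; lia.
  + have {}p2 := p2 Pw; do 6 wstep.
    split; last by hs; rewrite ?addn1; lia.
    split; hs; rewrite ?addn1; [by split | | | by tlia].
      by split; hs; rewrite ?addn1; [exact: e2 | move=> hg; apply: l2 => //; apply: Hl].
    by apply: grows_new => //; have := b_cnt3 Hb; lia.
- have Tv' : ar1 aPT (ar1 aST (rg1 vSp).-1) = 0 by rewrite ev.
  have e1 := base_pop sp1 Hb Tv'.
  have l1 Lw' := low_pop (Lw := ar1 aLO) (Lw' := Lw') nb_sym sp1 Hb.
  have l2 := low_pop_root (P := ar1 aPR) (A := ar1 aPA) (Lw := ar1 aLO) (T := ar1 aPT) (S := ar1 aST) sp1.
  rewrite ev in l1 l2.
  wstep; rewrite subn1; wstep => [/nat_of_bool_neq0 Pv3|/nat_of_bool_eq0 Pv3].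
  + have [An Ab PA] := b_par Hb vn Pv3.
    wstep => [/nat_of_bool_neq0 lt|/nat_of_bool_eq0 ge]; wstep.
    * split; last by hs; tlia.
      split; hs; [by split | | by [] | by tlia].
      split; hs; [exact: e1 | move=> hg; apply: l1 => //; first exact: Hl].
      - by move=> x ne; rewrite upd_other.
      - by rewrite upd_same; lia.
    * split; last by hs; tlia.
      split; hs; [by split | | by [] | by tlia].
      split; hs; [exact: e1 | move=> hg; apply: l1 => //; first exact: Hl].
      by lia.
  + wstep; split; last by hs; tlia.
    split; hs; [by split | | by [] | by tlia].
    by split; hs; [exact: e1 | move=> hg; apply: l2 => //; [exact: Hl | lia]].
Qed.

End Program.

(* Searches from the root and the first [vS] positions, with the positions from
   [vS] to [vL] blocked. *)
Definition prep : hcmd :=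
  vI <-- HC 0 ;;
  HWh (lt_ (HV vI) (HV vN)) (
    HSto aPR (HV vI) (HC 0) ;;
    HSto aPT (HV vI) (HR aHE (HV vI)) ;;
    vI <-- plus1 (HV vI)) ;;
  HSto aPR (HV vR) (HC 2) ;;
  HSto aST (HC 0) (HV vR) ;;
  vSp <-- HC 1 ;;
  vI <-- HC 0 ;;
  HWh (lt_ (HV vI) (HV vS)) (
    vX <-- HR aSE (HV vI) ;;
    HSto aPR (HV vX) (HC 2) ;;
    HSto aST (HV vSp) (HV vX) ;;
    vSp <-- plus1 (HV vSp) ;;
    vI <-- plus1 (HV vI)) ;;
  HWh (lt_ (HV vI) (HV vL)) (
    HSto aPR (HR aSE (HV vI)) (HC 1) ;;
    vI <-- plus1 (HV vI)) ;;
  vCnt <-- HC 3 ;;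
  drain.

(* Releases the blocked positions from the last one on, until a remaining
   neighbour [HD vC] of the position [vI] is reached; [vC] is 0 if there is none. *)
Definition find_dev : hcmd :=
  prep ;;
  vI <-- HV vL ;;
  vC <-- HC 0 ;;
  HWh (and_ (lt_ (HV vS) (HV vI)) (not_ (HV vC))) (
    vI <-- minus1 (HV vI) ;;
    vC <-- HR aRP (HV vI) ;;
    HWh (and_ (lt_ (HC 0) (HV vC))
          (not_ (and_ (not_ (eq_ (HR aHD (HV vC)) (HR aFS (HV vI))))
                      (lt_ (HC 1) (HR aPR (HR aHD (HV vC)))))))
      (vC <-- HR aNX (HV vC)) ;;
    HIf (HV vC) HSkip (
      vX <-- HR aSE (HV vI) ;;
      HSto aPR (HV vX) (HV vCnt) ;;
      HSto aPA (HV vX) (HR aCU (HV vI)) ;;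
      HSto aST (HC 0) (HV vX) ;;
      vCnt <-- plus1 (HV vCnt) ;;
      vSp <-- HC 1 ;;
      drain)).

(** * Positions, live neighbours and the search for a deviation *)

Lemma iota_inj_bound n L (q : nat -> nat) r : r < n -> (forall k, k < L -> q k < n) ->
  (forall k, k < L -> q k <> r) -> (forall k j, k < L -> j < k -> q j <> q k) -> L < n.
Proof.
move=> rn qn qr qq.
have u : uniq (r :: [seq q k | k <- iota 0 L]).
  rewrite /=; apply/andP; split.
    by apply/mapP => [[k]]; rewrite mem_iota => /andP[_ kL] /esym; apply: qr.
  rewrite map_inj_in_uniq ?iota_uniq // => i j.
  rewrite !mem_iota => /andP[_ iL] /andP[_ jL] e.
  by case: (ltngtP i j) => // h; [case: (qq _ _ jL h) | case: (qq _ _ iL h)].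
have := uniq_leq_size (s2 := iota 0 n) u; rewrite /= size_map !size_iota; apply.
move=> x; rewrite inE mem_iota => /orP[/eqP ->|/mapP [k]]; first by lia.
by rewrite mem_iota => /andP[_ kL] ->; apply: qn.
Qed.

Section Positions.

Variables (n r : nat) (q : nat -> nat) (L : nat).

Definition inF (s x : nat) : Prop := x = r \/ exists2 j, j < s & x = q j.

Definition distinct : Prop :=
  forall k, k < L -> [/\ q k < n, q k <> r & forall j, j < k -> q j <> q k].

Hypothesis r_lt : r < n.
Hypothesis Hq : distinct.

Lemma L_lt : L < n.
Proof.
apply: (iota_inj_bound r_lt (q := q)) => k; first by case/Hq.
  by case/Hq.
by move=> j /Hq [_ _]; apply.
Qed.

Lemma q_lt k : k < L -> q k < n. Proof. by case/Hq. Qed.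

Lemma q_inj j k : j < L -> k < L -> q j = q k -> j = k.
Proof.
move=> jL kL e; case: (ltngtP j k) => // h.
  by case: (Hq kL) => _ _ /(_ _ h).
by case: (Hq jL) => _ _ /(_ _ h) /nesym.
Qed.

Lemma inF_lt s x : s <= L -> inF s x -> x < n.
Proof. by move=> sL [->|[j js ->]] //; apply: q_lt; lia. Qed.

Lemma inF_q s k : s <= k -> k < L -> ~ inF s (q k).
Proof.
move=> sk kL [e|[j js e]]; first by case: (Hq kL) => _ /(_ e).
by have := q_inj _ _ (esym e); lia.
Qed.

End Positions.

Lemma inF_S r q s x : inF r q s.+1 x <-> inF r q s x \/ x = q s.
Proof.
split=> [[->|[j js ->]]|[[->|[j js ->]]|->]].
- by left; left.
- have [->|ne] := eqVneq j s; [by right | left; right; exists j => //; lia].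
- by left.
- by right; exists j => //; lia.
- by right; exists s.
Qed.

Section Liveness.

Variables (n : nat) (HD NX HE : nat -> nat) (r : nat) (q fst rp : nat -> nat).
Notation nb := (nb HD NX HE).
Notation lst := (lst HD NX).

(* [a] is joined to the first [s] positions by a walk that avoids the positions
   [s], .., [k]. *)
Definition live (s k a : nat) : Prop :=
  forall Z : nat -> Prop, (forall x, inF r q s x -> Z x) ->
    (forall x y, x < n -> y \in nb x -> Z y -> (forall j, s <= j <= k -> x <> q j) -> Z x) ->
    Z a.

(** The first choice is made by the search and not in the order of the list, so it has to be skipped
    when it is met in the list. *)
Definition remaining (k : nat) : seq nat := [seq a <- lst (rp k) | a != fst k].

Definition dead_at (s k : nat) : Prop := forall a, a \in remaining k -> ~ live s k a.

End Liveness.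

Lemma sub_val (a b : bool) : nat_of_bool a - nat_of_bool b = a && ~~ b.
Proof. by case: a; case: b. Qed.

Lemma low_count_upd n P w k : w < n ->
  low_count n (upd P w k) + (P w < 2) = low_count n P + (k < 2).
Proof.
move=> wn; have e := @sum_ord_update n (fun v => P v < 2 : nat)
  (fun v => upd P w k v < 2 : nat) w wn.
rewrite /low_count; move: e; rewrite upd_same => e; rewrite -e //.
by move=> x _ ne; rewrite upd_other.
Qed.

Section Program.

Variables (wl B M n m2 : nat) (HD NX HE : nat -> nat).
Hypothesis wl_ge : B + n + m2 + 100 < wl.
Hypothesis M_ge : n + m2 + 1 < M.
Hypothesis NX_lt : forall c, 0 < c <= m2 -> NX c < c.
Hypothesis HD_lt : forall c, 0 < c <= m2 -> HD c < n.
Hypothesis HD_0 : HD 0 < n.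
Hypothesis HE_le : forall v, v < n -> HE v <= m2.
Notation nb := (nb HD NX HE).
Notation lst := (lst HD NX).
Notation base := (base n m2 HD NX HE).
Notation pot := (pot n HD NX HE).
Notation adjacency := (adjacency n HD NX HE).
Notation drained := (drained n m2 HD NX HE).
Notation wp := (wp wl B M).
Hypothesis nb_sym : forall x y, x < n -> y \in nb x -> y < n /\ x \in nb y.
Hypothesis nb_uniq : forall x, x < n -> uniq (nb x).
Hypothesis nb_sum : \sum_(v < n) size (nb v) <= m2.

Variable r : nat.
Hypothesis r_lt : r < n.

Section Positions.

Variables (q : nat -> nat) (L s0 : nat).
Notation inF := (inF r q).
Notation live := (live n HD NX HE r q).

Definition ctx (s : hst) : Prop :=
  [/\ adjacency s, rg s vR = r, rg s vS = s0, rg s vL = L & ar s aSE = q].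

Hypothesis Hq : distinct n r q L.
Hypothesis s0L : s0 <= L.

Definition marks (i : nat) (P : nat -> nat) : Prop :=
  forall x, x < n -> [/\ P x <= 2, P x = 2 <-> inF s0 x &
    P x = 1 <-> exists2 j, s0 <= j < i & x = q j].

Lemma pot_init P T : (forall x, x < n -> T x = HE x) -> pot P T <= 2 * m2 + 2 * n.
Proof.
move=> eT; rewrite /pot.
have : \sum_(v < n) wt HD NX HE P T v <= \sum_(v < n) (size (nb v) + size (nb v) + 2).
  by apply: leq_sum => i _; rewrite /wt eT // -/(nb i); case: ifP; lia.
rewrite !big_split /= sum_nat_const card_ord => h; apply: leq_trans h _.
by apply: leq_add; [rewrite addnn -mul2n leq_mul2l nb_sum | rewrite mulnC].
Qed.

(** When [s0 = L] nothing is blocked, and this is the case where low points are wanted. The factor 8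
    absorbs the initial potential, at most [2 * m2 + 2 * n], and the three marking loops. *)
Lemma prep_spec s : ctx s ->
  wp prep (fun s' => [/\ drained s' (s0 = L), rg s' vSp = 0,
    (forall x, x < n -> (ar s' aPR x = 2 <-> inF s0 x) /\
        (ar s' aPR x = 1 <-> exists2 j, s0 <= j < L & x = q j)) &
    ck s' + ticks (pot (ar s' aPR) (ar s' aPT)) <= ck s + ticks (8 * (n + m2 + 1))]) s.
Proof.
move=> [[e1 e2 e3 e4] e5 e6 e7 e8]; have Ln := (L_lt r_lt Hq).
case: s e1 e2 e3 e4 e5 e6 e7 e8 => rg0 ar0 ck0 pd0 ou0; hs => e1 e2 e3 e4 e5 e6 e7 e8.
rewrite /prep; wstep; apply: wp_seqI.
pose I1 s' := [/\ ctx s', rg s' vI <= n,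
  forall v, v < rg s' vI -> ar s' aPR v = 0 /\ ar s' aPT v = HE v &
  ck s' + ticks (n - rg s' vI) <= ck0 + 2 + ticks n].
apply: (@wp_while _ _ _ _ _ I1 (fun s' => n - rg s' vI)).
  split; hs; [by split; hs | by [] | by [] | by tlia].
move=> [rg1 ar1 ck1 pd1 ou1] [[[f1 f2 f3 f4] f5 f6 f7 f8] hi h0 tm].
move: f1 f2 f3 f4 f5 f6 f7 f8 hi h0 tm; hs => f1 f2 f3 f4 f5 f6 f7 f8 hi h0 tm.
split; [by okt | |] => [/nat_of_bool_neq0 lt|/nat_of_bool_eq0 ge].
  rewrite f4 in lt.
  do 3 wstep; split; hs; last by tlia.
  split; hs; [by split; hs | by lia | | by tlia].
  move=> v vi; rewrite f3 !updE; case: eqP => [->|ne] //; apply: h0; lia.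
rewrite f4 -leqNgt in ge; have {hi ge} hi : rg1 vI = n by lia.
rewrite hi in h0 tm.
do 4 wstep; apply: wp_seqI; rewrite f5.
pose I2 s' := [/\ ctx s', [/\ rg s' vI <= s0, rg s' vSp = (rg s' vI).+1 &
    rg s' vSp + low_count n (ar s' aPR) <= n],
  forall x, x < n -> [/\ ar s' aPR x = 2 <-> inF (rg s' vI) x,
     ar s' aPR x <> 2 -> ar s' aPR x = 0 & ar s' aPT x = HE x],
  (forall j, j < rg s' vSp -> ar s' aST j < n /\ ar s' aPR (ar s' aST j) = 2) /\
  (forall x, x < n -> ar s' aPR x = 2 -> exists2 j, j < rg s' vSp & ar s' aST j = x) &
  ck s' + ticks (s0 - rg s' vI) <= ck0 + 100 + ticks n + ticks s0].
apply: (@wp_while _ _ _ _ _ I2 (fun s' => s0 - rg s' vI)).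
  split; hs; [by split; hs | | | | by tlia].
  - split=> //; have := @low_count_upd n (ar1 aPR) r 2 r_lt.
    have -> : low_count n (ar1 aPR) = n.
      rewrite /low_count (eq_bigr (fun=> 1)); last by move=> i _; rewrite (h0 i _).1.
      by rewrite sum1_card card_ord.
    by rewrite (h0 _ r_lt).1 /=; lia.
  - move=> x xn; rewrite updE; case: eqP => [->|ne]; split=> //.
    + by split=> // _; left.
    + by case: (h0 _ r_lt).
    + by rewrite (h0 _ xn).1; split=> // [[//|[j]]].
    + by rewrite (h0 _ xn).1.
    + by case: (h0 _ xn).
  - split=> [j|x xn]; first by case: j => // _; rewrite !upd_same.
    rewrite updE; case: eqP => [->|ne]; first by exists 0 => //; rewrite upd_same.
    by rewrite (h0 _ xn).1.
clear f1 f2 f3 f4 f5 f6 f7 f8 tm h0 hi ar1 rg1 ck1 pd1 ou1 I1.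
move=> [rg1 ar1 ck1 pd1 ou1] [[[f1 f2 f3 f4] f5 f6 f7 f8] [hi hsp hlow] hP [hS1 hS2] tm].
move: f1 f2 f3 f4 f5 f6 f7 f8 hi hsp hlow hP hS1 hS2 tm; hs.
move=> f1 f2 f3 f4 f5 f6 f7 f8 hi hsp hlow hP hS1 hS2 tm.
split; [by okt | |] => [/nat_of_bool_neq0 lt|/nat_of_bool_eq0 ge].
  rewrite f6 in lt; have iL : rg1 vI < L by lia.
  have qn := q_lt Hq iL; rewrite -f8 in qn.
  wstep; rewrite f8; have qM : q (rg1 vI) < M by rewrite -f8; lia.
  do 4 wstep; rewrite f8 in qn.
  have nF : ~ inF (rg1 vI) (q (rg1 vI)) by apply: (inF_q r_lt Hq).
  have [p1 p2 p3] := hP _ qn.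
  have P0 : ar1 aPR (q (rg1 vI)) = 0 by apply: p2 => /p1.
  split; hs; last by lia.
  split; hs; [by split; hs | | | | by tlia].
  - split; [by lia | by lia |].
    have := @low_count_upd n (ar1 aPR) _ 2 qn; rewrite P0 /=; lia.
  - move=> x xn; have [p4 p5 p6] := hP _ xn; rewrite addn1 updE; case: eqP => [->|ne]; split=> //.
    + by split=> // _; apply/inF_S; right.
    + by rewrite inF_S p4; split=> [h|[|//]]; [left | ].
  - split=> [j|x xn].
      rewrite addn1 ltnS leq_eqVlt => /orP[/eqP ->|hj].
        by rewrite !upd_same.
      rewrite [upd (ar1 aST) _ _ _]upd_other; last by lia.
      by have [a b] := hS1 _ hj; split=> //; rewrite updE b; case: eqP.
    rewrite updE; case: eqP => [->|ne Px]; first by exists (rg1 vSp); rewrite ?upd_same //; lia.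
    have [j hj <-] := hS2 _ xn Px; exists j; first by lia.
    by rewrite upd_other //; lia.
rewrite f6 -leqNgt in ge; have {ge} hi' : rg1 vI = s0 by lia.
rewrite hi' in hP tm hsp.
apply: wp_seqI.
pose I3 s' := [/\ ctx s', [/\ s0 <= rg s' vI <= L, rg s' vSp = s0.+1 &
    rg s' vSp + low_count n (ar s' aPR) <= n],
  marks (rg s' vI) (ar s' aPR) /\ forall x, x < n -> ar s' aPT x = HE x,
  (forall j, j < rg s' vSp -> ar s' aST j < n /\ ar s' aPR (ar s' aST j) = 2) /\
  (forall x, x < n -> ar s' aPR x = 2 -> exists2 j, j < rg s' vSp & ar s' aST j = x) &
  ck s' + ticks (L - rg s' vI) <= ck0 + 120 + ticks n + ticks s0 + ticks L].
apply: (@wp_while _ _ _ _ _ I3 (fun s' => L - rg s' vI)).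
  split; hs; [by split; hs | by split=> //; lia | | by split | by tlia].
  split=> x xn; last by case: (hP _ xn).
  have [p1 p2 _] := hP _ xn; split=> //.
    by have [->|/eqP/p2->] := eqVneq (ar1 aPR x) 2.
  rewrite hi'; split; last by move=> [j]; lia.
  by have [->|/eqP/p2->] := eqVneq (ar1 aPR x) 2.
clear f1 f2 f3 f4 f5 f6 f7 f8 tm hP hi hi' hsp hlow hS1 hS2 ar1 rg1 ck1 pd1 ou1 I2.
move=> [rg1 ar1 ck1 pd1 ou1] [[[f1 f2 f3 f4] f5 f6 f7 f8] [hi hsp hlow] [hP hT] [hS1 hS2] tm].
move: f1 f2 f3 f4 f5 f6 f7 f8 hi hsp hlow hP hT hS1 hS2 tm; hs.
move=> f1 f2 f3 f4 f5 f6 f7 f8 hi hsp hlow hP hT hS1 hS2 tm.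
split; [by okt | |] => [/nat_of_bool_neq0 lt|/nat_of_bool_eq0 ge].
  rewrite f7 in lt; have qn := q_lt Hq lt.
  wstep; [by rewrite f8; lia|]; wstep; rewrite f8.
  have [p0 p1 p2] := hP _ qn.
  have nF : ~ inF s0 (q (rg1 vI)) by apply: (inF_q r_lt Hq); lia.
  have nP : ar1 aPR (q (rg1 vI)) <> 2 by move=> /p1.
  split; hs; last by lia.
  split; hs; [by split; hs | | | | by tlia].
  - split; [by lia | by [] |].
    have := @low_count_upd n (ar1 aPR) _ 1 qn; case: ltnP; lia.
  - split=> [x xn|x xn]; last exact: hT.
    have [p3 p4 p5] := hP _ xn; rewrite addn1 updE; case: eqP => [->|ne]; split=> //.
    + by split=> // _; exists (rg1 vI) => //; lia.
    + rewrite p5; split=> [[j hj ->]|[j hj ej]]; exists j => //; first by lia.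
      by have [e|] := eqVneq j (rg1 vI); [case: ne; rewrite -e | lia].
  - split=> [j hj|x xn].
      have [a b] := hS1 _ hj; split=> //; rewrite updE; case: eqP => // e.
      by rewrite e in b.
    by rewrite updE; case: eqP => // _; apply: hS2.
rewrite f7 -leqNgt in ge; have {ge} hi' : rg1 vI = L by lia.
rewrite hi' in hP tm; wstep.
set s1 := HSt _ _ _ _ _.
have adj1 : adjacency s1 by split; rewrite /s1; hs.
have dr : drained s1 (s0 = L).
  split; rewrite /s1; hs.
    split.
    - by move=> i /hS1 [a ->].
    - by [].
    - by lia.
    - by [].
    - by move=> x xn; rewrite hT //; apply: HE_le.
    - by move=> x y xn; rewrite hT.
    - by move=> x xn _; apply: hT.
    - by move=> x y xn _ xy; right; rewrite hT.
    - by move=> x xn Px _; apply: hS2 => //; have [] := hP _ xn; lia.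
    - by move=> x xn Px; have [] := hP _ xn; lia.
    - by move=> x xn; have [] := hP _ xn; lia.
  move=> e0; have P2 i : i < rg1 vSp -> ar1 aPR (ar1 aST i) = 2 by move=> /hS1 [].
  split.
  - by move=> x xn e; have [_ _] := hP _ xn; rewrite e => [[/(_ erefl) [j]]]; lia.
  - by move=> i j ij hj; rewrite !P2 //; lia.
  - by move=> j /P2 ->.
  - by move=> i x /P2 ->.
  - by move=> i /P2 ->.
  - by move=> i /P2 ->.
  - by move=> i x y /P2 ->.
  - by move=> v vn Pv; have [] := hP _ vn; lia.
apply: wp_conseq (drain_spec wl_ge M_ge NX_lt HD_lt nb_sym nb_sum adj1 dr) _.
move=> s' _ [dr' sp' [gr1 gr2] tm']; split=> //.
  move=> x xn; have [p0 p1 p2] := hP _ xn.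
  have [P0|/eqP P0] := eqVneq (ar1 aPR x) 0; last first.
    by have [-> _] := gr1 x P0; rewrite /s1; hs.
  by rewrite -p1 -p2 P0; have [->|h] := gr2 x P0; split; split=> //; lia.
have := pot_init (ar1 aPR) hT; move: tm'; rewrite /s1; hs; tlia.
Qed.

Variables (cur fst rp : nat -> nat).
Notation dead_at := (dead_at n HD NX HE r q fst rp s0).

Definition ctx2 (s : hst) : Prop :=
  [/\ ctx s, ar s aCU = cur, ar s aFS = fst & ar s aRP = rp].

Hypothesis Hlink : forall k, s0 <= k < L ->
  [/\ cur k \in nb (q k), k.+1 < L -> cur k = q k.+1 & k.+1 = L -> inF s0 (cur k)].
Hypothesis Hrp : forall k, s0 <= k < L ->
  [/\ rp k <= m2, uniq (lst (rp k)) & {subset lst (rp k) <= nb (q k)}].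

(** With an empty stack, the vertices of mark at least 2 contain the sources and are closed under
    the steps of [live], so they contain all live vertices. *)
Lemma dead_of_marks P A T S cnt i : base P A T S 0 cnt ->
  (forall x, x < n -> (P x = 2 <-> inF s0 x) /\
     (P x = 1 <-> exists2 j, s0 <= j < i.+1 & x = q j)) ->
  forall a, P a < 2 -> ~ live s0 i a.
Proof.
move=> Hb hP a Pa /(_ (fun x => 2 <= P x)) h.
suff : 2 <= P a by lia.
apply: h => [x Fx|x y xn xy Py hx].
  by have xn := inF_lt r_lt Hq s0L Fx; have [[_ ->]] := hP _ xn.
have [yn yx] := nb_sym xn xy; have [_ [p1 _]] := hP _ xn.
have P0 : P x <> 0.
  have [//|] := b_scan Hb yn Py yx.
  have [->|/eqP Ty] := eqVneq (T y) 0; first by [].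
  by have [j] := b_stk Hb yn Py Ty.
have P1 : P x <> 1 by move=> /p1 [j hj]; apply: hx; lia.
by lia.
Qed.

(** A blocked vertex with a reached neighbour can be entered as if the search had just discovered it
    from there. Marks and scanning positions stay valid, so all releases together form a single
    search. *)
Lemma base_release P A T S cnt u cu : base P A T S 0 cnt -> u < n -> P u = 1 ->
  cu \in nb u -> 2 <= P cu ->
  base (upd P u cnt) (upd A u cu) T (upd S 0 u) 1 cnt.+1.
Proof.
move=> Hb un Pu cuu Pcu; have lc := @low_count_upd n P u cnt un.
case: Hb => h1 h2 h3 h4 h5 h5' h6 h7 h8 h9 h10; rewrite Pu /= in lc.
have c2 : (cnt < 2) = false by lia.
rewrite c2 in lc; split=> //.
- by case=> // _; rewrite !upd_same; split=> //; lia.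
- by lia.
- by lia.
- by lia.
- by move=> x xn; rewrite updE; case: eqP => [->|_]; [lia | exact: h6].
- move=> x y xn; rewrite (updE P); case: eqP => [->|ne] Px xy; first by right; rewrite h6 ?Pu.
  rewrite updE; case: eqP => [_|_]; [by left; lia | exact: h7].
- move=> x xn; rewrite updE; case: eqP => [-> _ _|ne Px Tx]; first by exists 0 => //; rewrite upd_same.
  by have [j] := h8 _ xn Px Tx.
- move=> x xn; rewrite (updE P u cnt x); case: eqP => [-> _|ne Px].
    rewrite upd_same; have [cun _] := nb_sym un cuu; split=> //.
    by rewrite upd_other; [have := h10 _ cun; lia | move=> e; rewrite e in Pcu; lia].
  have [a b c] := h9 _ xn Px; rewrite [upd A _ _ _]upd_other //; split=> //.
  by rewrite upd_other // => e; rewrite e in c; lia.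
- by move=> x xn; rewrite updE; case: eqP => [_|_]; [lia | have := h10 _ xn; lia].
Qed.

(** [sk] is the part of the list passed over. The state of the search is kept because the new path
    from [HD c] will follow its parents. *)
Definition deviation (s : hst) : Prop :=
  let i := rg s vI in let c := rg s vC in let P := ar s aPR in
  [/\ s0 <= i < L, 0 < c <= m2 /\ HD c <> fst i /\ 2 <= P (HD c),
      (forall k, i < k < L -> dead_at k) /\
      (exists2 sk, lst (rp i) = sk ++ lst c &
         forall a, a \in sk -> a <> fst i -> ~ live s0 i a),
      base P (ar s aPA) (ar s aPT) (ar s aST) 0 (rg s vCnt) &
      forall x, x < n -> (P x = 2 <-> inF s0 x) /\
        (P x = 1 <-> exists2 j, s0 <= j < i.+1 & x = q j)].

Lemma size_rp k : s0 <= k < L -> size (lst (rp k)) <= size (nb (q k)).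
Proof. by move=> /Hrp [_ u sub]; apply: uniq_leq_size. Qed.

Lemma ctx2_frame c s s' : hexec wl B M c s s' ->
  all (fun i => i \notin wregs c) [:: vN; vR; vS; vL] ->
  all (fun k => k \notin warrs c) [:: aHD; aNX; aHE; aSE; aCU; aFS; aRP] ->
  ctx2 s -> ctx2 s'.
Proof.
move=> x /and5P[w1 w2 w3 w4 _] /and5P[a1 a2 a3 a4 /and4P[a5 a6 a7 _]].
move=> [[[h1 h2 h3 h4] h5 h6 h7 h8] h9 h10 h11].
have fr := frame_rg x; have fa := frame_ar x.
by do 3 (split; rewrite ?fr ?fa //).
Qed.

Definition released (s : hst) (i : nat) : Prop :=
  [/\ base (ar s aPR) (ar s aPA) (ar s aPT) (ar s aST) 0 (rg s vCnt),
      forall x, x < n -> (ar s aPR x = 2 <-> inF s0 x) /\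
        (ar s aPR x = 1 <-> exists2 j, s0 <= j < i & x = q j),
      forall k, s0 <= k < L -> ar s aPR (q k) <> 0 &
      forall k, i <= k < L -> dead_at k].

Lemma released_ge2 s i k : released s i -> s0 <= i <= k -> k < L -> 2 <= ar s aPR (q k).
Proof.
move=> [_ hP h0 _] ik kL; have qn := q_lt Hq kL; have [_ [p1 _]] := hP _ qn.
have := h0 k _; have n1 : ar s aPR (q k) <> 1; last by lia.
by move=> /p1 [j hj] /esym /(q_inj Hq); lia.
Qed.

Lemma find_dev_spec s : ctx2 s ->
  wp find_dev (fun s' => [/\ ctx2 s',
    rg s' vC = 0 -> forall k, s0 <= k < L -> dead_at k,
    rg s' vC <> 0 -> deviation s' &
    ck s' <= ck s + ticks (10 * (n + m2 + 1))]) s.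
Proof.
move=> cs; have Ln := (L_lt r_lt Hq); rewrite /find_dev; apply: wp_seqI.
have [c1 _ _ _] := cs.
apply: wp_conseq (prep_spec c1) _ => s1 x1 [[dr _] sp0 hP tm1].
have {}x1 : ctx2 s1 by apply: (ctx2_frame x1).
rewrite sp0 in dr.
case: s1 x1 dr sp0 hP tm1 => rg1 ar1 ck1 pd1 ou1; move: (ck s) => ck0.
hs => cs1 dr sp0 hP tm1; have eL : rg1 vL = L by case: cs1 => [[]].
do 2 wstep; rewrite eL.
pose T := ck0 + ticks (8 * (n + m2 + 1)) + 100.
(* As long as no neighbour is found, all positions from [vI] on are released and dead, and the
   potential left still pays for the rest of the search. *)
pose IO s' := [/\ ctx2 s', s0 <= rg s' vI <= L,
  rg s' vC = 0 -> released s' (rg s' vI) /\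
    ck s' + ticks (pot (ar s' aPR) (ar s' aPT)) + ticks (rg s' vI) <= T + ticks L,
  rg s' vC <> 0 -> deviation s' & ck s' <= T + ticks L + 200].
apply: (@wp_while _ _ _ _ _ IO (fun s' => rg s' vI)).
  split; hs; [| by lia | | by [] | by rewrite /T; tlia].
    by case: cs1 => [[[h1 h2 h3 h4] h5 h6 h7 h8] h9 h10 h11]; do 3 (split; hs => //).
  move=> _; split; last by rewrite /T; tlia.
  split; hs=> //; last by lia.
  move=> k hk; have qn : q k < n by apply: (q_lt Hq); lia.
  by have [_ [_ ->]] := hP _ qn => //; exists k.
clear cs1 dr sp0 hP tm1 eL rg1 ar1 ck1 pd1 ou1.
move=> [rg1 ar1 ck1 pd1 ou1] [cs1 hi h0 h1 tm].
move: (cs1) => [[[f1 f2 f3 f4] f5 f6 f7 f8] f9 f10 f11].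
move: f1 f2 f3 f4 f5 f6 f7 f8 f9 f10 f11 hi h0 h1 tm; hs.
move=> f1 f2 f3 f4 f5 f6 f7 f8 f9 f10 f11 hi h0 h1 tm.
have TL : T + ticks L + 250 <= ck0 + ticks (10 * (n + m2 + 1)) by rewrite /T; tlia.
split; [by okt | rewrite !(eqb0, sub_val) => /nat_of_bool_neq0
  | rewrite !(eqb0, sub_val) => /nat_of_bool_eq0]; last first.
  rewrite f6 negbK => h; split; hs; [by [] | | by [] | by lia].
  move=> c0; have [[_ _ _ hd] _] := h0 c0; move: h; rewrite c0 eqxx andbT => h k hk.
  by apply: hd; lia.
rewrite f6 negbK => /andP[lt /eqP c0]; have {h0 h1} [rel tm1] := h0 c0.
set i := rg1 vI - 1; have ei : rg1 vI = i.+1 by rewrite /i; lia.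
have iL : s0 <= i < L by lia.
have [rp1 rp2 rp3] := Hrp iL.
have qn : q i < n by apply: (q_lt Hq); lia.
do 2 wstep; rewrite f11 -/i; apply: wp_seqI.
have [Hb hP hq0 hd] := rel; move: Hb hP hq0 hd; hs => Hb hP hq0 hd; rewrite ei in hP.
have Pq : ar1 aPR (q i) = 1.
  by have [_ [_ ->]] := hP _ qn => //; exists i => //; lia.
have pv := @pot_visit n HD NX HE (ar1 aPR) (ar1 aPT) (q i) (rg1 vCnt) qn.
have cn3 := b_cnt3 Hb; have {}pv := pv _ _; rewrite Pq in pv.
have {}pv := pv isT (ltnW cn3); have srp := size_rp iL.
pose IS s' := [/\ ar s' = ar1, (forall j, j <> vC -> rg s' j = updn rg1 vI i j),
  rg s' vC <= m2 /\
  exists2 sk, lst (rp i) = sk ++ lst (rg s' vC) &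
     forall a, a \in sk -> a = fst i \/ ar1 aPR a < 2 &
  ck s' + ticks (size (lst (rg s' vC))) <= ck1 + 50 + ticks (size (lst (rp i)))].
apply: (@wp_while _ _ _ _ _ IS (fun s' => size (lst (rg s' vC)))).
  split; hs; [by [] | | | by tlia].
    by move=> j; case: j => [|[|[|[|[|[|[|[|[|[|j]]]]]]]]]].
  by split=> //; exists [::].
move=> [rg2 ar2 ck2 pd2 ou2] [eA eR [c2 [sk esk hsk]] tm2].
move: eA eR c2 esk tm2; hs => eA eR c2 esk tm2; subst ar2.
have eI : rg2 vI = i by rewrite eR.
have cM : rg2 vC < M by lia.
(* The conjunction in the loop test is not lazy: [HD] is read at cell 0 as well, which [HD_0] makes
   harmless. *)
have HDn : HD (rg2 vC) < n.
  by have [->|ne] := eqVneq (rg2 vC) 0; [exact: HD_0 | apply: HD_lt; lia].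
rewrite f1 f10 eI; split; [by okt | rewrite !(eqb0, sub_val) => /nat_of_bool_neq0
  | rewrite !(eqb0, sub_val) => /nat_of_bool_eq0].
- move=> /andP[cpos]; rewrite !negbK => hbad.
  have cok : 0 < rg2 vC <= m2 by lia.
  have el := lst_cons HD NX_lt cok; have lt' := NX_lt cok.
  rewrite el in esk tm2; wstep; split; hs; last by rewrite f2 el.
  split; hs; [by [] | | | by rewrite f2 /= in tm2 *; tlia].
    by move=> j ne; have := eR j ne; move: ne; case: j => [|[|[|[|[|[|[|[|[|[|j]]]]]]]]]] //=.
  rewrite f2; split; first by lia.
  exists (rcons sk (HD (rg2 vC))); first by rewrite cat_rcons.
  move=> a; rewrite mem_rcons inE => /orP[/eqP ->|]; last exact: hsk.
  by move: hbad; case: eqP => [-> _|_]; [left | right; lia].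
- move=> hexit.
  have [eC|/eqP cne] := eqVneq (rg2 vC) 0.
    rewrite eC in esk; rewrite cats0 in esk.
    have dead : dead_at i.
      move=> a; rewrite mem_filter esk => /andP[/eqP af /hsk [//|Pa]].
      exact: (dead_of_marks Hb hP).
    have cui : cur i \in nb (q i) by case: (Hlink iL).
    (* The parent of position [i] has been reached already: it is the next position, released just
       before, or a source. *)
    have Pcu : 2 <= ar1 aPR (cur i).
      have [_ l1 l2] := Hlink iL; have [lt1|ge1] := ltnP i.+1 L.
        rewrite (l1 lt1); apply: (released_ge2 rel) => //; hs; lia.
      have iF : inF s0 (cur i) by apply: l2; lia.
      by have [_ [_ ->]] // := conj I (proj1 (hP _ (inF_lt r_lt Hq s0L iF))).
    have qM : q i < M by lia.
    have eR1 : rg2 vCnt = rg1 vCnt by rewrite eR.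
    have cb := b_cnt Hb.
    wstep; first by move=> /(_ eC).
    move=> _; wstep; rewrite eI f8; do 3 wstep; rewrite f9; do 2 wstep.
    set s2 := HSt _ _ _ _ _.
    have cs2 : ctx2 s2.
      by do 3 (split; rewrite /s2; hs; rewrite ?eR; hs => //).
    have adj2 : adjacency s2 by case: cs2 => [[]].
    have Hb2 := base_release Hb qn Pq cui Pcu.
    have dr2 : drained s2 False.
      by split=> //; rewrite /s2; hs; rewrite ?eI eR1 addn1.
    apply: wp_conseq (drain_spec wl_ge M_ge NX_lt HD_lt nb_sym nb_sum adj2 dr2) _.
    move=> s3 x3 [[dr3 _] sp3 [gr1 gr2] tm3].
    have cs3 : ctx2 s3 by apply: (ctx2_frame x3).
    have eI3 : rg s3 vI = i by rewrite (frame_rg x3) // /s2; hs.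
    have eC3 : rg s3 vC = 0 by rewrite (frame_rg x3) // /s2; hs.
    rewrite sp3 in dr3.
    have {}tm3 : ck s3 + ticks (pot (ar s3 aPR) (ar s3 aPT)) + ticks i <= T + ticks L.
      move: tm3; rewrite /s2; hs; rewrite eR1; move: tm2 tm1 srp pv; rewrite ei.
      by rewrite esk eC /=; tlia.
    split; rewrite ?eI3; last by lia.
    split; rewrite ?eI3; [by [] | by lia | | by rewrite eC3 | by tlia].
    move=> _; split; last by [].
    have e2 : ar s2 aPR = upd (ar1 aPR) (q i) (rg1 vCnt).
      by rewrite /s2; hs; rewrite eR1.
    rewrite e2 in gr1 gr2.
    have p3 x : x <> q i -> ar1 aPR x <> 0 -> ar s3 aPR x = ar1 aPR x.
      by move=> ne Px; have [|-> _] := gr1 x; rewrite upd_other.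
    have p3i : ar s3 aPR (q i) = rg1 vCnt.
      by have [|-> _] := gr1 (q i); rewrite upd_same //; lia.
    split=> //.
    - move=> x xn; have [p1 p2] := hP _ xn.
      have [->|/eqP ne] := eqVneq x (q i).
        rewrite p3i; split; split; try by lia.
          by move=> /(inF_q r_lt Hq); lia.
        by move=> [j hj /(q_inj Hq)]; lia.
      have eqj : (exists2 j, s0 <= j < i.+1 & x = q j) <-> exists2 j, s0 <= j < i & x = q j.
        split=> [[j hj ej]|[j hj ej]]; exists j => //; last by lia.
        by have [e|] := eqVneq j i; [rewrite e in ej | lia].
      rewrite -eqj -p1 -p2; have [P0|/eqP Px] := eqVneq (ar1 aPR x) 0; last by rewrite p3.
      by rewrite P0; have [|->|h] := gr2 x; [rewrite upd_other | | lia].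
    - move=> k hk; have [->|/eqP ne] := eqVneq k i; first by rewrite p3i; lia.
      by rewrite p3; [exact: hq0 | move=> /(q_inj Hq); lia | exact: hq0].
    - move=> k hk; have [->|ne] := eqVneq k i; first exact: dead.
      by apply: hd; lia.
  wstep; last by move=> /cne.
  move=> _; wstep.
  have cok : 0 < rg2 vC <= m2 by lia.
  move: hexit; rewrite !negbK; have -> /= : 0 < rg2 vC by lia.
  rewrite !negbK => /andP[/eqP nf Pc].
  have cs2 : ctx2 (HSt rg2 ar1 ck2 pd2 ou2).
    by do 3 (split; hs; rewrite ?eR; hs => //).
  have tme : ck2 + 100 <= T + ticks L + 100.
    by move: tm2 tm1 srp pv; tlia.
  split; hs; last by rewrite eI; lia.
  split; hs; rewrite ?eI; [ | by lia | by move=> /cne | | by lia].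
    by case: cs2 => [[[g1 g2 g3 g4] g5 g6 g7 g8] g9 g10 g11]; do 3 (split; hs => //).
  have eR1 : rg2 vCnt = rg1 vCnt by rewrite eR.
  move=> _; split; hs; rewrite ?eI ?eR1 //.
    split; first by move=> k hk; apply: hd; lia.
    exists sk => // a /hsk [//|Pa] _.
    exact: (dead_of_marks Hb hP).
Qed.

End Positions.
End Program.

(** * Configurations *)

(* Position [k] is the vertex [cq k] with its parent [ccur k], the parent [cfst k]
   that was tried first and the list [crp k] of the neighbours not yet considered.
   A phase starts where [cst k] is nonzero: it is a path from a terminal to the
   previous positions, and [cst k = 2] when it can still be changed. *)
Record conf := Conf {
  cq : nat -> nat; ccur : nat -> nat; cfst : nat -> nat; crp : nat -> nat; cst : nat -> nat
}.

Definition conf_of (s : hst) : conf :=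
  Conf (ar s aSE) (ar s aCU) (ar s aFS) (ar s aRP) (ar s aFL).

(** The arrays keep stale entries beyond the current length, so configurations are compared on a
    prefix. *)
Definition same (L : nat) (C C' : conf) : Prop :=
  forall k, k < L -> [/\ cq C' k = cq C k, ccur C' k = ccur C k, cfst C' k = cfst C k,
    crp C' k = crp C k & cst C' k = cst C k].

Lemma same_sym L C C' : same L C C' -> same L C' C.
Proof. by move=> h k /h [-> -> -> -> ->]. Qed.

Lemma same_trans L C C' C'' : same L C C' -> same L C' C'' -> same L C C''.
Proof. by move=> h h' k kL; have [-> -> -> -> ->] := h' _ kL; apply: h. Qed.

Lemma same_le L L' C C' : L' <= L -> same L C C' -> same L' C C'.
Proof. by move=> le h k kL; apply: h; lia. Qed.

Definition phase (C : conf) (L s e : nat) : Prop :=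
  [/\ s < e <= L, cst C s <> 0, forall k, s < k < e -> cst C k = 0 &
      e = L \/ cst C e <> 0].

Section Configurations.

Variables (n m2 : nat) (HD NX HE : nat -> nat).
Notation nb := (nb HD NX HE).
Notation lst := (lst HD NX).
Variables (r : nat) (Wt : nat -> Prop).

Definition cdead (C : conf) (s k : nat) : Prop :=
  dead_at n HD NX HE r (cq C) (cfst C) (crp C) s k.

(** The last clause keeps the current parent out of the remaining choices, so that no choice is made
    twice. *)
Definition pos_ok (C : conf) (k : nat) : Prop :=
  [/\ crp C k <= m2, uniq (lst (crp C k)), {subset lst (crp C k) <= nb (cq C k)} &
      ccur C k \notin remaining HD NX (cfst C) (crp C) k].

Definition seg_ok (C : conf) (s e : nat) : Prop :=
  forall k, s <= k < e -> [/\ ccur C k \in nb (cq C k), k.+1 < e -> ccur C k = cq C k.+1 &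
    k.+1 = e -> inF r (cq C) s (ccur C k)].

Record cfg (C : conf) (L : nat) : Prop := {
  c_dist : distinct n r (cq C) L;
  c_st0 : 0 < L -> cst C 0 <> 0;
  c_pos : forall k, k < L -> pos_ok C k;
  c_ph : forall s e, phase C L s e -> Wt (cq C s) /\ seg_ok C s e
}.

Definition flag_ok (C : conf) (s e : nat) : Prop :=
  (cst C s = 1 /\ forall k, s <= k < e -> cdead C s k) \/
  (cst C s = 2 /\ ~ forall k, s <= k < e -> cdead C s k).

Definition flags (C : conf) (L : nat) : Prop :=
  forall s e, phase C L s e -> flag_ok C s e.

Lemma inF_same L C C' s x : same L C C' -> s <= L ->
  inF r (cq C) s x -> inF r (cq C') s x.
Proof.
move=> sm sL [->|[j js ->]]; first by left.
by right; exists j => //; have [-> _ _ _ _] : _ := sm j (leq_trans js sL).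
Qed.

Lemma live_same L C C' s k a : same L C C' -> s <= k < L ->
  live n HD NX HE r (cq C) s k a -> live n HD NX HE r (cq C') s k a.
Proof.
move=> sm hk h Z ZF Zc; apply: h => [x Fx|x y xn xy Zy hx].
  by apply: ZF; apply: inF_same sm _ Fx; lia.
apply: Zc xy Zy _ => // j hj; have [|-> _ _ _ _] := sm j; first by lia.
exact: hx.
Qed.

Lemma dead_same L C C' s k : same L C C' -> s <= k < L -> cdead C s k -> cdead C' s k.
Proof.
move=> sm hk h a; have [|eq _ ef er _] := sm k; first by lia.
rewrite /remaining ef er => /h hn hl; apply: hn.
by apply: live_same (same_sym sm) hk hl.
Qed.

Lemma flag_same L C C' s e : same L C C' -> s < e <= L -> flag_ok C s e -> flag_ok C' s e.
Proof.
move=> sm he; have [|_ _ _ _ es] := sm s; first by lia.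
rewrite /flag_ok es => [[[e1 h]|[e2 h]]]; [left | right]; split=> //.
  by move=> k hk; apply: dead_same sm _ (h k hk); lia.
by move=> h'; apply: h => k hk; apply: dead_same (same_sym sm) _ (h' k hk); lia.
Qed.

Lemma seg_same L C C' s e : same L C C' -> s < e <= L -> seg_ok C s e -> seg_ok C' s e.
Proof.
move=> sm he h k hk; have [h1 h2 h3] := h k hk.
have [|-> -> _ _ _] := sm k; first by lia.
split=> // [lt|ee].
  by have [|-> _ _ _ _] := sm k.+1; [lia | exact: h2].
by apply: inF_same sm _ (h3 ee); lia.
Qed.

Lemma pos_same L C C' k : same L C C' -> k < L -> pos_ok C k -> pos_ok C' k.
Proof.
by move=> sm kL; rewrite /pos_ok /remaining; have [-> -> -> -> _] := sm k kL.
Qed.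

Lemma distinct_same L C C' : same L C C' -> distinct n r (cq C) L -> distinct n r (cq C') L.
Proof.
move=> sm h k kL; have [h1 h2 h3] := h k kL; have [-> _ _ _ _] := sm k kL.
split=> // j jk; have [-> _ _ _ _] : _ := sm j (ltn_trans jk kL).
exact: h3.
Qed.

(** No phase straddles [L], because [L] is the end or the start of a phase of the longer
    configuration. *)
Lemma phase_same L L' C C' s e : same L C C' -> L <= L' -> L = L' \/ cst C' L <> 0 ->
  s < L -> phase C' L' s e -> phase C L s e.
Proof.
move=> sm LL' hL sL [he hs hz hend].
have eL : e <= L.
  rewrite leqNgt; apply/negP => lt; case: hL => [eq|]; first by lia.
  by apply; apply: hz; lia.
have st k : k < L -> cst C' k = cst C k by case/sm.
split; [by lia | by rewrite -st | by move=> k hk; rewrite -st; [exact: hz | lia] |].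
have [->|ne] := eqVneq e L; first by left.
by right; rewrite -st; [case: hend => // ee; lia | lia].
Qed.

Lemma phase_trunc L L1 C s e : L1 <= L -> L1 = L \/ cst C L1 <> 0 ->
  phase C L1 s e -> phase C L s e.
Proof.
move=> le h1 [he hs hz hend]; split=> //; first by lia.
by case: hend => [->|]; [case: h1 => [->|]; [left | right] | right].
Qed.

Lemma cfg_trunc L L1 C : L1 <= L -> L1 = L \/ cst C L1 <> 0 -> cfg C L -> cfg C L1.
Proof.
move=> le h1 [d st0 ps ph]; split.
- by move=> k kL; apply: d; lia.
- by move=> L0; apply: st0; lia.
- by move=> k kL; apply: ps; lia.
- by move=> s e /(phase_trunc le h1); apply: ph.
Qed.

Lemma flags_trunc L L1 C : L1 <= L -> L1 = L \/ cst C L1 <> 0 -> flags C L -> flags C L1.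
Proof. by move=> le h1 fl s e /(phase_trunc le h1); apply: fl. Qed.

Section Extension.

Variables (C C' : conf) (L L' : nat).
Hypothesis sm : same L C C'.
Hypothesis LL' : L < L'.
Hypothesis st_new : cst C' L <> 0.
Hypothesis st_zero : forall k, L < k < L' -> cst C' k = 0.

Lemma phase_last s e : phase C' L' s e -> L <= s -> s = L /\ e = L'.
Proof.
move=> [he hs hz hend] Ls.
have eL : s = L.
  by apply/eqP/negPn/negP => ne; apply: hs; apply: st_zero; lia.
split=> //; case: hend => // he'; apply/eqP/negPn/negP => ne.
by apply: he'; apply: st_zero; lia.
Qed.

Lemma cfg_extend : cfg C L -> distinct n r (cq C') L' ->
  (forall k, L <= k < L' -> pos_ok C' k) -> Wt (cq C' L) -> seg_ok C' L L' -> cfg C' L'.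
Proof.
move=> [d st0 ps ph] d' ps' w sg; split=> //.
- move=> _; have [e|ne] := eqVneq L 0; first by have := st_new; rewrite e.
  by have [|_ _ _ _ ->] := sm (k := 0); [lia | apply: st0; lia].
- move=> k kL'; have [kL|Lk] := ltnP k L; last by apply: ps'; lia.
  exact: pos_same sm kL (ps _ kL).
- move=> s e hse; have [sL|Ls] := ltnP s L.
    have h := phase_same sm (ltnW LL') (or_intror st_new) sL hse.
    have [w' sg'] := ph _ _ h; have [he _ _ _] := h.
    have [-> _ _ _ _] := sm sL; split=> //; exact: seg_same sm he sg'.
  by have [-> ->] := phase_last hse Ls.
Qed.

Lemma flags_extend : flags C L -> flag_ok C' L L' -> flags C' L'.
Proof.
move=> fl f s e hse; have [sL|Ls] := ltnP s L.
  have h := phase_same sm (ltnW LL') (or_intror st_new) sL hse.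
  have [he _ _ _] := h; exact: flag_same sm he (fl _ _ h).
by have [-> ->] := phase_last hse Ls.
Qed.

End Extension.

Lemma phase_exists C L k : (0 < L -> cst C 0 <> 0) -> k < L ->
  exists s e, phase C L s e /\ s <= k < e.
Proof.
move=> st0 kL.
have [s [sk hs hz]] : exists s, [/\ s <= k, cst C s <> 0 &
    forall j, s < j <= k -> cst C j = 0].
  elim: k kL => [|k IH] kL.
    by exists 0; split=> //; [apply: st0 | lia].
  have [z|/eqP nz] := eqVneq (cst C k.+1) 0; last by exists k.+1; split=> //; lia.
  have [|s [sk hs hz]] := IH; first by lia.
  exists s; split=> //; first by lia.
  by move=> j hj; have [->|ne] := eqVneq j k.+1; [|apply: hz; lia].
have [e [ke eL hz' he]] : exists e, [/\ k < e, e <= L,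
    forall j, k < j < e -> cst C j = 0 & e = L \/ cst C e <> 0].
  have [d le_d] := ubnP (L - k); elim: d k kL le_d {sk hz} => // d IH k kL le_d.
  have [e1|ne] := eqVneq k.+1 L; first by exists L; split=> //; [lia | left].
  have [z|/eqP nz] := eqVneq (cst C k.+1) 0; last first.
    by exists k.+1; split=> //; [lia | right].
  have [||e [ke eL hz' he]] := IH k.+1; [lia | lia |].
  exists e; split=> //; first by lia.
  by move=> j hj; have [->|ne'] := eqVneq j k.+1; [|apply: hz'; lia].
exists s, e; split; last by lia.
split=> //; first by lia.
by move=> j hj; have [jk|kj] := leqP j k; [apply: hz; lia | apply: hz'; lia].
Qed.

Hypothesis r_lt : r < n.

Lemma live_not_pos C s t x : live n HD NX HE r (cq C) s t x -> t < n ->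
  forall L, distinct n r (cq C) L -> t < L -> forall j, s <= j <= t -> x <> cq C j.
Proof.
move=> h _ L d tL j hj ex.
suff : forall j, s <= j <= t -> x <> cq C j by move=> /(_ j hj).
apply: (h (fun x => forall j, s <= j <= t -> x <> cq C j)) => //.
by move=> y Fy i hi ey; subst y; apply: (inF_q r_lt d _ _ Fy); lia.
Qed.

Section NewPhase.

Variables (C : conf) (P A : nat -> nat) (L0 L1 L2 : nat).
Hypothesis nb_sym : forall x y, x < n -> y \in nb x -> y < n /\ x \in nb y.
Hypothesis d2 : distinct n r (cq C) L2.
Hypothesis L12 : L1 < L2.
Hypothesis new : forall k, L1 <= k < L2 ->
  [/\ k.+1 < L2 -> A (cq C k) = cq C k.+1, 3 <= P (cq C k), ccur C k = A (cq C k),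
      cfst C k = A (cq C k) & crp C k = HE (cq C k)].
(** The search may have been run from fewer than [L1] positions. It is enough that those added since
    are closed under search parents: its bridges then decide about the later phases too. *)
Hypothesis roots : forall x, x < n -> P x = 2 -> inF r (cq C) L1 x.
Hypothesis closed : forall x, x < n -> 3 <= P x -> inF r (cq C) L1 x ->
  inF r (cq C) L1 (A x).

(** Outside the subtree [I], a walk can enter [I] only at the position [k] itself, which is blocked.
    No earlier position lies in [I], since its parents would lead to position [k]; and all
    neighbours of position [k] except its parent lie in [I]. *)
Lemma dead_bridge k : L1 <= k < L2 -> bridge n HD NX HE P A (cq C k) -> cdead C L1 k.
Proof.
move=> hk [I [Iv I3 Ie Ic]] a; have [_ _ _ ef er] := new hk.
rewrite mem_filter ef er => /andP[/eqP ne an] /(_ (fun x => ~ I x)) h.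
have nIa : ~ I a; last by have [_ /ne] := Ie _ _ Iv an nIa.
apply: h => [x Fx Ix|x y xn xy nIy hx Ix].
  have := Ic x Ix (inF r (cq C) L1) closed Fx.
  by apply: (inF_q r_lt d2); lia.
by have [ex _] := Ie _ _ Ix xy nIy; apply: (hx k) => //; lia.
Qed.

(** If the whole phase were dead, the vertices live at [t] would be closed under all edges but the
    parent edge of position [t]: a live vertex next to a position [j] would be a remaining neighbour
    of [j], or its parent, which for [j < t] is again a position. Position [t] would then be live,
    which a blocked position never is. *)
Lemma live_nonbridge t : L1 <= t < L2 -> nonbridge n HD NX HE P A (cq C t) ->
  ~ forall k, L1 <= k < L2 -> cdead C L1 k.
Proof.
move=> ht nB dead; have tn : t < n by have := L_lt r_lt d2; lia.
have np x : live n HD NX HE r (cq C) L1 t x -> forall j, L1 <= j <= t -> x <> cq C j.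
  by move=> h; apply: (live_not_pos h tn d2); lia.
suff : live n HD NX HE r (cq C) L1 t (cq C t).
  by move=> /np /(_ t); apply => //; lia.
apply: (nB (live n HD NX HE r (cq C) L1 t)) => [x xn Px Z ZF _|x y xn xy ly ne].
  by apply: ZF; apply: roots.
case: (classic (exists2 j, L1 <= j <= t & x = cq C j)) => [[j hj ex]|nx]; last first.
  move=> Z ZF Zc; apply: (Zc x y) => //; first exact: ly.
  by move=> j hj ex; apply: nx; exists j.
exfalso; have hj2 : L1 <= j < L2 by lia.
have [l1 _ ec ef er] := new hj2.
have ncur : y <> A (cq C j).
  move=> ey; have [ejt|njt] := eqVneq j t; first by apply: ne; rewrite ex ey ejt.
  have := np _ ly j.+1; rewrite ey l1; [by apply => //; lia | lia].
apply: (dead j hj2 y); first by rewrite mem_filter ef er -/(nb _) -ex xy andbT; apply/eqP; rewrite ex.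
move=> Z ZF Zc; apply: ly => // x' y' xn' xy' Zy' hx'; apply: (Zc x' y') => // i hi.
by apply: hx'; lia.
Qed.

End NewPhase.
End Configurations.

(** * The path of search parents from a vertex to the previous positions *)

Definition walk : hcmd :=
  vF <-- HC 1 ;;
  HWh (not_ (eq_ (HR aPR (HV vX)) (HC 2))) (
    HSto aSE (HV vL) (HV vX) ;;
    HSto aFL (HV vL) (HC 0) ;;
    HSto aCU (HV vL) (HR aPA (HV vX)) ;;
    HSto aFS (HV vL) (HR aPA (HV vX)) ;;
    HSto aRP (HV vL) (HR aHE (HV vX)) ;;
    HIf (lt_ (HR aLO (HV vX)) (HR aPR (HV vX))) (vF <-- HC 2) HSkip ;;
    HSto aPR (HV vX) (HC 2) ;;
    vX <-- HR aPA (HV vX) ;;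
    vL <-- plus1 (HV vL)).

Section Program.

Variables (wl B M n m2 : nat) (HD NX HE : nat -> nat).
Hypothesis wl_ge : B + n + m2 + 100 < wl.
Hypothesis M_ge : n + m2 + 1 < M.
Hypothesis NX_lt : forall c, 0 < c <= m2 -> NX c < c.
Hypothesis HD_lt : forall c, 0 < c <= m2 -> HD c < n.
Hypothesis HD_0 : HD 0 < n.
Hypothesis HE_le : forall v, v < n -> HE v <= m2.
Notation nb := (nb HD NX HE).
Notation adjacency := (adjacency n HD NX HE).
Notation wp := (wp wl B M).
Hypothesis nb_sym : forall x y, x < n -> y \in nb x -> y < n /\ x \in nb y.
Hypothesis nb_uniq : forall x, x < n -> uniq (nb x).
Hypothesis nb_sum : \sum_(v < n) size (nb v) <= m2.

Variables (r : nat) (Wt : nat -> Prop).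
Hypothesis r_lt : r < n.

Section Walk.

Variables (C : conf) (P A Lw : nat -> nat) (L0 x0 : nat).

(** [w_F] is the outcome of the bridge test for the path: 2 as soon as one vertex has a low point
    below its number. [w_P] allows only one change of marks, to 2 on the new path. *)
Record walked (s : hst) : Prop := {
  w_adj : adjacency s;
  w_arr : [/\ ar s aPA = A, ar s aLO = Lw & rg s vR = r];
  w_same : same L0 C (conf_of s);
  w_L : L0 <= rg s vL;
  w_dist : distinct n r (ar s aSE) (rg s vL);
  w_x : rg s vX < n /\ 2 <= P (rg s vX);
  w_P : forall v, v < n -> ar s aPR v = P v \/
    (ar s aPR v = 2 /\ exists2 k, L0 <= k < rg s vL & ar s aSE k = v);
  w_P2 : forall k, L0 <= k < rg s vL -> ar s aPR (ar s aSE k) = 2;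
  w_new : forall k, L0 <= k < rg s vL ->
    [/\ 3 <= P (ar s aSE k), P (rg s vX) < P (ar s aSE k),
        k.+1 < rg s vL -> A (ar s aSE k) = ar s aSE k.+1,
        k.+1 = rg s vL -> A (ar s aSE k) = rg s vX &
        [/\ ar s aCU k = A (ar s aSE k), ar s aFS k = A (ar s aSE k),
            ar s aRP k = HE (ar s aSE k) & ar s aFL k = 0]];
  w_start : (rg s vL = L0 -> rg s vX = x0) /\ (L0 < rg s vL -> ar s aSE L0 = x0);
  w_F : (rg s vF = 1 /\ forall k, L0 <= k < rg s vL -> P (ar s aSE k) <= Lw (ar s aSE k)) \/
        (rg s vF = 2 /\ exists2 k, L0 <= k < rg s vL & Lw (ar s aSE k) < P (ar s aSE k))
}.

Hypothesis Hpar : forall x, x < n -> 3 <= P x ->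
  [/\ A x < n, A x \in nb x & 2 <= P (A x) < P x].
Hypothesis d0 : distinct n r (cq C) L0.
Hypothesis P_old : forall k, k < L0 -> P (cq C k) <= 2.
Hypothesis P_root : P r <= 2.

(** Marks strictly decrease along parents, so the walk ends at a mark 2. The vertices passed receive
    this mark themselves, so that later walks stop at them. *)
Lemma walk_spec s : adjacency s -> same L0 C (conf_of s) ->
  [/\ ar s aPR = P, ar s aPA = A & ar s aLO = Lw] ->
  [/\ rg s vR = r, rg s vL = L0 & rg s vX = x0] -> x0 < n -> 2 <= P x0 ->
  wp walk (fun s' => [/\ walked s', P (rg s' vX) = 2 &
    ck s' <= ck s + 50 + ticks (rg s' vL - L0)]) s.
Proof.
case: s => rg0 ar0 ck0 pd0 ou0 [] a1 a2 a3 a4 sm0 [b1 b2 b3] [e1 e2 e3] x0n Px0.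
move: a1 a2 a3 a4 sm0 b1 b2 b3 e1 e2 e3; hs => a1 a2 a3 a4 sm0 b1 b2 b3 e1 e2 e3.
rewrite /walk; wstep.
pose I s' := walked s' /\ ck s' <= ck0 + 20 + ticks (rg s' vL - L0).
apply: (@wp_while _ _ _ _ _ I (fun s' => P (rg s' vX))).
  split; last by hs; lia.
  split; hs=> //.
  - by rewrite e2.
  - by rewrite e2; apply: distinct_same sm0 d0.
  - by rewrite e3.
  - by move=> v _; left; rewrite b1.
  - by move=> k; lia.
  - by move=> k; lia.
  - by split=> // h; lia.
  - by left; split=> // k; lia.
move=> [rg1 ar1 ck1 pd1 ou1] [w tm]; case: (w) => [[f1 f2 f3 f4] [g1 g2 g3] sm hL dd [xn Px] hP hP2 hnew hst hF].
move: f1 f2 f3 f4 g1 g2 g3 sm hL dd xn Px hP hP2 hnew hst hF tm; hs.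
move=> f1 f2 f3 f4 g1 g2 g3 sm hL dd xn Px hP hP2 hnew hst hF tm.
have Ln := L_lt r_lt dd.
split; [by okt | rewrite eqb0 => /nat_of_bool_neq0 /eqP ne2
  | rewrite eqb0 => /nat_of_bool_eq0]; last first.
  rewrite negbK => /eqP P2; split; hs; [| | by tlia].
    by case: w => *; split.
  have [<- //|[_ [k hk ek]]] := hP _ xn.
  by have [_ lt _ _ _] := hnew _ hk; rewrite ek in lt; lia.
have eP : ar1 aPR (rg1 vX) = P (rg1 vX) by have [//|[/ne2]] := hP _ xn.
have Px3 : 3 <= P (rg1 vX) by move: ne2; rewrite eP; lia.
have [An Ab PA] := Hpar xn Px3.
set x := rg1 vX in xn Px hP hnew hst ne2 eP Px3 An Ab PA *.
set L := rg1 vL in hL dd hP hP2 hnew hst hF tm Ln *.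
have xq k : k < L -> ar1 aSE k <> x.
  move=> kL ek; have [lt|ge] := ltnP k L0.
    by have [eq _ _ _ _] := sm k lt; have := P_old lt; rewrite -eq /= ek; lia.
  by apply: ne2; rewrite -ek; apply: hP2; lia.
have xr : x <> r by move=> e; rewrite e in Px3; lia.
have oth (f : nat -> nat) v k : k < L -> upd f L v k = f k by move=> kL; rewrite upd_other //; lia.
do 5 wstep; apply: wp_seqI.
set Q := (X in wp _ X _).
suff fin F : (F = 2 /\ Lw x < P x) \/ (F = rg1 vF /\ P x <= Lw x) ->
   forall rg2 ck2, (forall i, rg2 i = updn rg1 vF F i) -> ck2 <= ck1 + 120 ->
   Q (HSt rg2 (upda (upda (upda (upda (upda ar1 aSE L x) aFL L 0) aCU L (ar1 aPA x))
       aFS L (ar1 aPA x)) aRP L (ar1 aHE x)) ck2 pd1 ou1).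
  wstep => [/nat_of_bool_neq0 lt|/nat_of_bool_eq0 ge]; wstep.
    rewrite g2 eP -/x in lt; rewrite -/x; apply: (fin 2); [by left | by [] | by lia].
  rewrite g2 eP -/x -leqNgt in ge; hs; rewrite -/x; apply: (fin (rg1 vF)); [by right | | by hs; lia].
  by move=> i; rewrite /updn; case: Nat.eqb_spec => [->|].
move=> hFF rg2 ck2 eR tc; rewrite /Q.
have eX : rg2 vX = x by rewrite eR.
have eL : rg2 vL = L by rewrite eR.
do 3 wstep; rewrite eX eL g1 f3.
split; last by hs; lia.
split; last by hs; tlia.
have aF : rg2 vF = F by rewrite eR.
have rgo i : i <> vX -> i <> vL -> updn (updn rg2 vX (A x)) vL (L + 1) i = rg2 i.
  by move=> i1 i2; rewrite /updn; do 2 case: Nat.eqb_spec => //.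
have lastk k : L0 <= k < L + 1 -> k <> L -> L0 <= k < L by lia.
split; hs.
- by split; hs => //; rewrite eR.
- by split=> //; rewrite eR.
- move=> k kL; have kL' : k < L by lia.
  by have [h1 h2 h3 h4 h5] := sm k kL; rewrite /= !oth.
- by lia.
- move=> k; rewrite addn1 ltnS leq_eqVlt => /orP[/eqP ->|kL].
    by rewrite upd_same; split=> // j jL; rewrite oth //; apply: xq.
  have [h1 h2 h3] := dd k kL; rewrite oth //; split=> // j jk; rewrite oth; [exact: h3 | lia].
- by split=> //; lia.
- move=> v vn; rewrite updE; case: eqP => [->|ne].
    by right; split=> //; exists L; rewrite ?upd_same //; lia.
  have [|[h1 [k hk ek]]] := hP _ vn; first by left.
  by right; split=> //; exists k; [lia | rewrite oth //; lia].
- move=> k hk; have [->|/eqP nk] := eqVneq k L; first by rewrite !upd_same.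
  have hk' := lastk k hk nk; rewrite oth; last by lia.
  by rewrite updE; case: eqP => // _; apply: hP2.
- move=> k hk; have [->|/eqP nk] := eqVneq k L.
    rewrite !upd_same; split=> //; try lia.
  have hk' := lastk k hk nk; have [h1 h2 h3 h4 [h5 h6 h7 h8]] := hnew k hk'.
  have kL : k < L by lia.
  rewrite ![upd _ _ _ k]oth //; split=> //; first by lia.
    move=> _; have [e|ne] := eqVneq k.+1 L; first by rewrite e upd_same h4.
    by rewrite oth; [apply: h3 | ]; lia.
  by lia.
- split=> [h|_]; first by lia.
  have [e|ne] := eqVneq L0 L; last by rewrite oth; [apply: (proj2 hst) | ]; lia.
  by rewrite e upd_same; apply: (proj1 hst).
- rewrite aF; case: hFF => [[eF lt]|[eF le]].
    by right; split=> //; exists L; rewrite ?upd_same //; lia.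
  case: hF => [[h1 h2]|[h1 [k hk h2]]].
    left; split; first by rewrite eF.
    move=> k hk; have [->|/eqP nk] := eqVneq k L; first by rewrite upd_same.
    by have hk' := lastk k hk nk; rewrite oth; [exact: h2 | lia].
  right; split; first by rewrite eF.
  by exists k; [lia | rewrite oth //; lia].
Qed.

End Walk.
End Program.

(** * Greedy completion of a configuration *)

Definition complete : hcmd :=
  vS <-- HV vL ;;
  prep ;;
  vOk <-- HC 1 ;;
  vJ <-- HC 0 ;;
  HWh (lt_ (HV vJ) (HV vW)) (
    vX <-- HR aIn (HB OpAdd (HV vT) (HV vJ)) ;;
    HIf (HR aPR (HV vX))
      (vS0 <-- HV vL ;;
       walk ;;
       HIf (lt_ (HV vS0) (HV vL)) (HSto aFL (HV vS0) (HV vF)) HSkip)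
      (vOk <-- HC 0) ;;
    vJ <-- plus1 (HV vJ)).

Lemma cfg_same n m2 HD NX HE r Wt L C C' : same L C C' ->
  cfg n m2 HD NX HE r Wt C L -> cfg n m2 HD NX HE r Wt C' L.
Proof.
move=> sm [d st0 ps ph]; split.
- exact: distinct_same sm d.
- by move=> L0; have [_ _ _ _ ->] := sm _ L0; apply: st0.
- by move=> k kL; apply: pos_same sm kL (ps _ kL).
- move=> s e hse; have sL : s < L by case: hse => *; lia.
  have h := phase_same sm (leqnn L) (or_introl erefl) sL hse.
  have [w sg] := ph _ _ h; have [he _ _ _] := h; have [-> _ _ _ _] := sm _ sL.
  by split=> //; apply: seg_same sm he sg.
Qed.

Lemma flags_same n HD NX HE r L C C' : same L C C' ->
  flags n HD NX HE r C L -> flags n HD NX HE r C' L.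
Proof.
move=> sm fl s e hse; have sL : s < L by case: hse => *; lia.
have h := phase_same sm (leqnn L) (or_introl erefl) sL hse.
by have [he _ _ _] := h; apply: flag_same sm he (fl _ _ h).
Qed.

Section Program.

Variables (wl B M n m2 : nat) (HD NX HE : nat -> nat).
Hypothesis wl_ge : B + n + m2 + 100 < wl.
Hypothesis M_ge : n + m2 + 1 < M.
Hypothesis NX_lt : forall c, 0 < c <= m2 -> NX c < c.
Hypothesis HD_lt : forall c, 0 < c <= m2 -> HD c < n.
Hypothesis HD_0 : HD 0 < n.
Hypothesis HE_le : forall v, v < n -> HE v <= m2.
Notation nb := (nb HD NX HE).
Notation adjacency := (adjacency n HD NX HE).
Notation wp := (wp wl B M).
Hypothesis nb_sym : forall x y, x < n -> y \in nb x -> y < n /\ x \in nb y.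
Hypothesis nb_uniq : forall x, x < n -> uniq (nb x).
Hypothesis nb_sum : \sum_(v < n) size (nb v) <= m2.

Variables (r tb nw : nat) (inp : nat -> nat).
Hypothesis r_lt : r < n.
Hypothesis tb_le : tb + nw <= B.
Hypothesis nw_le : nw <= n.
Hypothesis term_lt : forall j, j < nw -> inp (tb + j) < n.

Definition Wt (x : nat) : Prop := exists2 j, j < nw & x = inp (tb + j).

Notation cfg := (cfg n m2 HD NX HE r Wt).
Notation flags := (flags n HD NX HE r).

Definition ginv (s : hst) : Prop :=
  [/\ adjacency s, ar s aIn = inp, rg s vW = nw, rg s vT = tb & rg s vR = r].

Definition reach (w : nat) : Prop := forall Z : nat -> Prop, Z r ->
  (forall x y, x < n -> y \in nb x -> Z y -> Z x) -> Z w.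

Definition fresh (C : conf) (L L' : nat) : Prop :=
  forall k, L <= k < L' -> ccur C k = cfst C k /\ crp C k = HE (cq C k).

Lemma ginv_frame c s s' : hexec wl B M c s s' ->
  all (fun i => i \notin wregs c) [:: vN; vW; vT; vR] ->
  all (fun k => k \notin warrs c) [:: aHD; aNX; aHE; aIn] -> ginv s -> ginv s'.
Proof.
move=> x /and5P[w1 w2 w3 w4 _] /and5P[a1 a2 a3 a4 _] [[h1 h2 h3 h4] h5 h6 h7 h8].
have fr := frame_rg x; have fa := frame_ar x.
by do 2 (split; rewrite ?fr ?fa //).
Qed.

Lemma conf_frame c s s' : hexec wl B M c s s' ->
  all (fun k => k \notin warrs c) [:: aSE; aCU; aFS; aRP; aFL] -> conf_of s' = conf_of s.
Proof.
move=> x /and5P[a1 a2 a3 a4 /andP[a5 _]]; have fa := frame_ar x.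
by rewrite /conf_of !fa.
Qed.

(** A terminal left unmarked by the search cannot be reached from [r], and then there is no
    solution. A terminal already in the tree has mark 2: its walk is empty and starts no phase. *)
Lemma complete_spec s : ginv s -> cfg (conf_of s) (rg s vL) -> flags (conf_of s) (rg s vL) ->
  wp complete (fun s' => let L := rg s vL in let L' := rg s' vL in
    [/\ ginv s', same L (conf_of s) (conf_of s') /\ L <= L',
      (rg s' vOk = 1 /\ [/\ cfg (conf_of s') L', flags (conf_of s') L',
         fresh (conf_of s') L L' & forall x, Wt x -> inF r (ar s' aSE) L' x]) \/
      (rg s' vOk = 0 /\ exists2 w, Wt w & ~ reach w) &
      ck s' <= ck s + ticks (12 * (n + m2 + 1))]) s.
Proof.
move=> gi; set C0 := conf_of s; set L0 := rg s vL => cf0 fl0.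
have d0 := c_dist cf0; have L0n := L_lt r_lt d0.
rewrite /complete; wstep; apply: wp_seqI.
set s1 := HSt _ _ _ _ _.
have gi1 : ginv s1 by case: gi => [[h1 h2 h3 h4] h5 h6 h7 h8]; do 2 (split; rewrite /s1; hs => //).
have cx : ctx n HD NX HE r (cq C0) L0 L0 s1.
  by case: gi1 => a1 a2 a3 a4 a5; split=> //; rewrite /s1; hs.
apply: wp_conseq (prep_spec wl_ge M_ge NX_lt HD_lt HD_0 HE_le nb_sym nb_sum r_lt d0 (leqnn _) cx) _.
move=> s2 x2 [[dr dl] sp0 hP0 tm2].
have gi2 : ginv s2 by apply: (ginv_frame x2).
have cf2 : conf_of s2 = C0 by rewrite (conf_frame x2) // /s1.
have L2 : rg s2 vL = L0 by rewrite (frame_rg x2) // /s1; hs.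
have {dl} dl := dl erefl; rewrite sp0 in dr dl.
have {}tm2 : ck s2 <= ck s + 10 + ticks (8 * (n + m2 + 1)).
  by move: tm2; rewrite /s1; hs; tlia.
move: (ck s) tm2 => ck0 tm2.
case: s2 x2 dr dl sp0 gi2 cf2 L2 hP0 tm2 => rg2 ar2 ck2 pd2 ou2.
hs => x2 dr dl sp0 gi2 cf2 L2 hP0 tm2.
pose Pd := ar2 aPR; pose Pa := ar2 aPA; pose Lw := ar2 aLO.
rewrite -/Pd -/Pa -/Lw in dr dl hP0.
have Pd1 x : x < n -> Pd x <> 1 by exact: (l_no1 dl).
have PdF x : x < n -> (Pd x = 2 <-> inF r (cq C0) L0 x) by move=> xn; case: (hP0 _ xn).
clear hP0.
(* [Pd], [Pa] and [Lw] are the results of the search, against which all phases are judged. The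
   closure of the positions under parents lets this one search serve for every phase. *)
pose IC s' := [/\ [/\ ginv s', same L0 C0 (conf_of s'), L0 <= rg s' vL & rg s' vJ <= nw],
  [/\ cfg (conf_of s') (rg s' vL), flags (conf_of s') (rg s' vL) &
      fresh (conf_of s') L0 (rg s' vL)],
  [/\ ar s' aPA = Pa, ar s' aLO = Lw,
      forall x, x < n -> (ar s' aPR x = 2 <-> inF r (ar s' aSE) (rg s' vL) x) /\
         (ar s' aPR x = Pd x \/ ar s' aPR x = 2) &
      forall x, x < n -> 3 <= Pd x -> inF r (ar s' aSE) (rg s' vL) x ->
         inF r (ar s' aSE) (rg s' vL) (Pa x)],
  (rg s' vOk = 1 /\ forall j, j < rg s' vJ -> inF r (ar s' aSE) (rg s' vL) (inp (tb + j))) \/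
  (rg s' vOk = 0 /\ exists2 w, Wt w & ~ reach w) &
  ck s' <= ck0 + 50 + ticks (8 * (n + m2 + 1)) + ticks (rg s' vL - L0) + ticks (rg s' vJ)].
do 2 wstep.
apply: (@wp_while _ _ _ _ _ IC (fun s' => nw - rg s' vJ)).
  have e9 : ar2 aSE = cq C0 by rewrite -cf2.
  split; hs; rewrite ?L2.
  - split; [by case: gi2 => [[h1 h2 h3 h4] h5 h6 h7 h8]; do 2 (split; hs => //) | | by [] | by []].
    by rewrite /conf_of; hs; rewrite -cf2.
  - by rewrite /conf_of; hs; rewrite /conf_of in cf2; move: cf2; hs => ->; split=> // k; lia.
  - split=> //; rewrite e9 => x xn.
      by split; [exact: PdF | left].
    by move=> P3 /PdF; lia.
  - by left.
  - by tlia.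
clear gi2 L2 tm2 x2 cf2 sp0 cx gi1 s1.
move=> [rg1 ar1 ck1 pd1 ou1] [[gi1 sm1 hL hJ] [cf1 fl1 fr1] [eA eL hP hcl] hok tm].
move: (gi1) => [[f1 f2 f3 f4] f5 f6 f7 f8].
move: f1 f2 f3 f4 f5 f6 f7 f8 hL hJ cf1 fl1 fr1 eA eL hP hcl hok tm; hs.
move=> f1 f2 f3 f4 f5 f6 f7 f8 hL hJ cf1 fl1 fr1 eA eL hP hcl hok tm.
set L1 := rg1 vL in hL cf1 fl1 fr1 hP hcl hok tm *.
have d1 := c_dist cf1; have L1n := L_lt r_lt d1.
split; [by okt | move=> /nat_of_bool_neq0 lt | move=> /nat_of_bool_eq0 ge]; last first.
  have eJ : rg1 vJ = nw by move: ge; rewrite f6; lia.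
  split; hs; [| by split | | by tlia].
    by do 2 (split; hs => //).
  case: hok => [[h1 h2]|h]; [left | by right]; split=> //; split=> //.
  by move=> x [j jn ->]; apply: h2; rewrite eJ.
rewrite f6 in lt; have wn := term_lt lt.
wstep; rewrite f5 f7; set w := inp (tb + rg1 vJ) in wn *.
have Ww : Wt w by exists (rg1 vJ).
apply: wp_seqI; wstep => Pw; last first.
  wstep; wstep; split; hs; last by lia.
  have Pdw : Pd w = 0 by have [_ [<-|]] := hP _ wn; rewrite Pw.
  split; hs; [ | by [] | by [] | | by tlia].
    by split; [do 2 (split; hs => //) | by [] | by [] | lia].
  right; split=> //; exists w => // /(_ (fun x => 2 <= Pd x)) h.
  suff : 2 <= Pd w by rewrite Pdw.
  apply: h => [|x y xn xy Py]; first by have [_ ->] := PdF _ r_lt => //; left.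
  have [yn yx] := nb_sym xn xy; have := Pd1 _ xn.
  have [|] := b_scan dr yn Py yx; first by lia.
  have [->|/eqP Ty] := eqVneq (ar2 aPT y) 0; first by [].
  by have [j] := b_stk dr yn Py Ty.
wstep; apply: wp_seqI; rewrite -/L1.
set s3 := HSt _ _ _ _ _.
have hP1 x : x < n -> 3 <= ar1 aPR x -> ar1 aPR x = Pd x.
  by move=> xn P3; have [_ [//|e]] := hP _ xn; lia.
have hpar x : x < n -> 3 <= ar1 aPR x ->
    [/\ Pa x < n, Pa x \in nb x & 2 <= ar1 aPR (Pa x) < ar1 aPR x].
  move=> xn P3; have e := hP1 _ xn P3; rewrite e in P3 *.
  have [An Ab PA] := b_par dr xn P3; split=> //.
  by have [_ [->|->]] := hP _ An; lia.
have Pw2 : 2 <= ar1 aPR w.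
  by have [_ [e|->]] := hP _ wn; rewrite ?e //; have := Pd1 _ wn; lia.
have P_old k : k < L1 -> ar1 aPR (ar1 aSE k) <= 2.
  by move=> kL; have [[_ ->]] := hP _ (q_lt d1 kL) => //; right; exists k.
have P_root : ar1 aPR r <= 2 by have [[_ ->]] := hP _ r_lt => //; left.
pose C1 := conf_of (HSt rg1 ar1 ck1 pd1 ou1).
have adj3 : adjacency s3 by split; rewrite /s3; hs.
have sm3 : same L1 C1 (conf_of s3) by [].
have ea3 : [/\ ar s3 aPR = ar1 aPR, ar s3 aPA = Pa & ar s3 aLO = Lw] by rewrite /s3; hs.
have er3 : [/\ rg s3 vR = r, rg s3 vL = L1 & rg s3 vX = w] by rewrite /s3; hs.
apply: wp_conseq (walk_spec (C := C1) wl_ge M_ge HD_0 nb_sum r_lt hpar d1 P_old P_root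
  adj3 sm3 ea3 er3 wn Pw2) _.
move=> s4 x4 [wk Pend tm4].
have gi3 : ginv s3 by split; rewrite /s3; hs.
have gi4 : ginv s4 by apply: (ginv_frame x4).
have eS0 : rg s4 vS0 = L1 by rewrite (frame_rg x4) // /s3; hs.
have eJ4 : rg s4 vJ = rg1 vJ by rewrite (frame_rg x4) // /s3; hs.
have eOk4 : rg s4 vOk = rg1 vOk by rewrite (frame_rg x4) // /s3; hs.
have {}tm4 : ck s4 <= ck1 + 110 + ticks (rg s4 vL - L1) by move: tm4; rewrite /s3; hs; tlia.
clear x4 sm3 adj3 gi3 ea3 er3 s3.
case: wk => _ [w1 w2 w3] w4 w5 w6 [w7 w8] w9 w10 w11 [w12 w13] w14.
case: s4 gi4 eS0 eJ4 eOk4 tm4 Pend w1 w2 w3 w4 w5 w6 w7 w8 w9 w10 w11 w12 w13 w14 => rg4 ar4 ck4 pd4 ou4.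
hs => gi4 eS0 eJ4 eOk4 tm4 Pend w1 w2 w3 w4 w5 w6 w7 w8 w9 w10 w11 w12 w13 w14.
set L4 := rg4 vL in tm4 w5 w6 w9 w10 w11 w12 w13 w14 *.
have L4n := L_lt r_lt w6.
move: (gi4) => [[k1 k2 k3 k4] k5 k6 k7 k8].
move: k1 k2 k3 k4 k5 k6 k7 k8; hs => k1 k2 k3 k4 k5 k6 k7 k8.
have smT : same L0 C0 (conf_of (HSt rg4 ar4 ck4 pd4 ou4)).
  exact: same_trans sm1 (same_le hL w4).
have inFold x : inF r (ar1 aSE) L1 x -> inF r (ar4 aSE) L1 x.
  exact: (inF_same w4 (leqnn L1)).
have inFle x : inF r (ar4 aSE) L1 x -> inF r (ar4 aSE) L4 x.
  by move=> [->|[j jL ->]]; [left | right; exists j => //; lia].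
have okn : (rg1 vOk = 1 /\ forall j, j < rg1 vJ + 1 -> inF r (ar4 aSE) L4 (inp (tb + j))) \/
    (rg1 vOk = 0 /\ exists2 w, Wt w & ~ reach w).
  case: hok => [[h1 h2]|h]; [left | by right]; split=> // j hj.
  have [->|ne] := eqVneq j (rg1 vJ); last by apply/inFle/inFold/h2; lia.
  have [e|ne] := eqVneq L4 L1; last by right; exists L1; [lia | rewrite w13 //; lia].
  have [[p1 _] _] := hP _ wn; apply/inFle/inFold/p1.
  by rewrite -(w12 e).
have hP4 x : x < n -> (ar4 aPR x = 2 <-> inF r (ar4 aSE) L4 x) /\
    (ar4 aPR x = Pd x \/ ar4 aPR x = 2).
  move=> xn; have [[p1 p2] p3] := hP _ xn; split; last first.
    by have [->|[]] := w9 _ xn; [ | right].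
  split=> [P4|].
    have [e|[_ [k hk <-]]] := w9 _ xn; last by right; exists k => //; lia.
    by apply/inFle/inFold/p1; rewrite -e.
  have keep y : y < n -> ar1 aPR y = 2 -> ar4 aPR y = 2.
    by move=> yn Py; have [->|[]] := w9 _ yn.
  move=> [ex|[k kL ex]].
    by apply: keep => //; apply: p2; left.
  have [lt1|ge1] := ltnP k L1; last by rewrite ex; apply: w10; lia.
  by apply: keep => //; apply: p2; right; exists k => //; rewrite ex; case: (w4 k lt1).
have endF : inF r (ar4 aSE) L1 (rg4 vX).
  by apply: inFold; have [[p1 _] _] := hP _ w7; apply: p1.
have hcl1 x : x < n -> 3 <= Pd x -> inF r (ar4 aSE) L1 x -> inF r (ar4 aSE) L1 (Pa x).
  move=> xn P3 h; apply: inFold; apply: hcl => //.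
  exact: (inF_same (same_sym w4) (leqnn L1)).
have hcl4 x : x < n -> 3 <= Pd x -> inF r (ar4 aSE) L4 x -> inF r (ar4 aSE) L4 (Pa x).
  move=> xn P3 h; case: (classic (inF r (ar4 aSE) L1 x)) => [h1|n1].
    exact/inFle/hcl1.
  case: h => [ex|[k kL ex]]; first by case: n1; left.
  have hk : L1 <= k < L4.
    by rewrite kL andbT leqNgt; apply/negP => lt1; apply: n1; right; exists k.
  have [_ _ l1 l2 _] := w11 _ hk; rewrite ex.
  have [e|ne] := eqVneq k.+1 L4; first by rewrite l2 //; apply: inFle.
  by rewrite l1; [right; exists k.+1 => //; lia | lia].
have frn C' : same L4 (conf_of (HSt rg4 ar4 ck4 pd4 ou4)) C' \/
    (forall k, k < L4 -> [/\ cq C' k = ar4 aSE k, ccur C' k = ar4 aCU k, cfst C' k = ar4 aFS k & crp C' k = ar4 aRP k]) ->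
    fresh C' L0 L4.
  move=> h k hk; have [-> -> -> ->] : [/\ cq C' k = ar4 aSE k, ccur C' k = ar4 aCU k,
     cfst C' k = ar4 aFS k & crp C' k = ar4 aRP k].
    by case: h => [/(_ k)[|]|/(_ k)]; [lia | | apply; lia].
  have [lt1|ge1] := ltnP k L1.
    have [a1 a2 a3 a4 _] := w4 _ lt1; have := fr1 k; move: a1 a2 a3 a4.
    by rewrite /C1 /conf_of /= => -> -> -> ->; apply; lia.
  by have [|_ _ _ _ [-> -> -> _]] := w11 k; [lia|].
wstep; [move=> /nat_of_bool_neq0 | move=> /nat_of_bool_eq0]; rewrite eS0 -/L4 => hlt.
- wstep; rewrite eS0; wstep; split; hs; last by rewrite eJ4; lia.
  set s5 := HSt _ _ _ _ _.
  have newk k : L1 <= k < L4 -> [/\ k.+1 < L4 -> Pa (ar4 aSE k) = ar4 aSE k.+1,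
      3 <= Pd (ar4 aSE k), ar4 aCU k = Pa (ar4 aSE k), ar4 aFS k = Pa (ar4 aSE k) &
      ar4 aRP k = HE (ar4 aSE k)].
    move=> hk; have [a1 a2 a3 a4 [a5 a6 a7 a8]] := w11 _ hk; split=> //.
    by rewrite -hP1 //; apply: (q_lt w6); lia.
  have e5 : conf_of s5 = Conf (ar4 aSE) (ar4 aCU) (ar4 aFS) (ar4 aRP)
    (upd (ar4 aFL) L1 (rg4 vF)) by [].
  have sm5 : same L1 C1 (conf_of s5).
    move=> k kL; have [b1 b2 b3 b4 b5] := w4 k kL.
    by rewrite e5; split=> //=; rewrite upd_other //; lia.
  have nz : cst (conf_of s5) L1 <> 0.
    by rewrite e5 /= upd_same; case: w14 => [[->]|[->]].
  have zz k : L1 < k < L4 -> cst (conf_of s5) k = 0.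
    move=> hk; rewrite e5 /= upd_other; last by lia.
    by have [|_ _ _ _ [_ _ _ ->]] := w11 k; [lia|].
  have rts x : x < n -> Pd x = 2 -> inF r (ar4 aSE) L1 x.
    move=> xn Px; have [h _] := PdF _ xn; apply: inFold.
    have [->|[j jL ->]] := inF_same sm1 (leqnn L0) (h Px); first by left.
    by right; exists j => //; lia.
  have rL : rg s5 vL = L4 by [].
  have rJ : rg s5 vJ = rg4 vJ + 1 by [].
  have aE : ar s5 aSE = ar4 aSE by [].
  split; rewrite ?rL ?rJ ?aE.
  + split; [ | | by lia | by rewrite eJ4; lia].
      by do 2 (split; rewrite /s5; hs => //).
    by apply: same_trans sm1 (same_le hL sm5).
  + split; last by apply: frn; right.
      apply: (cfg_extend sm5 hlt nz zz cf1) => //.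
      * move=> k hk; have [a1 a2 a3 a4 a5] := newk _ hk.
        have qn : ar4 aSE k < n by apply: (q_lt w6); lia.
        rewrite /pos_ok /remaining e5 /= a5; split.
        - exact: HE_le.
        - exact: nb_uniq.
        - by [].
        - by rewrite mem_filter a3 a4 eqxx.
      * by rewrite e5 /= w13.
      * move=> k hk; have [a1 a2 a3 a4 a5] := newk _ hk.
        have qn : ar4 aSE k < n by apply: (q_lt w6); lia.
        have [_ Ab _] := b_par dr qn a2.
        rewrite e5 /= a3; split=> // e.
        by have [_ _ _ -> //] := w11 _ hk.
    apply: (flags_extend sm5 hlt nz zz fl1).
    have -> : flag_ok n HD NX HE r (conf_of s5) L1 L4 = ((rg4 vF = 1 /\ forall k, L1 <= k < L4 ->
      cdead n HD NX HE r (conf_of s5) L1 k) \/ (rg4 vF = 2 /\ ~ forall k, L1 <= k < L4 ->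
      cdead n HD NX HE r (conf_of s5) L1 k)) by rewrite /flag_ok {1 3}e5 /= upd_same.
    have done k : L1 <= k < L4 -> (Lw (ar4 aSE k) < Pd (ar4 aSE k) ->
         nonbridge n HD NX HE Pd Pa (ar4 aSE k)) /\
       (Pd (ar4 aSE k) <= Lw (ar4 aSE k) -> bridge n HD NX HE Pd Pa (ar4 aSE k)).
      move=> hk; have [_ a2 _ _ _] := newk _ hk.
      by apply: (l_done dl) => //; apply: (q_lt w6); lia.
    have eqP k : L1 <= k < L4 -> ar1 aPR (ar4 aSE k) = Pd (ar4 aSE k).
      by move=> hk; have [a1 _ _ _ _] := w11 _ hk; apply: hP1 => //; apply: (q_lt w6); lia.
    case: w14 => [[-> h]|[-> [k hk h]]]; [left | right]; split=> //.
      move=> k hk; have := h k hk; rewrite eqP // => le; have [_ br] := done k hk.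
      exact: (dead_bridge (C := conf_of s5) r_lt w6 hlt newk hcl1 hk (br le)).
    rewrite eqP // in h; have [nbr _] := done k hk.
    exact: (live_nonbridge (C := conf_of s5) r_lt w6 hlt newk rts hk (nbr h)).
  + by split.
  + by rewrite eJ4; move: okn; rewrite -eOk4.
  + by rewrite eJ4 /s5; hs; move: tm4 tm w5; tlia.
- wstep; wstep; split; hs; last by rewrite eJ4; lia.
  have e41 : L4 = L1 by lia.
  have smx : same L4 C1 (conf_of (HSt rg4 ar4 ck4 pd4 ou4)) by rewrite e41.
  split; hs; rewrite -/L4.
  + split; [by do 2 (split; hs => //) | by [] | by lia | by rewrite eJ4; lia].
  + split; last by apply: frn; left.
      by apply: (cfg_same (C := C1)); rewrite ?e41.
    by apply: (flags_same (C := C1)); rewrite ?e41.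
  + by split.
  + by rewrite eOk4 eJ4.
  + by rewrite eJ4; move: tm4 tm w5; tlia.
Qed.

End Program.

(** * The order of the enumeration *)

(* The next configuration differs at the last position [t] that has a live
   remaining neighbour; the new neighbour is the first one that is live. *)
Definition next_conf n HD NX HE r (C : conf) (L : nat) (C' : conf) (L' : nat) : Prop :=
  exists s t e, [/\ phase C L s e /\ s <= t < e,
    (forall k, k < t -> [/\ cq C' k = cq C k, ccur C' k = ccur C k, cfst C' k = cfst C k &
       crp C' k = crp C k]) /\ (cq C' t = cq C t /\ cfst C' t = cfst C t),
    t < L' /\ fresh HE C' t.+1 L',
    ccur C' t <> cfst C t /\
    (exists2 sk, lst HD NX (crp C t) = sk ++ ccur C' t :: lst HD NX (crp C' t) &
       forall b, b \in sk -> b <> cfst C t -> ~ live n HD NX HE r (cq C) s t b) &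
    forall s' e' k, phase C L s' e' -> s' <= k < e' -> t < k -> cdead n HD NX HE r C s' k].

Section Enumeration.

Variables (n' : nat).
Notation n := n'.+1.
Variables (E : {set {set 'I_n}}) (W : {set 'I_n}) (m2 : nat) (HD NX HE : nat -> nat).
Variables (r : nat) (Wt : nat -> Prop).
Notation nb := (nb HD NX HE).
Notation lst := (lst HD NX).
Notation cfg := (cfg n m2 HD NX HE r Wt).
Notation crem := (fun C => remaining HD NX (cfst C) (crp C)).
Notation o := (@inord n').
Hypothesis r_lt : r < n.
Hypothesis nbE : forall x y, x < n -> (y \in nb x) = (y < n) && ([set o x; o y] \in E).
Hypothesis WE : forall x, x < n -> (o x \in W) <-> Wt x.
Hypothesis rW : Wt r.

Lemma oK x : x < n -> val (o x) = x. Proof. by move=> xn; rewrite /= inordK. Qed.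

Lemma o_val (x : 'I_n) : o (val x) = x. Proof. exact: inord_val. Qed.

Lemma o_inj x y : x < n -> y < n -> o x = o y -> x = y.
Proof. by move=> xn yn /(congr1 val); rewrite !oK. Qed.

Lemma orW : o r \in W. Proof. exact/WE. Qed.

Notation sol := (minimal_steiner E W).
Notation decr := (dec (o r)).

Definition cagree (C : conf) (T : subgraph n) (k : nat) : Prop :=
  agree (o r) (fun i => o (cq C i)) (fun i => o (ccur C i)) T k.

Definition ctree (C : conf) (L : nat) : subgraph n :=
  tree_of (o r) L (fun i => o (cq C i)) (fun i => o (ccur C i)).

Definition complete_conf (C : conf) (L : nat) : Prop :=
  forall x, Wt x -> inF r (cq C) L x.

Section Tree.

Variables (C : conf) (L : nat).
Hypothesis cf : cfg C L.
Hypothesis cc : complete_conf C L.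

Lemma t_root k : k < L -> o (cq C k) != o r.
Proof.
move=> kL; apply/eqP => /o_inj e; have [qn qr _] := c_dist cf kL.
by apply: qr; apply: e.
Qed.

Lemma t_inj i j : i < L -> j < L -> o (cq C i) = o (cq C j) -> i = j.
Proof.
move=> iL jL /o_inj e; apply: (q_inj (c_dist cf)) => //.
by apply: e; apply: (q_lt (c_dist cf)).
Qed.

Lemma seg_at k : k < L -> exists s e, [/\ phase C L s e, s <= k < e & Wt (cq C s)] /\
  seg_ok HD NX HE r C s e.
Proof.
move=> kL; have [s [e [ph hk]]] := phase_exists (c_st0 cf) kL.
by have [w sg] := c_ph cf ph; exists s, e.
Qed.

Lemma cur_nb k : k < L -> ccur C k \in nb (cq C k).
Proof. by move=> kL; have [s [e [[_ hk _] sg]]] := seg_at kL; case: (sg k hk). Qed.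

Lemma cur_lt k : k < L -> ccur C k < n.
Proof.
by move=> kL; have := cur_nb kL; rewrite nbE ?(q_lt (c_dist cf)) // => /andP[].
Qed.

Lemma t_edge k : k < L -> [set o (cq C k); o (ccur C k)] \in E.
Proof.
by move=> kL; have := cur_nb kL; rewrite nbE ?(q_lt (c_dist cf)) // => /andP[].
Qed.

Lemma t_in k : k < L -> o (ccur C k) = o r \/ exists2 j, j < L & o (ccur C k) = o (cq C j).
Proof.
move=> kL; have [s [e [[[he _ _ _] hk _] sg]]] := seg_at kL; have [_ h1 h2] := sg k hk.
have [ek|ne] := eqVneq k.+1 e.
  have [->|[j js ->]] := h2 ek; first by left.
  by right; exists j => //; lia.
by right; exists k.+1; [lia | rewrite h1 //; lia].
Qed.

Lemma t_croot (Z : 'I_n -> Prop) : Z (o r) ->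
  (forall k, k < L -> Z (o (ccur C k)) -> Z (o (cq C k))) ->
  forall k, k < L -> Z (o (cq C k)).
Proof.
move=> Zr Zc k kL; have [d le_d] := ubnP k; elim: d k kL le_d => // d IH k kL le_d.
have [s [e [[[he _ _ _] hk _] sg]]] := seg_at kL.
have ZF x : inF r (cq C) s x -> Z (o x).
  by move=> [->|[j js ->]] //; apply: IH; lia.
have [d' le_d'] := ubnP (e - k); elim: d' k {kL le_d} hk le_d' => // d' IH' k hk le_d'.
have [_ h1 h2] := sg k hk; apply: Zc; first by lia.
have [ek|ne] := eqVneq k.+1 e; first by apply/ZF/h2.
by rewrite h1; [apply: IH' | ]; lia.
Qed.

Lemma t_term k : k < L -> o (cq C k) \in W \/ exists2 j, j < k & o (ccur C j) = o (cq C k).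
Proof.
move=> kL; have [s [e [[[he _ _ _] hk ws] sg]]] := seg_at kL.
have [->|ne] := eqVneq k s; first by left; apply/WE => //; apply: (q_lt (c_dist cf)); lia.
right; exists k.-1; first by lia.
have hk' : s <= k.-1 < e by lia.
have [_ h1 _] := sg _ hk'; rewrite h1; last by lia.
by rewrite prednK //; lia.
Qed.

Lemma t_W w : w \in W -> w = o r \/ exists2 k, k < L & w = o (cq C k).
Proof.
rewrite -(o_val w) => wW; have [h _] := WE (ltn_ord w).
have [e|[k kL e]] := cc (h wW); first by left; rewrite /= e.
by right; exists k => //; rewrite /= e.
Qed.

Lemma ctree_sol : sol (ctree C L).
Proof. exact: (tree_minimal orW t_root t_inj t_edge t_in t_croot t_term t_W). Qed.

Lemma ctree_dec k : k < L -> decr (ctree C L) (o (cq C k)) (o (ccur C k)).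
Proof. exact: (tree_dec orW t_root t_inj t_edge t_in t_croot t_term t_W). Qed.

Lemma cagree_eq T : sol T -> cagree C T L -> T = ctree C L.
Proof. exact: (agree_eq orW t_edge t_in t_croot t_term t_W). Qed.

Lemma ctree_encoded : lists_vertices (ctree C L).1
    (tree_vertices (o r) L (fun i => o (cq C i))) /\
  lists_edges (ctree C L).2 (tree_edges L (fun i => o (cq C i)) (fun i => o (ccur C i))).
Proof. exact: (tree_encoded orW t_root t_inj t_edge t_in t_croot t_term t_W). Qed.

Lemma cagree_dec T k : sol T -> cagree C T k -> k < L ->
  exists2 v, v \in nb (cq C k) & decr T (o (cq C k)) (o v).
Proof.
move=> mT aT kL; have [v dv] := agree_dec orW t_root t_term mT aT kL.
exists (val v); rewrite ?o_val //.
have qn := q_lt (c_dist cf) kL.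
rewrite nbE // ltn_ord o_val; have /andP[/steinerP [/subsetP sE _ _ _] _] := mT.
by apply: sE; case/andP: dv.
Qed.

(** This is [dec_live], carried over to vertices represented by numbers. *)
Lemma cagree_live T s e k v : sol T -> phase C L s e -> s <= k < e -> cagree C T k ->
  v < n -> decr T (o (cq C k)) (o v) -> live n HD NX HE r (cq C) s k v.
Proof.
move=> mT ph hk aT vn dv Z ZF Zc; have [he _ _ _] := ph; have [_ sg] := c_ph cf ph.
have qn j : s <= j <= k -> cq C j < n by move=> hj; apply: (q_lt (c_dist cf)); lia.
rewrite -(oK vn).
apply: (dec_live (s := s) (Z := fun x => Z (val x)) (q := fun i => o (cq C i)) orW mT _ _ dv).
- by move=> j hj; apply: t_root; lia.
- move=> j hj; have hj' : s <= j < e by lia.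
  have [_ h1 _] := sg j hj'; rewrite -h1; last by lia.
  by apply: aT; lia.
- by rewrite oK //; apply: ZF; left.
- move=> x y xy Zy hx; apply: (Zc _ _ (ltn_ord x) _ Zy) => //.
    by rewrite (nbE _ (ltn_ord x)) ltn_ord !o_val.
  by move=> j hj ex; apply: (hx j hj); apply: val_inj; rewrite oK // qn.
Qed.

End Tree.

Definition tried (C : conf) (k v : nat) : Prop := v \notin crem C k /\ v <> ccur C k.

(** [T] leaves the branch of the decision tree that leads to [C] at a choice explored earlier: as a
    leaf, it lies to the left of [C]. *)
Definition tried_before (C : conf) (L : nat) (T : subgraph n) : Prop :=
  exists k v, [/\ k < L, cagree C T k, v < n, decr T (o (cq C k)) (o v) & tried C k v].

Definition listed (C : conf) (L : nat) (Hs : seq (subgraph n)) : Prop :=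
  uniq Hs /\ forall T, (T \in Hs) <-> (sol T /\ tried_before C L T).

Lemma cdec_uniq T x v v' : sol T -> x < n -> x <> r -> v < n -> v' < n ->
  decr T (o x) (o v) -> decr T (o x) (o v') -> v = v'.
Proof.
move=> mT xn xr vn vn' d d'; apply: o_inj => //.
have ne : o x != o r by apply/eqP => /o_inj h; apply: xr; apply: h.
exact: (dec_uniq mT ne d d').
Qed.

Lemma first_deviation C L T : cfg C L -> sol T ->
  cagree C T L \/ exists k v, [/\ k < L, cagree C T k, v \in nb (cq C k),
    decr T (o (cq C k)) (o v) & v <> ccur C k].
Proof.
move=> cf mT; suff H k : k <= L -> cagree C T k \/ exists k v, [/\ k < L, cagree C T k,
    v \in nb (cq C k), decr T (o (cq C k)) (o v) & v <> ccur C k] by apply: H.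
elim: k => [|k IH] kL; first by left.
have [|aT|?] := IH; [by lia | | by right].
have [v vn dv] := cagree_dec cf mT aT kL.
have [ev|/eqP ne] := eqVneq v (ccur C k); last by right; exists k, v.
left=> j; rewrite ltnS leq_eqVlt => /orP[/eqP ->|jk]; last exact: aT.
by rewrite -ev.
Qed.

(** The parents of the current tree are the current choices, and parents are unique, so it cannot
    also leave the branch at a tried choice. *)
Lemma ctree_not_listed C L Hs : cfg C L -> complete_conf C L -> listed C L Hs ->
  ctree C L \notin Hs.
Proof.
move=> cf cc [_ hL]; apply/negP => /hL [mT [k [v [kL aT vn dv [_ ne]]]]].
have [qn qr _] := c_dist cf kL.
by apply: ne; apply: (cdec_uniq mT qn qr vn (cur_lt cf kL) dv); apply: ctree_dec.
Qed.

Lemma listed_nil C L : cfg C L -> fresh HE C 0 L -> listed C L [::].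
Proof.
move=> cf fr; split=> // T; split=> // [[mT [k [v [kL aT vn dv [nr ne]]]]]].
exfalso; apply: (negP nr); have [ef er] := fr k kL.
rewrite mem_filter er -ef; apply/andP; split; first exact/eqP.
have qn := q_lt (c_dist cf) kL; rewrite -/(nb _) nbE // vn /=.
have /andP[/steinerP [/subsetP sE _ _ _] _] := mT.
by apply: sE; case/andP: dv.
Qed.

Section Next.

Variables (C C' : conf) (L L' : nat) (Hs : seq (subgraph n)).
Hypothesis cf : cfg C L.
Hypothesis cf' : cfg C' L'.
Hypothesis cc : complete_conf C L.
Hypothesis lH : listed C L Hs.

Lemma listed_rcons_uniq : uniq (rcons Hs (ctree C L)).
Proof. by rewrite rcons_uniq (ctree_not_listed cf cc lH); case: lH. Qed.

Lemma sol_dec_nb T k v : sol T -> k < L -> v < n -> decr T (o (cq C k)) (o v) ->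
  v \in nb (cq C k).
Proof.
move=> mT kL vn dv; have qn := q_lt (c_dist cf) kL; rewrite nbE // vn.
have /andP[/steinerP [/subsetP sE _ _ _] _] := mT.
by apply: sE; case/andP: dv.
Qed.

(** A solution other than the current tree deviates first to a live neighbour; where all positions
    are dead this neighbour is not remaining, hence it was tried. *)
Lemma listed_last : (forall s e k, phase C L s e -> s <= k < e ->
    cdead n HD NX HE r C s k) ->
  forall T, (T \in rcons Hs (ctree C L)) <-> sol T.
Proof.
move=> dead T; have [_ hL] := lH; rewrite mem_rcons inE; split.
  by move=> /orP[/eqP ->|/hL []] //; apply: ctree_sol.
move=> mT; have [aT|[k [v [kL aT vnb dv ne]]]] := first_deviation cf mT.
  by rewrite (cagree_eq cf cc mT aT) eqxx.
apply/orP; right; apply/hL; split=> //; exists k, v.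
have qn := q_lt (c_dist cf) kL.
have vn : v < n by move: vnb; rewrite nbE // => /andP[].
split=> //; split=> //; apply/negP => vr.
have [s [e [[ph hk _] _]]] := seg_at cf kL.
exact: (dead _ _ _ ph hk v vr (cagree_live cf mT ph hk aT vn dv)).
Qed.

(** The leaves to the left of the new configuration are those to the left of the old one and the old
    leaf itself. Nothing else is skipped: positions after [t] are dead, and so are the neighbours
    [sk] passed over at [t]. *)
Lemma listed_next : next_conf n HD NX HE r C L C' L' ->
  listed C' L' (rcons Hs (ctree C L)).
Proof.
move=> [s [t [e [[ph ht] [eqk [eq_t ef_t]] [tL' fr] [nfst [sk esk hsk]] dead]]]].
split; first exact: listed_rcons_uniq.
have [_ hL] := lH; have [he _ _ _] := ph; have tL : t < L by lia.
have agr T k : k <= t -> cagree C T k <-> cagree C' T k.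
  move=> kt; split=> h j jk; have [e1 e2 _ _] : _ := eqk j (leq_trans jk kt).
    by rewrite e1 e2; apply: h.
  by rewrite -e1 -e2; apply: h.
have [rp1 ul sub curn] := c_pos cf tL.
have uniq_l : uniq (sk ++ ccur C' t :: lst (crp C' t)) by rewrite -esk.
have qn := q_lt (c_dist cf) tL; have [_ qr _] := c_dist cf tL.
have tried_k k v : k < t -> tried C k v <-> tried C' k v.
  by move=> kt; rewrite /tried /remaining; have [_ -> -> ->] := eqk _ kt.
have tried_t v : v \in nb (cq C t) -> (tried C t v \/ v = ccur C t) -> tried C' t v.
  move=> vnb h; split.
    rewrite mem_filter ef_t negb_and negbK.
    have [ev|nv] := eqVneq v (cfst C t); first by [].
    rewrite /=; apply/negP => vl.
    have vr : v \in crem C t by rewrite mem_filter nv esk mem_cat inE vl !orbT.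
    case: h => [[/negP]|ev]; first exact.
    by rewrite -ev vr in curn.
  move=> ev; have vr : v \in crem C t.
    by rewrite mem_filter esk mem_cat inE ev eqxx orbT andbT; apply/eqP.
  case: h => [[/negP]|ev']; first exact.
  by rewrite -ev' vr in curn.
(* A solution that agrees with [C] beyond [t] uses the old parent at [t], which now counts as
   tried. *)
have agr_t T : sol T -> forall k, cagree C T k -> t < k -> k <= L -> tried_before C' L' T.
  move=> mT k aT tk kL; exists t, (ccur C t); have aTt := aT t tk.
  split=> //.
  - by apply/agr => // j jt; apply: aT; lia.
  - exact: (cur_lt cf tL).
  - by rewrite eq_t.
  - by apply: tried_t; [exact: (cur_nb cf tL) | right].
move=> T; rewrite mem_rcons inE; split.
  move=> /orP[/eqP ->|/hL [mT [k [v [kL aT vn dv tv]]]]].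
    split; first exact: ctree_sol.
    apply: (agr_t _ (ctree_sol cf cc) L) => // k kL.
    exact: ctree_dec.
  split=> //; have vnb := sol_dec_nb mT kL vn dv.
  have [kt|tk|ek] := ltngtP k t.
  - exists k, v; have [e1 _ _ _] := eqk _ kt; split=> //; first by lia.
    + by apply/agr => //; apply: ltnW.
    + by rewrite e1.
    + exact/tried_k.
  - by apply: (agr_t _ mT _ aT tk); lia.
  - subst k; exists t, v; split=> //; first exact/agr.
      by rewrite eq_t.
    by apply: tried_t => //; left.
move=> [mT [k [v [kL aT vn dv tv]]]].
have [kt|tk|ek] := ltngtP k t.
- apply/orP; right; apply/hL; split=> //; have [e1 _ _ _] := eqk _ kt.
  exists k, v; split=> //; first by lia.
  + by apply/agr => //; apply: ltnW.
  + by rewrite -e1.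
  + exact/tried_k.
(* Beyond [t] the new configuration is fresh: every neighbour but the current one remains. *)
- exfalso; have hk : t.+1 <= k < L' by lia.
  have [e1 e2] := fr k hk; have [nr ne] := tv; apply: (negP nr).
  have qn' := q_lt (c_dist cf') kL.
  rewrite mem_filter e2 -e1 -/(nb _) nbE // vn /=; apply/andP; split; first exact/eqP.
  have /andP[/steinerP [/subsetP sE _ _ _] _] := mT.
  by apply: sE; case/andP: dv.
- subst k; rewrite eq_t in dv; have aTt : cagree C T t by apply/agr.
  have vnb := sol_dec_nb mT tL vn dv.
  (* At [t] the solution uses either a choice tried before the old parent, or the old parent itself;
     in the latter case it is the old leaf or deviates from it after [t]. *)
  have [ev|/eqP nv] := eqVneq v (ccur C t); last first.
    apply/orP; right; apply/hL; split=> //; exists t, v; split=> //; split=> //.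
    have [nr ne] := tv; apply/negP; rewrite mem_filter esk mem_cat inE => /andP[/eqP nf].
    case/or3P => [vsk|/eqP //|vl].
      exact: (hsk v vsk nf (cagree_live cf mT ph ht aTt vn dv)).
    by apply: (negP nr); rewrite mem_filter ef_t vl andbT; apply/eqP.
  have [aL|[k [v' [kL' aT' vnb' dv' ne']]]] := first_deviation cf mT.
    by rewrite (cagree_eq cf cc mT aL) eqxx.
  apply/orP; right; apply/hL; split=> //.
  have qn' := q_lt (c_dist cf) kL'.
  have vn' : v' < n by move: vnb'; rewrite nbE // => /andP[].
  exists k, v'; split=> //; split=> //; apply/negP => vr.
  have [kt|tk|ek] := ltngtP k t; last 2 first.
  + have [s' [e' [[ph' hk' _] _]]] := seg_at cf kL'.
    exact: (dead _ _ _ ph' hk' tk v' vr (cagree_live cf mT ph' hk' aT' vn' dv')).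
  + subst k; apply: ne'; rewrite -ev.
    exact: (cdec_uniq mT qn qr vn' vn dv' dv).
  have [_ qr' _] := c_dist cf kL'.
  apply: ne'; apply: (cdec_uniq mT qn' qr' vn' (cur_lt cf kL') dv').
  exact: aTt.
Qed.

End Next.

Lemma no_solution w : Wt w -> w < n ->
  ~ reach n HD NX HE r w -> forall T, ~ sol T.
Proof.
move=> ww wn nr T /andP[/steinerP [/subsetP sE _ _ cW] _]; apply: nr => Z Zr Zc.
have wW : o w \in W by apply/WE.
have /and3P[_ _ c] := cW _ _ orW wW.
suff : Z (val (o w)) by rewrite oK.
apply: (@connect_invariant _ _ (fun x : 'I_n => Z (val x)) _ _ c); first by rewrite oK.
move=> a b Za ab; apply: (Zc _ _ (ltn_ord b) _ Za).
by rewrite (nbE _ (ltn_ord b)) ltn_ord !o_val setUC; apply: sE.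
Qed.

End Enumeration.

(* Drops the phases that cannot be changed any more from the end. *)
Definition scan : hcmd :=
  vS <-- HV vL ;;
  vOk <-- HC 0 ;;
  HWh (and_ (lt_ (HC 0) (HV vS)) (not_ (HV vOk))) (
    vS <-- minus1 (HV vS) ;;
    HIf (eq_ (HR aFL (HV vS)) (HC 2)) (vOk <-- HC 1)
      (HIf (HR aFL (HV vS)) (vL <-- HV vS) HSkip)).

(** The second [find_dev] only recomputes the flag of the modified phase, because the bridge test
    does not see that its lists are partly consumed. *)
Definition advance : hcmd :=
  find_dev ;;
  vX <-- HR aHD (HV vC) ;;
  HSto aCU (HV vI) (HV vX) ;;
  HSto aRP (HV vI) (HR aNX (HV vC)) ;;
  vL <-- plus1 (HV vI) ;;
  walk ;;
  find_dev ;;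
  HIf (HV vC) (HSto aFL (HV vS) (HC 2)) (HSto aFL (HV vS) (HC 1)) ;;
  complete.

(** * Correctness of the step to the next configuration *)

Section Program.

Variables (wl B M n m2 : nat) (HD NX HE : nat -> nat).
Hypothesis wl_ge : B + n + m2 + 100 < wl.
Hypothesis M_ge : n + m2 + 1 < M.
Hypothesis NX_lt : forall c, 0 < c <= m2 -> NX c < c.
Hypothesis HD_lt : forall c, 0 < c <= m2 -> HD c < n.
Hypothesis HD_0 : HD 0 < n.
Hypothesis HE_le : forall v, v < n -> HE v <= m2.
Notation nb := (nb HD NX HE).
Notation lst := (lst HD NX).
Notation adjacency := (adjacency n HD NX HE).
Notation wp := (wp wl B M).
Hypothesis nb_sym : forall x y, x < n -> y \in nb x -> y < n /\ x \in nb y.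
Hypothesis nb_uniq : forall x, x < n -> uniq (nb x).
Hypothesis nb_sum : \sum_(v < n) size (nb v) <= m2.

Variables (r tb nw : nat) (inp : nat -> nat).
Hypothesis r_lt : r < n.
Hypothesis tb_le : tb + nw <= B.
Hypothesis nw_le : nw <= n.
Hypothesis term_lt : forall j, j < nw -> inp (tb + j) < n.
Notation Wt := (Wt tb nw inp).
Notation cfg := (cfg n m2 HD NX HE r Wt).
Notation flags := (flags n HD NX HE r).
Notation ginv := (ginv n HD NX HE r tb nw inp).
Notation reach := (reach n HD NX HE r).
Notation complete_conf := (complete_conf r Wt).
Notation cdead := (cdead n HD NX HE r).

Definition scanned (C : conf) (L : nat) (s : hst) : Prop :=
  let S := rg s vS in let L' := rg s vL in
  [/\ phase C L' S L', cst C S = 2, L' <= L /\ (L' = L \/ cst C L' <> 0) &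
      forall k, L' <= k < L -> cst C k <> 2].

Lemma scan_spec s : ginv s -> cfg (conf_of s) (rg s vL) ->
  wp scan (fun s' => [/\ ginv s', conf_of s' = conf_of s,
    rg s' vOk <> 0 -> scanned (conf_of s) (rg s vL) s',
    rg s' vOk = 0 -> forall k, k < rg s vL -> cst (conf_of s) k <> 2 &
    ck s' <= ck s + ticks (n + 1)]) s.
Proof.
case: s => rg0 ar0 ck0 pd0 ou0 gi cf; move: (gi) => [[f1 f2 f3 f4] f5 f6 f7 f8].
move: f1 f2 f3 f4 f5 f6 f7 f8; hs => f1 f2 f3 f4 f5 f6 f7 f8.
set C := conf_of _ in cf *; have Ln := L_lt r_lt (c_dist cf); move: cf Ln; hs => cf Ln.
have st0 := c_st0 cf.
rewrite /scan; do 2 wstep.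
pose I s' := [/\ ginv s' /\ ar s' = ar0,
  [/\ rg s' vS <= rg s' vL, rg s' vL <= rg0 vL & rg s' vL = rg0 vL \/ cst C (rg s' vL) <> 0],
  forall k, rg s' vL <= k < rg0 vL -> cst C k <> 2,
  (rg s' vOk = 0 /\ forall k, rg s' vS <= k < rg s' vL -> cst C k = 0) \/
  (rg s' vOk = 1 /\ phase C (rg s' vL) (rg s' vS) (rg s' vL) /\ cst C (rg s' vS) = 2) &
  ck s' + ticks (rg s' vS) <= ck0 + 50 + ticks (rg0 vL)].
apply: (@wp_while _ _ _ _ _ I (fun s' => rg s' vS)).
  split; hs; [ | by split=> //; left | by lia | by left; split=> // k; lia | by lia].
  by split=> //; do 2 (split; hs => //).
move=> [rg1 ar1 ck1 pd1 ou1] [[gi1 eA] [h1 h2 h3] h4 h5 tm]; move: eA h1 h2 h3 h4 h5 tm; hs.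
move=> eA h1 h2 h3 h4 h5 tm; subst ar1; move: (gi1) => [[g1 g2 g3 g4] g5 g6 g7 g8].
move: g1 g2 g3 g4 g5 g6 g7 g8; hs => g1 g2 g3 g4 g5 g6 g7 g8.
split; [by okt | rewrite !(eqb0, sub_val) negbK => /nat_of_bool_neq0 /andP[S0 /eqP ok0]
  | rewrite !(eqb0, sub_val) negbK => /nat_of_bool_eq0 hx]; last first.
  split; hs; [by do 2 (split; hs => //) | by [] | | | by tlia].
    by move=> ok; case: h5 => [[/ok]|[_ [p1 p2]]] //.
  move=> ok k kL; case: h5 => [[_ h5]|[e]]; last by rewrite e in ok.
  have S0 : rg1 vS = 0 by move: hx; rewrite ok eqxx andbT; lia.
  have L0 : rg1 vL = 0.
    have [//|ne] := eqVneq (rg1 vL) 0; have := h5 0; rewrite S0 => z.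
    by case: st0; [lia | apply: z; lia].
  by apply: h4; lia.
have {}h5 : forall k, rg1 vS <= k < rg1 vL -> cst C k = 0.
  by case: h5 => [[_]|[e]] //; rewrite e in ok0.
have gi' rg2 ck2 : (forall i, i \in [:: vN; vW; vT; vR] -> rg2 i = rg1 i) ->
    ginv (HSt rg2 ar0 ck2 pd1 ou1).
  by move=> e; do 2 (split; hs; rewrite ?e => //).
set S := rg1 vS - 1; have eS : rg1 vS = S.+1 by rewrite /S; lia.
have eF : ar0 aFL S = cst C S by [].
wstep; rewrite -/S; wstep; [move=> /nat_of_bool_neq0 /eqP e2 | move=> /nat_of_bool_eq0 /eqP e2].
  rewrite eF in e2; wstep; split; hs; last by lia.
  split; hs; [by split=> //; apply: gi' | by split=> //; lia | by [] | | by tlia].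
  right; split=> //; split=> //; split; [by lia | by rewrite e2 | | by left].
  by move=> k hk; apply: h5; lia.
rewrite eF in e2; wstep; rewrite eF => e0; wstep; split; hs; try lia.
  split; hs; [by split=> //; apply: gi' | by split=> //; [lia | right] | | | by tlia].
    move=> k hk; have [->|ne] := eqVneq k S; first exact: e2.
    have [kL|Lk] := ltnP k (rg1 vL); last by apply: h4; lia.
    by rewrite h5 //; lia.
  by left; split=> // k; lia.
split; hs; [by split=> //; apply: gi' | by split=> //; lia | by [] | | by tlia].
left; split=> // k hk; have [->|ne] := eqVneq k S; first exact: e0.
by apply: h5; lia.
Qed.

(** The converse of [dead_of_marks]: from a vertex of mark at least 2 the parents descend to a
    source, and this path avoids the blocked positions, whose mark is 1. *)
Lemma deviation_live C L s0 s : distinct n r (cq C) L -> s0 <= L ->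
  deviation n m2 HD NX HE r (cq C) L s0 (cfst C) (crp C) s ->
  ~ forall k, s0 <= k < L -> cdead C s0 k.
Proof.
move=> d sL [hi [hc [nf P2]] [_ [sk esk _]] Hb hP] dead.
have HDn := HD_lt hc.
apply: (dead _ hi (HD (rg s vC))).
  rewrite mem_filter esk mem_cat (lst_cons HD NX_lt hc) inE eqxx orbT andbT.
  exact/eqP.
move=> Z ZF Zc; move: (HD (rg s vC)) HDn P2 {nf} => x xn Px.
have [k le_k] := ubnP (ar s aPR x); elim: k x le_k xn Px => // k IH x le_k xn Px.
have [p1 p2] := hP _ xn.
have [e2|ne2] := eqVneq (ar s aPR x) 2; first by apply: ZF; apply/p1.
have [|An Ab PA] := b_par Hb xn; first by lia.
apply: (Zc x _ xn Ab); first by apply: IH; lia.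
move=> j hj ex; have : ar s aPR x = 1 by apply/p2; exists j => //; lia.
by lia.
Qed.

Lemma advance_spec s Lf : ginv s -> cfg (conf_of s) Lf -> flags (conf_of s) Lf ->
  scanned (conf_of s) Lf s -> (forall w, Wt w -> reach w) ->
  wp advance (fun s' => [/\ ginv s' /\ rg s' vOk = 1, cfg (conf_of s') (rg s' vL),
    flags (conf_of s') (rg s' vL), complete_conf (conf_of s') (rg s' vL) /\
    next_conf n HD NX HE r (conf_of s) Lf (conf_of s') (rg s' vL) &
    ck s' <= ck s + ticks (40 * (n + m2 + 1))]) s.
Proof.
move=> gi cf fl [ph st2 [LLf hL] nost2] hreach.
set C := conf_of s in cf fl ph st2 hL nost2 *.
set L := rg s vL in ph LLf hL nost2; set S := rg s vS in ph st2.
have cfL := cfg_trunc LLf hL cf; have d := c_dist cfL; have Ln := L_lt r_lt d.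
have [hSL nz hz _] := ph; have [wS sg] := c_ph cfL ph.
have S_le : S <= L by lia.
have phf := phase_trunc LLf hL ph.
have nd : ~ forall k, S <= k < L -> cdead C S k.
  by have [[e1]|[_ h]] := fl _ _ phf; first by rewrite st2 in e1.
have cS : cfg C S by apply: (cfg_trunc _ (or_intror nz) cfL).
have fS : flags C S.
  by apply: (flags_trunc (L := Lf) _ (or_intror nz) fl); lia.
have rpk k : S <= k < L -> [/\ crp C k <= m2, uniq (lst (crp C k)) &
    {subset lst (crp C k) <= nb (cq C k)}].
  by move=> hk; have [|? ? ? _] := c_pos cfL (k := k); [lia|].
have cx : ctx2 n HD NX HE r (cq C) L S (ccur C) (cfst C) (crp C) s.
  by case: gi => a1 a2 a3 a4 a5; do 2 (split; hs => //).
rewrite /advance; apply: wp_seqI.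
apply: wp_conseq (find_dev_spec wl_ge M_ge NX_lt HD_lt HD_0 HE_le nb_sym nb_sum r_lt d S_le sg rpk cx) _.
move=> s1 x1 [cx1 c0 dv tm1].
have gi1 : ginv s1 by apply: (ginv_frame x1).
have cf1 : conf_of s1 = C by rewrite (conf_frame x1).
(* The flag 2 of the phase guarantees that this search succeeds. *)
have cne : rg s1 vC <> 0 by move=> /c0.
have {c0 dv} dv := dv cne.
move: (ck s) tm1 => ck0 tm1.
have eS1 : rg s1 vS = S by case: cx1 => [[]].
have [hi [hc [nf P2]] [dead1 [sk esk hsk]] Hb hP] := dv.
case: s1 x1 cx1 tm1 gi1 cf1 cne dv eS1 hi hc nf P2 dead1 esk hsk Hb hP => rg1 ar1 ck1 pd1 ou1.
hs => _ _ tm1 gi1 cf1 cne _ eS1 hi hc nf P2 dead1 esk hsk Hb hP.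
set t := rg1 vI in hi nf dead1 esk hsk hP *; set c := rg1 vC in hc nf P2 esk cne *.
move: (gi1) => [[g1 g2 g3 g4] g5 g6 g7 g8]; move: g1 g2 g3 g4 g5 g6 g7 g8; hs.
move=> g1 g2 g3 g4 g5 g6 g7 g8.
have HDn := HD_lt hc; have NXc := NX_lt hc; have elc := lst_cons HD NX_lt hc.
wstep; rewrite -/c g1; do 3 wstep; rewrite -/c -/t g2; apply: wp_seqI.
set s2 := HSt _ _ _ _ _.
pose C2 := Conf (cq C) (upd (ccur C) t (HD c)) (cfst C) (upd (crp C) t (NX c)) (cst C).
have eC2 : conf_of s2 = C2.
  by rewrite /C2 -cf1 /s2 /conf_of; hs.
have adj2 : adjacency s2 by split; rewrite /s2; hs.
have sm2 : same t.+1 C2 (conf_of s2) by rewrite eC2.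
have P_old k : k < t.+1 -> ar1 aPR (cq C2 k) <= 2.
  move=> kt; have qn : cq C k < n by apply: (q_lt d); lia.
  have [[_ p1] [_ p2]] := hP _ qn; have [kS|Sk] := ltnP k S.
    by rewrite p1 //; right; exists k.
  by rewrite p2 //; exists k => //; lia.
have P_root : ar1 aPR r <= 2 by have [[_ ->]] := hP _ r_lt => //; left.
have d2 : distinct n r (cq C2) t.+1 by move=> k kt; apply: d; lia.
have ea2 : [/\ ar s2 aPR = ar1 aPR, ar s2 aPA = ar1 aPA & ar s2 aLO = ar1 aLO] by rewrite /s2; hs.
have er2 : [/\ rg s2 vR = r, rg s2 vL = t.+1 & rg s2 vX = HD c] by rewrite /s2; hs; rewrite addn1.
apply: wp_conseq (walk_spec (C := C2) wl_ge M_ge HD_0 nb_sum r_lt (b_par Hb) d2 P_old P_root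
  adj2 sm2 ea2 er2 HDn P2) _.
move=> s3 x3 [wk Pend tm3].
have gi2 : ginv s2 by do 2 (split; rewrite /s2; hs => //).
have gi3 : ginv s3 by apply: (ginv_frame x3).
have eS3 : rg s3 vS = S by rewrite (frame_rg x3) // /s2; hs.
have {}tm3 : ck s3 <= ck0 + ticks (10 * (n + m2 + 1)) + 150 + ticks (rg s3 vL - t.+1).
  by move: tm3; rewrite /s2; hs; tlia.
clear x3 sm2 adj2 ea2 er2 gi2 eC2 s2.
case: wk => _ _ w4 w5 w6 [w7 w8] w9 w10 w11 [w12 w13] _.
set C3 := conf_of s3 in w4; set L3 := rg s3 vL in tm3 w5 w6 w9 w10 w11 w12 w13.
have d3 : distinct n r (cq C3) L3 by [].
have L3n := L_lt r_lt d3.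
have old k : k < t -> [/\ cq C3 k = cq C k, ccur C3 k = ccur C k, cfst C3 k = cfst C k,
    crp C3 k = crp C k & cst C3 k = cst C k].
  move=> kt; have [|b1 b2 b3 b4 b5] := w4 k; first by lia.
  by rewrite b1 b2 b3 b4 b5 /= !upd_other; [split | lia | lia].
have at_t : [/\ cq C3 t = cq C t, ccur C3 t = HD c, cfst C3 t = cfst C t,
    crp C3 t = NX c & cst C3 t = cst C t].
  by have [|b1 b2 b3 b4 b5] := w4 t; [lia | rewrite b1 b2 b3 b4 b5 /= !upd_same].
have smS : same S C C3 by move=> k kS; apply: old; lia.
have new k : t < k < L3 -> [/\ ccur C3 k \in nb (cq C3 k), ccur C3 k = cfst C3 k,
    crp C3 k = HE (cq C3 k), cst C3 k = 0 &
    (k.+1 < L3 -> ccur C3 k = cq C3 k.+1) /\ (k.+1 = L3 -> inF r (cq C3) S (ccur C3 k))].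
  move=> hk; have [P3 _ l1 l2 [b1 b2 b3 b4]] := w11 k hk.
  have qn : ar s3 aSE k < n by apply: (q_lt d3); lia.
  have [_ Ab _] := b_par Hb qn P3; rewrite /C3 /= b1 b2; split=> //; split=> // e.
  rewrite l2 //; have [[p1 _] _] := hP _ w7; exact: (inF_same smS (leqnn S) (p1 Pend)).
have cu : HD c \in nb (cq C t).
  by have [_ _ sub] := rpk _ hi; apply: sub; rewrite esk elc mem_cat mem_head orbT.
have sg3 : seg_ok HD NX HE r C3 S L3.
  move=> k hk; have [kt|tk|ek] := ltngtP k t.
  - have [|h1 h2 h3] := sg k; first by lia.
    have [-> -> _ _ _] := old k kt; split=> // e; last by lia.
    rewrite h2; last by lia.
    have [k1|k1] : k.+1 = t \/ k.+1 < t by lia.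
      by have [e1 _ _ _ _] := at_t; rewrite k1 e1.
    by have [-> _ _ _ _] := old _ k1.
  - by have [|b1 _ _ _ [b2 b3]] := new k; [lia|].
  - subst k; have [e1 e2 _ _ _] := at_t; rewrite e1 e2; split=> // e.
      by rewrite -(w13 e).
    have ex := w12 (esym e); rewrite -ex.
    have [[p1 _] _] := hP _ w7; exact: (inF_same smS (leqnn S) (p1 Pend)).
have ul : uniq (sk ++ HD c :: lst (NX c)) by have [_ u _] := rpk _ hi; rewrite -elc -esk.
have po3 k : S <= k < L3 -> pos_ok m2 HD NX HE C3 k.
  move=> hk; have [kt|tk|ek] := ltngtP k t.
  - have kL : k < L by lia.
    have := c_pos cfL kL; rewrite /pos_ok /remaining.
    by have [-> -> -> -> _] := old k kt.
  - have [|b1 b2 b3 _ _] := new k; first by lia.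
    have qn : cq C3 k < n by apply: (q_lt d3); lia.
    rewrite /pos_ok /remaining b2 b3; split=> //; [exact: HE_le | exact: nb_uniq |].
    by rewrite mem_filter eqxx.
  - subst k; have [e1 e2 e3 e4 _] := at_t; have [_ _ sub] := rpk _ hi.
    rewrite /pos_ok /remaining e1 e2 e3 e4.
    move: ul; rewrite cat_uniq /= => /and3P[_ _ /andP[nin u2]]; split=> //; first by lia.
      by move=> x hx; apply: sub; rewrite esk elc mem_cat inE hx !orbT.
    by rewrite mem_filter negb_and nin orbT.
have rp3 k : S <= k < L3 -> [/\ crp C3 k <= m2, uniq (lst (crp C3 k)) &
    {subset lst (crp C3 k) <= nb (cq C3 k)}].
  by move=> /po3 [].
have cx3 : ctx2 n HD NX HE r (cq C3) L3 S (ccur C3) (cfst C3) (crp C3) s3.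
  by case: gi3 => a1 a2 a3 a4 a5; do 2 (split; hs => //).
have SL3 : S <= L3 by lia.
apply: wp_seqI.
apply: wp_conseq (find_dev_spec wl_ge M_ge NX_lt HD_lt HD_0 HE_le nb_sym nb_sum r_lt d3 SL3 sg3 rp3 cx3) _.
move=> s4 x4 [cx4 c0 dv4 tm4].
have gi4 : ginv s4 by apply: (ginv_frame x4).
have cf4 : conf_of s4 = C3 by rewrite (conf_frame x4).
have eS4 : rg s4 vS = S by rewrite (frame_rg x4).
have eL4 : rg s4 vL = L3 by rewrite (frame_rg x4).
have {}dv4 : rg s4 vC <> 0 -> ~ forall k, S <= k < L3 -> cdead C3 S k.
  by move=> /dv4; apply: deviation_live.
clear x4 cx4.
case: s4 cf4 eS4 eL4 gi4 c0 dv4 tm4 => rg4 ar4 ck4 pd4 ou4.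
hs => cf4 eS4 eL4 gi4 c0 dv4 tm4; apply: wp_seqI.
pose Cf F := Conf (cq C3) (ccur C3) (cfst C3) (crp C3) (upd (cst C3) S F).
suff fin F ck5 : (F = 1 /\ rg4 vC = 0) \/ (F = 2 /\ rg4 vC <> 0) -> ck5 <= ck4 + 50 ->
    wp complete (fun s' => [/\ ginv s' /\ rg s' vOk = 1, cfg (conf_of s') (rg s' vL),
    flags (conf_of s') (rg s' vL), complete_conf (conf_of s') (rg s' vL) /\
    next_conf n HD NX HE r C Lf (conf_of s') (rg s' vL) &
    ck s' <= ck0 + ticks (40 * (n + m2 + 1))]) (HSt rg4 (upda ar4 aFL S F) ck5 pd4 ou4).
  wstep => hcv; wstep; rewrite eS4; apply: fin; try lia.
move=> hF tm5; set s5 := HSt _ _ _ _ _.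
have eC5 : conf_of s5 = Cf F.
  by rewrite /Cf -cf4 /s5 /conf_of; hs.
have gi5 : ginv s5.
  by case: gi4 => [[h1 h2 h3 h4] h5 h6 h7 h8]; do 2 (split; rewrite /s5; hs => //).
have eL5 : rg s5 vL = L3 by [].
have F0 : F = 1 \/ F = 2 by case: hF => [[->]|[->]]; [left | right].
have smS5 : same S C (Cf F).
  by move=> k kS; have [b1 b2 b3 b4 b5] := smS k kS; split=> //=; rewrite upd_other //; lia.
have nzF : cst (Cf F) S <> 0 by rewrite /= upd_same; case: F0 => ->.
have zF k : S < k < L3 -> cst (Cf F) k = 0.
  move=> hk; have -> : cst (Cf F) k = cst C3 k by rewrite /= upd_other //; lia.
  have [kt|tk|ek] := ltngtP k t.
  - by have [_ _ _ _ ->] := old k kt; apply: hz; lia.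
  - by have [|_ _ _ -> _] := new k; [lia|].
  - by subst k; have [_ _ _ _ ->] := at_t; apply: hz; lia.
have LL3 : S < L3 by lia.
have cf5 : cfg (conf_of s5) (rg s5 vL).
  rewrite eC5 eL5; apply: (cfg_extend smS5 LL3 nzF zF cS) => //.
  have -> : cq (Cf F) S = cq C3 S by [].
  have [kt|tk|ek] := ltngtP S t; first by have [-> _ _ _ _] := old S kt.
    by lia.
  by rewrite ek; have [-> _ _ _ _] := at_t; rewrite -ek.
have fl5 : flags (conf_of s5) (rg s5 vL).
  rewrite eC5 eL5; apply: (flags_extend smS5 LL3 nzF zF fS).
  rewrite /flag_ok /= upd_same; case: hF => [[-> h]|[-> h]]; [left | right]; split=> //.
    exact: c0.
  exact: dv4.
apply: wp_conseq (complete_spec wl_ge M_ge NX_lt HD_lt HD_0 HE_le nb_sym nb_uniq nb_sum r_lt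
  tb_le nw_le term_lt gi5 cf5 fl5) _.
rewrite eC5 eL5 => s6 _ [gi6 [sm6 LL6] hok tm6].
case: hok => [[ok [cf6 fl6 fr6 cc6]]|[_ [w ww nr]]]; last by case: nr; apply: hreach.
split=> //; last by move: tm6; rewrite /s5; hs; move: tm5 tm4 tm3; tlia.
split=> //; exists S, t, L.
have to6 k : k < L3 -> [/\ cq (conf_of s6) k = cq C3 k, ccur (conf_of s6) k = ccur C3 k,
    cfst (conf_of s6) k = cfst C3 k & crp (conf_of s6) k = crp C3 k].
  by move=> kL; have [b1 b2 b3 b4 _] := sm6 k kL.
have tL3 : t < L3 by lia.
have [b1 b2 b3 b4] := to6 _ tL3; have [e1 e2 e3 e4 _] := at_t.
split.
- by split=> //; lia.
- split; last by rewrite b1 b3.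
  move=> k kt; have [|-> -> -> ->] := to6 k; first by lia.
  by have [h1 h2 h3 h4 _] := old k kt.
- split; first by lia.
  move=> k hk; have [kL|Lk] := ltnP k L3; last by apply: fr6; lia.
  by have [-> -> -> ->] := to6 k kL; have [|_ h1 h2 _ _] := new k; [lia|].
- rewrite b2 b4 e2 e4; split; first exact: nf.
  by exists sk => //; rewrite esk elc.
(* Later positions of the same phase were found dead by the search; those of the dropped phases are
   dead because their flag is 1. *)
- move=> s' e' k ph' hk tk; have [he' nz' hz' _] := ph'.
  have [kL|Lk] := ltnP k L.
    have es : s' = S.
      have [lt|gt|//] := ltngtP s' S.
        by case: nz; apply: hz'; lia.
      by case: nz'; apply: hz; lia.
    by rewrite es; apply: dead1; lia.
  have sL : L <= s'.
    rewrite leqNgt; apply/negP => lt; case: hL => [e|nzL]; first by lia.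
    by apply: nzL; apply: hz'; lia.
  have [[_ h]|[e2' _]] := fl _ _ ph'; first by apply: h.
  by case: (nost2 s'); [lia|].
Qed.

End Program.

(** * Output and the main loop *)

Definition output : hcmd :=
  HWr (plus1 (HV vL)) ;;
  HWr (HV vR) ;;
  vI <-- HC 0 ;;
  HWh (lt_ (HV vI) (HV vL)) (
    HWr (HR aSE (HV vI)) ;;
    vI <-- plus1 (HV vI)) ;;
  vI <-- HC 0 ;;
  HWh (lt_ (HV vI) (HV vL)) (
    HWr (HR aSE (HV vI)) ;;
    HWr (HR aCU (HV vI)) ;;
    vI <-- plus1 (HV vI)) ;;
  HEm.

Definition loop : hcmd :=
  vGo <-- HV vOk ;;
  HWh (HV vGo) (
    output ;;
    scan ;;
    HIf (HV vOk) advance (vGo <-- HC 0)).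

Definition out_words (C : conf) (r L : nat) : seq nat :=
  L.+1 :: r :: [seq cq C k | k <- iota 0 L] ++
  flatten [seq [:: cq C k; ccur C k] | k <- iota 0 L].

Lemma iota_rcons m : iota 0 m.+1 = rcons (iota 0 m) m.
Proof. by rewrite -addn1 iotaD cats1. Qed.

Lemma flatten_rcons (T : Type) (ss : seq (seq T)) s :
  flatten (rcons ss s) = flatten ss ++ s.
Proof. by rewrite -cats1 flatten_cat /= cats0. Qed.

Lemma Forall2_rcons (S T : Type) (R : S -> T -> Prop) xs ys x y :
  List.Forall2 R xs ys -> R x y -> List.Forall2 R (rcons xs x) (rcons ys y).
Proof. by elim=> [|a b xs' ys' h _ IH] Rxy /=; constructor; auto. Qed.

Section Program.

Variables (wl B M n' m2 : nat) (HD NX HE : nat -> nat).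
Notation n := n'.+1.
Variables (E : {set {set 'I_n}}) (W : {set 'I_n}).
Hypothesis wl_ge : B + n + m2 + 100 < wl.
Hypothesis M_ge : n + m2 + 1 < M.
Hypothesis NX_lt : forall c, 0 < c <= m2 -> NX c < c.
Hypothesis HD_lt : forall c, 0 < c <= m2 -> HD c < n.
Hypothesis HD_0 : HD 0 < n.
Hypothesis HE_le : forall v, v < n -> HE v <= m2.
Notation nb := (nb HD NX HE).
Notation wp := (wp wl B M).
Notation o := (@inord n').
Hypothesis nbE : forall x y, x < n -> (y \in nb x) = (y < n) && ([set o x; o y] \in E).
Hypothesis nb_uniq : forall x, x < n -> uniq (nb x).
Hypothesis nb_sum : \sum_(v < n) size (nb v) <= m2.

Variables (r tb nw : nat) (inp : nat -> nat).
Hypothesis r_lt : r < n.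
Hypothesis tb_le : tb + nw <= B.
Hypothesis nw_le : nw <= n.
Hypothesis term_lt : forall j, j < nw -> inp (tb + j) < n.
Notation Wt := (Wt tb nw inp).
Hypothesis WE : forall x, x < n -> (o x \in W) <-> Wt x.
Hypothesis rW : Wt r.
Notation cfg := (cfg n m2 HD NX HE r Wt).
Notation flags := (flags n HD NX HE r).
Notation ginv := (ginv n HD NX HE r tb nw inp).
Notation reach := (reach n HD NX HE r).
Notation complete_conf := (complete_conf r Wt).
Notation ctree := (ctree n' r).
Notation listed := (listed E W HD NX r).
Notation sol := (minimal_steiner E W).

Lemma nb_sym x y : x < n -> y \in nb x -> y < n /\ x \in nb y.
Proof.
by move=> xn; rewrite nbE // => /andP[yn h]; split=> //; rewrite nbE // xn setUC.
Qed.

Lemma output_spec s : ginv s -> rg s vL < n -> pd s = [::] ->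
  wp output (fun s' => [/\ pd s' = [::],
    ou s' = rcons (ou s) (ck s', out_words (conf_of s) r (rg s vL)) &
    ck s <= ck s' <= ck s + ticks (2 * n + 2)]) s.
Proof.
case: s => rg0 ar0 ck0 pd0 ou0 [[f1 f2 f3 f4] f5 f6 f7 f8].
move: f1 f2 f3 f4 f5 f6 f7 f8; hs => f1 f2 f3 f4 f5 f6 f7 f8 Ln pd_nil.
rewrite /output; do 3 wstep; rewrite pd_nil f8; apply: wp_seqI.
set L := rg0 vL in Ln *; set q := ar0 aSE; set cu := ar0 aCU.
pose I1 s' := [/\ ar s' = ar0 /\ ou s' = ou0, rg s' vL = L /\ rg s' vI <= L,
  pd s' = L.+1 :: r :: [seq q k | k <- iota 0 (rg s' vI)] &
  ck0 <= ck s' /\ ck s' + ticks (L - rg s' vI) <= ck0 + 20 + ticks L].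
apply: (@wp_while _ _ _ _ _ I1 (fun s' => L - rg s' vI)).
  by split; hs; [by [] | by [] | rewrite addn1 | split; tlia].
move=> [rg1 ar1 ck1 pd1 ou1] [[eA eo] [eL hi] ep [t1 t2]]; move: eA eo eL hi ep t1 t2; hs.
move=> eA eo eL hi ep t1 t2; subst ar1 ou1.
split; [by okt | move=> /nat_of_bool_neq0; rewrite eL => lt
  | move=> /nat_of_bool_eq0; rewrite eL => ge].
  do 2 wstep; split; hs; last by lia.
  split; hs; [by [] | by split=> //; lia | | by split; tlia].
  by rewrite ep addn1 iota_rcons map_rcons.
have {ge} hi' : rg1 vI = L by lia.
rewrite hi' in ep t2; wstep; apply: wp_seqI.
pose I2 s' := [/\ ar s' = ar0 /\ ou s' = ou0, rg s' vL = L /\ rg s' vI <= L,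
  pd s' = L.+1 :: r :: [seq q k | k <- iota 0 L] ++
    flatten [seq [:: q k; cu k] | k <- iota 0 (rg s' vI)] &
  ck0 <= ck s' /\ ck s' + ticks (L - rg s' vI) <= ck0 + 40 + ticks L + ticks L].
apply: (@wp_while _ _ _ _ _ I2 (fun s' => L - rg s' vI)).
  by split; hs; [by [] | by [] | rewrite ep cats0 | split; tlia].
clear I1 ep t1 t2 hi hi' eL rg1 ck1 pd1.
move=> [rg1 ar1 ck1 pd1 ou1] [[eA eo] [eL hi] ep [t1 t2]]; move: eA eo eL hi ep t1 t2; hs.
move=> eA eo eL hi ep t1 t2; subst ar1 ou1.
split; [by okt | move=> /nat_of_bool_neq0; rewrite eL => lt
  | move=> /nat_of_bool_eq0; rewrite eL => ge].
  do 3 wstep; split; hs; last by lia.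
  split; hs; [by [] | by split=> //; lia | | by split; tlia].
  by rewrite ep addn1 iota_rcons map_rcons flatten_rcons -!cats1 /= -!catA.
have {ge} hi' : rg1 vI = L by lia.
rewrite hi' in ep t2; wstep; split; hs; [by [] | by rewrite ep | by tlia].
Qed.

Definition encoded (H : subgraph n) (p : nat * seq nat) : Prop := encodes_subgraph H p.2.

Lemma out_encoded C L t : cfg C L -> complete_conf C L ->
  encoded (ctree C L) (t, out_words C r L).
Proof.
move=> cf cc; have [h1 h2] := ctree_encoded r_lt nbE WE rW cf cc.
exists (tree_vertices (o r) L (fun i => o (cq C i))),
  (tree_edges L (fun i => o (cq C i)) (fun i => o (ccur C i))); split=> //.
rewrite /out_words /= size_map size_iota inordK //; congr (_ :: _ :: _ ++ _).
  rewrite -map_comp; apply/eq_in_map => k; rewrite mem_iota => /andP[_ kL].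
  by rewrite /= inordK // (q_lt (c_dist cf)).
rewrite /edge_words /tree_edges -map_comp; congr flatten; apply/eq_in_map => k; rewrite mem_iota => /andP[_ kL].
rewrite /= !inordK //; first exact: (cur_lt nbE cf).
exact: (q_lt (c_dist cf)).
Qed.

(** In multiples of [n + m2 + 1]: the loop head is reached within 50 after an output, of which
    [advance] takes at most 40; the rest pays for the next [output]. *)
Definition budget : nat := ticks (60 * (n + m2 + 1)).

Definition on_time (t0 : nat) (os : seq (nat * seq nat)) : bool :=
  path (fun t t' => t <= t' <= t + budget) t0 (map fst os).

Definition last_time (t0 : nat) (os : seq (nat * seq nat)) : nat := last t0 (map fst os).

Definition finished (Hs : seq (subgraph n)) : Prop :=
  uniq Hs /\ forall T, (T \in Hs) <-> sol T.

Lemma loop_spec s t0 : ginv s -> pd s = [::] -> ou s = [::] ->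
  t0 <= ck s <= t0 + ticks (15 * (n + m2 + 1)) ->
  (rg s vOk = 1 /\ [/\ cfg (conf_of s) (rg s vL), flags (conf_of s) (rg s vL),
     complete_conf (conf_of s) (rg s vL) & fresh HE (conf_of s) 0 (rg s vL)]) \/
  (rg s vOk = 0 /\ forall T, ~ sol T) ->
  (rg s vOk = 1 -> forall w, Wt w -> reach w) ->
  wp loop (fun s' => exists2 Hs, finished Hs &
    [/\ List.Forall2 encoded Hs (ou s'), on_time t0 (ou s') &
        last_time t0 (ou s') <= ck s' <= last_time t0 (ou s') + budget]) s.
Proof.
case: s => rg0 ar0 ck0 pd0 ou0; hs => gi epd eou tm hok hre.
rewrite /loop; wstep.
pose I s' := [/\ ginv s' /\ pd s' = [::],
  on_time t0 (ou s') /\ last_time t0 (ou s') <= ck s',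
  (rg s' vGo = 1 /\ ck s' <= last_time t0 (ou s') + ticks (50 * (n + m2 + 1))) \/
  (rg s' vGo = 0 /\ ck s' + 2 <= last_time t0 (ou s') + budget) &
  exists2 Hs, List.Forall2 encoded Hs (ou s') &
    (rg s' vGo = 1 /\ [/\ cfg (conf_of s') (rg s' vL), flags (conf_of s') (rg s' vL),
       complete_conf (conf_of s') (rg s' vL), listed (conf_of s') (rg s' vL) Hs &
       forall w, Wt w -> reach w]) \/
    (rg s' vGo = 0 /\ finished Hs)].
(* Each round outputs one more distinct solution, so the number of solutions bounds the rounds. *)
apply: (@wp_while _ _ _ _ _ I (fun s' => (#|[set T | sol T]|).+1 - size (ou s') + rg s' vGo)).
  split; hs; rewrite ?epd ?eou /last_time /on_time /=.
  - by case: gi => [[h1 h2 h3 h4] h5 h6 h7 h8]; split=> //; do 2 (split; hs => //).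
  - by split=> //; lia.
  - by case: hok => [[-> _]|[-> _]]; [left | right]; split=> //; rewrite /budget; tlia.
  - exists [::] => //; case: hok => [[e [cf fl cc fr]]|[e ns]]; [left | right]; split=> //.
      split=> //; last exact: hre.
      exact: (listed_nil W nbE cf fr).
    by split=> // T; split=> // /ns.
clear gi epd eou tm hok hre rg0 ar0 ck0 pd0 ou0.
move=> s1 [[gi1 ep1] [ot1 lt1] bud1 [Hs hF hst]]; split; [by [] | |] => go.
  have {}go : rg s1 vGo = 1 by case: hst => [[]//|[e0]]; rewrite /= e0 in go.
  have [{}hst] : [/\ cfg (conf_of s1) (rg s1 vL), flags (conf_of s1) (rg s1 vL),
       complete_conf (conf_of s1) (rg s1 vL), listed (conf_of s1) (rg s1 vL) Hs &
       forall w, Wt w -> reach w] by case: hst => [[_]//|[e0]]; rewrite e0 in go.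
  move=> fl cc lH hre; have cf := hst.
  have {}bud1 : ck s1 <= last_time t0 (ou s1) + ticks (50 * (n + m2 + 1)).
    by case: bud1 => [[_]//|[e0]]; rewrite e0 in go.
  have Ln := L_lt r_lt (c_dist cf).
  case: s1 gi1 ep1 ot1 lt1 bud1 hF go hst fl cc lH cf Ln => rg1 ar1 ck1 pd1 ou1.
  hs => gi1 ep1 ot1 lt1 bud1 hF go _ fl cc lH cf Ln.
  set C := conf_of _ in cf fl cc lH.
  set s2 := htick _ _.
  have gi2 : ginv s2 by case: gi1 => [[h1 h2 h3 h4] h5 h6 h7 h8]; do 2 (split; rewrite /s2; hs => //).
  apply: wp_seqI; apply: wp_conseq (output_spec gi2 Ln ep1) _.
  move=> s3 x3 [p3 o3 t3].
  have gi3 : ginv s3 by apply: (ginv_frame x3).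
  have c3 : conf_of s3 = C by rewrite (conf_frame x3).
  have L3 : rg s3 vL = rg1 vL by rewrite (frame_rg x3).
  have go3 : rg s3 vGo = 1 by rewrite (frame_rg x3).
  have {}o3 : ou s3 = rcons ou1 (ck s3, out_words C r (rg1 vL)) by [].
  have {}t3 : ck1 <= ck s3 <= ck1 + 10 + ticks (2 * n + 2) by move: t3; rewrite /s2; hs; tlia.
  have hF3 : List.Forall2 encoded (rcons Hs (ctree C (rg1 vL))) (ou s3).
    by rewrite o3; apply: Forall2_rcons hF (out_encoded _ cf cc).
  have ot3 : on_time t0 (ou s3).
    rewrite /on_time o3 map_rcons rcons_path -/(on_time t0 ou1) ot1 /=.
    by rewrite -/(last_time t0 ou1) /budget; move: t3 bud1; tlia.
  have lt3 : last_time t0 (ou s3) = ck s3 by rewrite /last_time o3 map_rcons last_rcons.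
  have szH : size Hs <= #|[set T | sol T]|.
    have [uH hH] := lH; rewrite -(card_uniqP uH); apply: subset_leq_card.
    by apply/subsetP => T /hH [mT _]; rewrite inE.
  have szo : size ou1 = size Hs by apply/esym; elim: hF => //= a b xs ys _ _ ->.
  have so3 : size (ou s3) = (size ou1).+1 by rewrite o3 size_rcons.
  have cf3 : cfg (conf_of s3) (rg s3 vL) by rewrite c3 L3.
  apply: wp_seqI; apply: wp_conseq (scan_spec wl_ge M_ge HD_0 nb_sum r_lt tb_le nw_le gi3 cf3) _.
  rewrite c3 L3 => s4 x4 [gi4 c4 hsc hno t4].
  have [p4 o4] := frame_out x4 isT.
  have go4 : rg s4 vGo = 1 by rewrite (frame_rg x4).
  have t4' : ck s3 <= ck s4 := hexec_clock x4.
  wstep => ok; last first.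
    wstep; split; last by hs; rewrite o4 so3 szo go; lia.
    split; hs; rewrite ?p4 ?o4.
    - by case: gi4 => [[h1 h2 h3 h4] h5 h6 h7 h8]; split=> //; do 2 (split; hs => //).
    - by rewrite lt3; split=> //; lia.
    - by right; split=> //; rewrite lt3 /budget; move: t4; tlia.
    - exists (rcons Hs (ctree C (rg1 vL))) => //; right; split=> //; split.
        exact: (listed_rcons_uniq r_lt nbE WE rW cf cc lH).
      apply: (listed_last r_lt nbE WE rW cf cc lH) => s' e' k ph hk.
      have [[_ h]|[e2 _]] := fl _ _ ph; first exact: h.
      by have [he _ _ _] := ph; case: (hno ok s'); [lia|].
  case: s4 gi4 c4 hsc t4 t4' p4 o4 go4 ok {x4 hno} => rg4 ar4 ck4 pd4 ou4.
  hs => gi4 c4 hsc t4 t4' p4 o4 go4 ok; have {}hsc := hsc ok.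
  set s5 := htick _ _.
  have gi5 : ginv s5 by case: gi4 => [[h1 h2 h3 h4] h5 h6 h7 h8]; do 2 (split; rewrite /s5; hs => //).
  have c5 : conf_of s5 = C by rewrite -c4.
  have cf5 : cfg (conf_of s5) (rg1 vL) by rewrite c5.
  have fl5 : flags (conf_of s5) (rg1 vL) by rewrite c5.
  have sc5 : scanned (conf_of s5) (rg1 vL) s5 by rewrite c5.
  apply: wp_conseq (advance_spec wl_ge M_ge NX_lt HD_lt HD_0 HE_le nb_sym nb_uniq nb_sum r_lt
    tb_le nw_le term_lt gi5 cf5 fl5 sc5 hre) _.
  rewrite c5 => s6 x6 [[gi6 _] cf6 fl6 [cc6 nx] t6].
  have [p6 o6] := frame_out x6 isT.
  have {}p6 : pd s6 = [::] by rewrite p6 /s5; hs; rewrite p4.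
  have {}o6 : ou s6 = ou s3 by rewrite o6 /s5; hs.
  have go6 : rg s6 vGo = 1 by rewrite (frame_rg x6) // /s5; hs.
  have t6' := hexec_clock x6.
  have {}t6 : ck s6 <= ck4 + 2 + ticks (40 * (n + m2 + 1)) by move: t6; rewrite /s5; hs; tlia.
  have {}t6' : ck4 <= ck s6 by move: t6'; rewrite /s5; hs; lia.
  split; last by rewrite o6 go6 so3 szo go; lia.
  split; rewrite ?o6 ?lt3 ?go6 //.
  - by split=> //; lia.
  - by left; split=> //; move: t4 t6; tlia.
  - exists (rcons Hs (ctree C (rg1 vL))) => //; left; split=> //; split=> //.
    exact: (listed_next r_lt nbE WE rW cf cf6 cc lH nx).
have {}go : rg s1 vGo = 0 by [].
have fin : finished Hs by case: hst => [[e0]|[_]//]; rewrite e0 in go.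
exists Hs => //; split=> //; hs.
by case: bud1 => [[e0]|[_ b]]; [rewrite e0 in go | move: lt1 b; rewrite /=; lia].
Qed.

End Program.

(** * Building the adjacency lists *)

(** The list of [x] as [build] leaves it: each edge adds a cell at the head of the lists of both
    ends. *)
Definition nbl (es : seq (nat * nat)) (x : nat) : seq nat :=
  foldl (fun l e => let l1 := if x == e.1 then e.2 :: l else l in
                    if x == e.2 then e.1 :: l1 else l1) [::] es.

Lemma nbl_rcons es u v x : nbl (rcons es (u, v)) x =
  let l1 := if x == u then v :: nbl es x else nbl es x in
  if x == v then u :: l1 else l1.
Proof. by rewrite /nbl foldl_rcons. Qed.

Lemma mem_nbl es x y : (y \in nbl es x) = ((x, y) \in es) || ((y, x) \in es).
Proof.
elim/last_ind: es => // es [u v] IH.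
rewrite nbl_rcons !mem_rcons !inE !xpair_eqE.
case: (x == u); case: (x == v); rewrite /= ?inE IH;
  by case: (y == u); case: (y == v); case: ((x, y) \in es); case: ((y, x) \in es).
Qed.

Lemma nbl_uniq es x : uniq es -> (forall u v, (u, v) \in es -> (v, u) \notin es) ->
  uniq (nbl es x).
Proof.
elim/last_ind: es => // es [u v] IH; rewrite rcons_uniq => /andP[ne ues] anti.
have {}IH : uniq (nbl es x).
  apply: IH => // a b h; have := anti a b; rewrite !mem_rcons !inE h orbT => /(_ isT).
  by rewrite negb_or => /andP[].
have := anti u v; rewrite !mem_rcons !inE eqxx => /(_ isT).
rewrite negb_or xpair_eqE => /andP[uv vu].
rewrite nbl_rcons; case: eqP => [ex|_]; case: eqP => [ex'|_] //=; subst.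
- by rewrite !eqxx in uv.
- by rewrite IH mem_nbl negb_or vu ne.
- by rewrite IH mem_nbl negb_or ne vu.
Qed.

Lemma sum_eq_op n u : u < n -> \sum_(x < n) (val x == u : nat) = 1.
Proof.
move=> un; rewrite (bigD1 (Ordinal un)) //= eqxx big1 // => i /eqP ne.
by case: eqP => // e; case: ne; apply: val_inj.
Qed.

Lemma nbl_sum n es : (forall e, e \in es -> e.1 < n /\ e.2 < n) ->
  \sum_(x < n) size (nbl es x) = (size es).*2.
Proof.
elim/last_ind: es => [|es [u v] IH] h.
  by rewrite big1 // => i _.
have [un vn] : u < n /\ v < n by apply: (h (u, v)); rewrite mem_rcons mem_head.
rewrite (eq_bigr (fun x : 'I_n => (size (nbl es x) + (val x == u) + (val x == v)))).
  rewrite !big_split /= !sum_eq_op // IH ?size_rcons.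
    by rewrite doubleS !addn1.
  by move=> e he; apply: h; rewrite mem_rcons inE he orbT.
move=> i _; rewrite nbl_rcons /=; case: (nat_of_ord i == u); case: (nat_of_ord i == v) => /=; lia.
Qed.

Definition adjok n (HD NX HE : nat -> nat) (k : nat) (f : nat -> seq nat) : Prop :=
  [/\ forall c, 0 < c <= k -> NX c < c /\ HD c < n, HD 0 = 0 &
      forall v, v < n -> HE v <= k /\ lst HD NX (HE v) = f v].

(** The new cell has the largest address so far, so the links still decrease and no old list passes
    through it. *)
Lemma adjok_add n HD NX HE k f u w : adjok n HD NX HE k f -> u < n -> w < n ->
  adjok n (upd HD k.+1 w) (upd NX k.+1 (HE u)) (upd HE u k.+1) k.+1
    (fun v => if v == u then w :: f v else f v).
Proof.
move=> [h1 h2 h3] un wn; have [HEu lu] := h3 _ un.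
have old c : c <= k -> lst (upd HD k.+1 w) (upd NX k.+1 (HE u)) c = lst HD NX c.
  move=> ck; apply: (lst_ext (m2 := k)) => // c' hc'; first by case: (h1 c' hc').
  by rewrite !upd_other //; lia.
have h1' c : 0 < c <= k.+1 -> upd NX k.+1 (HE u) c < c /\ upd HD k.+1 w c < n.
  move=> hc; rewrite !updE; case: eqP => [->|ne]; first by split=> //; lia.
  by apply: h1; lia.
split=> //.
move=> v vn; rewrite (updE HE); case: eqP => [->|_].
  split=> //; rewrite (lst_cons _ (m2 := k.+1)); last by lia.
    by rewrite !upd_same old ?lu.
  by move=> c hc; case: (h1' c hc).
have [HEv lv] := h3 _ vn; split; first by lia.
by rewrite old.
Qed.

Definition build : hcmd :=
  vI <-- HC 0 ;;
  HWh (lt_ (HV vI) (HV vM)) (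
    vJ <-- HB OpAdd (HC 3) (HB OpAdd (HV vI) (HV vI)) ;;
    vU <-- HR aIn (HV vJ) ;;
    vV <-- HR aIn (plus1 (HV vJ)) ;;
    vK <-- plus1 (HB OpAdd (HV vI) (HV vI)) ;;
    HSto aHD (HV vK) (HV vV) ;;
    HSto aNX (HV vK) (HR aHE (HV vU)) ;;
    HSto aHE (HV vU) (HV vK) ;;
    vK <-- plus1 (HV vK) ;;
    HSto aHD (HV vK) (HV vU) ;;
    HSto aNX (HV vK) (HR aHE (HV vV)) ;;
    HSto aHE (HV vV) (HV vK) ;;
    vI <-- plus1 (HV vI)).

(** Without terminals there is no root; the only solution is then the empty subgraph, written as a
    single 0. *)
Definition prog : hcmd :=
  vN <-- HR aIn (HC 0) ;;
  vM <-- HR aIn (HC 1) ;;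
  vW <-- HR aIn (HC 2) ;;
  vT <-- HB OpAdd (HC 3) (HB OpAdd (HV vM) (HV vM)) ;;
  HIf (HV vW)
    (build ;; vR <-- HR aIn (HV vT) ;; complete ;; loop)
    (HWr (HC 0) ;; HEm).

Section Build.

Variables (wl B M n : nat) (inp : nat -> nat) (en : seq (nat * nat)).
Notation m := (size en).
Hypothesis wl_ge : B + n + m.*2 + 100 < wl.
Hypothesis M_ge : n + m.*2 + 1 < M.
Hypothesis B_ge : 3 + m.*2 <= B.
Hypothesis inp1 : forall i, i < m -> inp (3 + (i + i)) = (nth (0, 0) en i).1.
Hypothesis inp2 : forall i, i < m -> inp (3 + (i + i) + 1) = (nth (0, 0) en i).2.
Hypothesis en_lt : forall e, e \in en -> e.1 < n /\ e.2 < n.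

Lemma build_spec s : ar s aIn = inp -> rg s vM = m ->
  (forall i, ar s aHD i = 0) -> (forall i, ar s aHE i = 0) ->
  wp wl B M build (fun s' => adjok n (ar s' aHD) (ar s' aNX) (ar s' aHE) m.*2 (nbl en) /\
     ck s' <= ck s + 10 + ticks m) s.
Proof.
case: s => rg0 ar0 ck0 pd0 ou0; hs => ei em zHD zHE.
rewrite /build; wstep.
pose I s' := [/\ ar s' aIn = inp /\ rg s' vM = m, rg s' vI <= m,
  adjok n (ar s' aHD) (ar s' aNX) (ar s' aHE) (rg s' vI).*2 (nbl (take (rg s' vI) en)) &
  ck s' + ticks (m - rg s' vI) <= ck0 + 5 + ticks m].
apply: (@wp_while _ _ _ _ _ I (fun s' => m - rg s' vI)).
  split; hs; [by [] | by [] | | by tlia].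
  split; hs; [by lia | exact: zHD |].
  by move=> v vn; rewrite zHE take0.
move=> [rg1 ar1 ck1 pd1 ou1] [[eI eM] hi ok tm]; move: eI eM hi ok tm; hs.
move=> eI eM hi ok tm; set i := rg1 vI in hi ok tm *.
split; [by okt | move=> /nat_of_bool_neq0; rewrite eM => lt
  | move=> /nat_of_bool_eq0; rewrite eM => ge]; last first.
  have ei' : i = m by lia.
  by hs; rewrite ei' take_size in ok tm; split=> //; tlia.
have i1 := inp1 lt; have i2 := inp2 lt.
have [un vn] := en_lt (mem_nth (0, 0) lt).
set u := (nth (0, 0) en i).1 in i1 un; set v := (nth (0, 0) en i).2 in i2 vn.
wstep; do 2 wstep; rewrite -/i eI i1 i2.
have [_ _ hHE] := ok.
do 9 wstep; split; hs; last by lia.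
split; hs; [by [] | by lia | | by tlia].
have e1 : i + i + 1 = i.*2.+1 by lia.
have e2 : i.*2.+1 + 1 = i.*2.+2 by lia.
rewrite !e1 !e2 addn1 doubleS (take_nth (0, 0)) // -/i.
have ok2 := adjok_add (adjok_add ok un vn) vn un.
case: ok2 => a1 a2 a3; split=> // x xn; have [b1 b2] := a3 x xn; split=> //.
by rewrite b2 [nth _ _ _]surjective_pairing -/u -/v nbl_rcons.
Qed.

End Build.

(** * The encoded instance *)

Lemma uniq_map_inj (T T' : eqType) (f : T -> T') s x y :
  uniq (map f s) -> x \in s -> y \in s -> f x = f y -> x = y.
Proof.
elim: s => //= a s IH /andP[na us]; rewrite !inE => /orP[/eqP ->|xs] /orP[/eqP ->|ys] //.
- by move=> e; rewrite e map_f in na.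
- by move=> e; rewrite -e map_f in na.
- exact: IH.
Qed.

Lemma pair_eq_set n (u v x y : 'I_n) : [set u; v] = [set x; y] ->
  (u = x /\ v = y) \/ (u = y /\ v = x).
Proof.
move=> e; have h1 : u \in [set x; y] by rewrite -e !inE eqxx.
have h2 : v \in [set x; y] by rewrite -e !inE eqxx orbT.
have h3 : x \in [set u; v] by rewrite e !inE eqxx.
have h4 : y \in [set u; v] by rewrite e !inE eqxx orbT.
move: h1 h2 h3 h4; rewrite !inE.
case/orP=> /eqP eu; case/orP=> /eqP ev; do 2 (case/orP=> /eqP ?); subst; auto.
Qed.

Definition instance_words n (es : seq ('I_n * 'I_n)) (ws : seq 'I_n) : seq nat :=
  [:: n; size es; size ws] ++ edge_words es ++ map val ws.

Section Correctness.

Variables (n : nat) (E : {set {set 'I_n}}) (W : {set 'I_n}).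
Variables (es : seq ('I_n * 'I_n)) (ws : seq 'I_n).
Hypothesis gE : is_graph E.
Hypothesis lE : lists_edges E es.
Hypothesis lW : lists_vertices W ws.
Notation inp := (instance_words es ws).
Notation en := [seq (val e.1, val e.2) | e <- es].

Lemma es_uniq : uniq es.
Proof.
by have := enum_uniq (mem E); rewrite -(perm_uniq lE) => /map_uniq.
Qed.

Lemma size_es : size es = #|E|.
Proof. by have := perm_size lE; rewrite size_map -cardE. Qed.

Lemma es_le : size es <= n * n.
Proof.
rewrite -(card_uniqP es_uniq); apply: leq_trans (max_card _) _.
by rewrite card_prod card_ord.
Qed.

Lemma ws_le : size ws <= n.
Proof. by rewrite (perm_size lW) -cardE; apply: leq_trans (max_card _) _; rewrite card_ord. Qed.

Lemma size_edge_words : size (edge_words es) = (size es).*2.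
Proof. by elim: es => //= e l IH; rewrite /edge_words /= -/(edge_words l) IH doubleS. Qed.

Lemma nth_edge_words (l : seq ('I_n * 'I_n)) i : i < size l ->
  nth 0 (edge_words l) (i + i) = (nth (0, 0) [seq (val e.1, val e.2) | e <- l] i).1 /\
  nth 0 (edge_words l) (i + i + 1) = (nth (0, 0) [seq (val e.1, val e.2) | e <- l] i).2.
Proof.
elim: l i => [|e l IH] [|i] // il; have [h1 h2] := IH i il.
by have -> : i.+1 + i.+1 = (i + i).+2 by rewrite addSn addnS.
Qed.

Lemma size_inp : size inp = 3 + (size es).*2 + size ws.
Proof. by rewrite !size_cat size_edge_words size_map addnA. Qed.

Lemma mem_en (u v : 'I_n) : (val u, val v) \in en = ((u, v) \in es).
Proof.
apply/mapP/idP => [[[a b] h [e1 e2]]|h]; last by exists (u, v).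
by rewrite (val_inj e1 : u = a) (val_inj e2 : v = b).
Qed.

Lemma en_uniq : uniq en.
Proof.
rewrite map_inj_uniq ?es_uniq // => [[a b] [c d]] [e1 e2].
by congr pair; apply: val_inj.
Qed.

Lemma mem_E u v : ([set u; v] \in E) = ((u, v) \in es) || ((v, u) \in es).
Proof.
rewrite -mem_enum -(perm_mem lE); apply/mapP/orP => [[[a b] h /pair_eq_set [[-> ->]|[-> ->]]]|].
- by left.
- by right.
- by move=> [h|h]; [exists (u, v) | exists (v, u) => //=; rewrite setUC].
Qed.

(** Both orientations would list one edge twice, unless they coincide in a self-loop, which
    [is_graph] excludes. *)
Lemma en_anti u v : (u, v) \in en -> (v, u) \notin en.
Proof.
move=> /mapP [[a b] h [-> ->]]; apply/negP; rewrite mem_en => h'.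
have ub : uniq [seq [set e.1; e.2] | e <- es] by rewrite (perm_uniq lE) enum_uniq.
have [eab _] : (a, b) = (b, a) by apply: (uniq_map_inj ub h h'); rewrite /= setUC.
have : [set a; b] \in E by rewrite mem_E h.
by move/forall_inP: gE => /(_ [set a; b]) H /H; rewrite eab setUid cards1.
Qed.

Lemma en_lt e : e \in en -> e.1 < n /\ e.2 < n.
Proof. by move=> /mapP [[a b] _ ->]; split; apply: ltn_ord. Qed.

Lemma mem_W w : (w \in W) = (w \in ws).
Proof. by rewrite (perm_mem lW) mem_enum. Qed.

Lemma nth_edge i : i < size es ->
  nth 0 inp (3 + (i + i)) = (nth (0, 0) en i).1 /\
  nth 0 inp (3 + (i + i) + 1) = (nth (0, 0) en i).2.
Proof.
move=> il; have [h1 h2] := nth_edge_words il.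
change (nth 0 (edge_words es ++ map val ws) (i + i) = (nth (0, 0) en i).1 /\
  nth 0 (edge_words es ++ map val ws) (i + i + 1) = (nth (0, 0) en i).2).
rewrite !nth_cat size_edge_words.
clear gE lE lW; have -> : i + i < (size es).*2 by lia.
by have -> : i + i + 1 < (size es).*2 by lia.
Qed.

Lemma nth_terminal j : nth 0 inp (3 + (size es).*2 + j) = nth 0 (map val ws) j.
Proof.
change (nth 0 (edge_words es ++ map val ws) ((size es).*2 + j) = nth 0 (map val ws) j).
by rewrite nth_cat size_edge_words ltnNge leq_addr /= addKn.
Qed.

Lemma WtP x : Wt (3 + (size es).*2) (size ws) (nth 0 inp) x <-> x \in map val ws.
Proof.
split=> [[j jl ->]|/(nthP 0) [j jl <-]].
  by rewrite nth_terminal mem_nth // size_map.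
by exists j; rewrite ?nth_terminal // -(size_map val).
Qed.

Lemma minimal_no_terminals : W = set0 -> minimal_steiner_trees E W = [set (set0, set0)].
Proof.
move=> ->; have s0 : steiner E set0 (set0, set0).
  apply/steinerP; by split=> /= [|x y|e|u v]; rewrite ?in_set0 // sub0set.
apply/setP => T; rewrite !inE; apply/idP/eqP => [mT|->].
  by rewrite -(minimal_proper mT s0) //; apply: sub0set.
rewrite /minimal_steiner s0; apply/forallP => [[V F]]; apply/implyP.
by case/and3P; rewrite /= !subset0 => /eqP -> /eqP ->; rewrite eqxx.
Qed.

End Correctness.

Definition prog_post n (E : {set {set 'I_n}}) (W : {set 'I_n}) (m2 t0 : nat) (s : hst) : Prop :=
  enumerates_trees E W (ou s) /\ delay_le (ticks (60 * (n + m2 + 1))) t0 (ou s) (ck s).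

Section Run.

Variables (wl B M n' : nat).
Notation n := n'.+1.
Variables (E : {set {set 'I_n}}) (W : {set 'I_n}).
Variables (es : seq ('I_n * 'I_n)) (ws : seq 'I_n).
Hypothesis gE : is_graph E.
Hypothesis lE : lists_edges E es.
Hypothesis lW : lists_vertices W ws.
Notation m2 := (size es).*2.
Notation inp := (instance_words es ws).
Notation en := [seq (val e.1, val e.2) | e <- es].
Hypothesis B_E : B = 3 + m2 + size ws.
Hypothesis wl_ge : B + n + m2 + 100 < wl.
Hypothesis M_ge : n + m2 + 1 < M.
Hypothesis ws_gt0 : 0 < size ws.
Notation tb := (3 + m2).
Notation o := (@inord n').

(** After one successful completion all terminals are joined to [r], which rules out failure in the
    later ones. *)
Lemma complete_reach HD NX HE r Wt C L : r < n ->
  (forall x, x < n -> forall y, y \in nb HD NX HE x -> y < n) -> cfg n m2 HD NX HE r Wt C L ->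
  complete_conf r Wt C L -> forall w, Wt w -> reach n HD NX HE r w.
Proof.
move=> rn nlt cf cc w /cc [->|[k kL ->]] Z Zr Zc //.
have qn := q_lt (c_dist cf).
have := t_croot (Z := fun x => Z (val x)) rn cf; rewrite /= inordK // => /(_ Zr) h.
rewrite -[cq C k](@inordK n') ?qn //; apply: h => // j jL.
have [u [v [[[he _ _ _] hj _] sg]]] := seg_at cf jL; have [hn _ _] := sg j hj.
rewrite (inordK (qn _ jL)) (inordK (nlt _ (qn _ jL) _ hn)).
exact: Zc (qn _ jL) hn.
Qed.

Lemma run_spec s t0 : ar s aIn = nth 0 inp ->
  [/\ rg s vN = n, rg s vM = size es, rg s vW = size ws, rg s vT = tb & rg s vL = 0] ->
  (forall i, ar s aHD i = 0) -> (forall i, ar s aHE i = 0) ->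
  pd s = [::] -> ou s = [::] -> t0 <= ck s <= t0 + 100 ->
  wp wl B M (build ;; vR <-- HR aIn (HV vT) ;; complete ;; loop) (prog_post E W m2 t0) s.
Proof.
move=> eI [eN eM eW eT eL] zHD zHE ep eo tm.
have sen : size en = size es by rewrite size_map.
have hb1 : B + n + (size en).*2 + 100 < wl by rewrite sen.
have hb2 : n + (size en).*2 + 1 < M by rewrite sen.
have hb3 : 3 + (size en).*2 <= B by rewrite sen B_E leq_addr.
have hn i : i < size en -> nth 0 inp (3 + (i + i)) = (nth (0, 0) en i).1 /\
    nth 0 inp (3 + (i + i) + 1) = (nth (0, 0) en i).2.
  by rewrite sen; apply: nth_edge.
have eM' : rg s vM = size en by rewrite sen.
apply: wp_seqI.
apply: wp_conseq (build_spec hb1 hb2 hb3 (fun i h => proj1 (hn i h))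
  (fun i h => proj2 (hn i h)) (@en_lt _ es) eI eM' zHD zHE) _.
rewrite sen => s1 x1 [[h1 HD0 h3] t1].
have t1' := hexec_clock x1.
have e1 : ar s1 aIn = nth 0 inp by rewrite (frame_ar x1).
have eN1 : rg s1 vN = n by rewrite (frame_rg x1).
have eW1 : rg s1 vW = size ws by rewrite (frame_rg x1).
have eT1 : rg s1 vT = tb by rewrite (frame_rg x1).
have eL1 : rg s1 vL = 0 by rewrite (frame_rg x1).
have [p1 o1] := frame_out x1 isT; rewrite {}ep in p1; rewrite {}eo in o1.
clear x1 eI eN eM eM' eW eT eL zHD zHE.
case: s1 h1 HD0 h3 t1 t1' e1 eN1 eW1 eT1 eL1 p1 o1 => rg1 ar1 ck1 pd1 ou1.
hs => h1 HD0 h3 t1 t1' e1 eN1 eW1 eT1 eL1 p1 o1.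
set HD := ar1 1 in h1 HD0 h3; set NX := ar1 2 in h1 h3; set HE := ar1 3 in h3.
pose r := nth 0 inp tb.
have WP := WtP es ws.
have r_ws : r \in map val ws.
  by rewrite /r -[X in nth 0 _ X]addn0 (nth_terminal es) mem_nth // size_map.
have lt_ws x : x \in map val ws -> x < n by case/mapP => y _ ->; apply: ltn_ord.
have rn : r < n by apply: lt_ws.
have rW : Wt tb (size ws) (nth 0 inp) r by apply/WP.
have term_lt j : j < size ws -> nth 0 inp (tb + j) < n.
  by move=> jl; apply: lt_ws; apply/WP; exists j.
have WE x : x < n -> (o x \in W) <-> Wt tb (size ws) (nth 0 inp) x.
  move=> xn; rewrite (mem_W lW) -(mem_map val_inj) /= inordK //; split=> h; first exact/WP.
  by apply/WP.
have NX_lt c : 0 < c <= m2 -> NX c < c by move=> /h1 [].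
have HD_lt c : 0 < c <= m2 -> HD c < n by move=> /h1 [].
have HD_0 : HD 0 < n by rewrite HD0.
have HE_le v : v < n -> HE v <= m2 by move=> /h3 [].
have nb_E v : v < n -> nb HD NX HE v = nbl en v by move=> /h3 [].
have nbE x y : x < n -> (y \in nb HD NX HE x) = (y < n) && ([set o x; o y] \in E).
  move=> xn; rewrite nb_E // mem_nbl; case: (ltnP y n) => yn /=.
    by rewrite (mem_E lE) -!mem_en /= !inordK.
  by apply/negP => /orP[] /(@en_lt _ es) [] /= l1 l2; move: yn l1 l2; clear; lia.
have nb_uniq x : x < n -> uniq (nb HD NX HE x).
  move=> xn; rewrite nb_E //; apply: nbl_uniq; first exact: (en_uniq lE).
  by move=> u v; apply: (en_anti gE lE).
have nb_sum : \sum_(v < n) size (nb HD NX HE v) <= m2.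
  rewrite (eq_bigr (fun v : 'I_n => size (nbl en v))) => [|v _]; last by rewrite nb_E.
  by rewrite nbl_sum ?sen //; apply: en_lt.
have tb_le : tb + size ws <= B by rewrite B_E.
have nw_le : size ws <= n := ws_le lW.
have rwl : r < wl by lia.
wstep.
rewrite eT1 e1 -/r.
set s2 := HSt _ _ _ _ _.
have gi2 : ginv n HD NX HE r tb (size ws) (nth 0 inp) s2 by do 2 (split; rewrite /s2; hs => //).
have np u v : ~ phase (conf_of s2) (rg s2 vL) u v.
  by rewrite {2}/s2; hs; rewrite eL1 => [[h _ _ _]]; lia.
have L2 : rg s2 vL = 0 by [].
have cf2 : cfg n m2 HD NX HE r (Wt tb (size ws) (nth 0 inp)) (conf_of s2) (rg s2 vL).
  by split; [rewrite L2 | rewrite L2 | rewrite L2 | move=> u v /np].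
have fl2 : flags n HD NX HE r (conf_of s2) (rg s2 vL) by move=> u v /np.
apply: wp_seqI.
apply: wp_conseq (complete_spec wl_ge M_ge NX_lt HD_lt HD_0 HE_le (nb_sym nbE) nb_uniq nb_sum
  rn tb_le nw_le term_lt gi2 cf2 fl2) _.
move=> s3 x3; cbv zeta; case=> gi3 _ hok t3.
have t3' := hexec_clock x3.
have [p3 o3] := frame_out x3 isT.
rewrite {}L2 in hok.
have {}p3 : pd s3 = [::] by rewrite p3.
have {}o3 : ou s3 = [::] by rewrite o3.
have tm3 : t0 <= ck s3 <= t0 + ticks (15 * (n + m2 + 1)).
  by move: t3 t3'; rewrite /s2; hs => t3 t3'; apply/andP; split; tlia.
have hok' : (rg s3 vOk = 1 /\ [/\ cfg n m2 HD NX HE r (Wt tb (size ws) (nth 0 inp)) (conf_of s3) (rg s3 vL),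
    flags n HD NX HE r (conf_of s3) (rg s3 vL),
    complete_conf r (Wt tb (size ws) (nth 0 inp)) (conf_of s3) (rg s3 vL) &
    fresh HE (conf_of s3) 0 (rg s3 vL)]) \/
    (rg s3 vOk = 0 /\ forall T, ~ minimal_steiner E W T).
  case: hok => [[e [c1 c2 c3 c4]]|[e [w Ww nr]]]; [by left; split | right; split=> // T].
  by apply: (no_solution rn nbE WE rW Ww _ nr); apply/lt_ws/WP.
have hre : rg s3 vOk = 1 -> forall w, Wt tb (size ws) (nth 0 inp) w -> reach n HD NX HE r w.
  by case: hok' => [[e [c1 _ c3 _]] _|[-> _]] //; apply: (complete_reach rn _ c1 c3) => x xn y /(nb_sym nbE xn) [].
apply: wp_conseq (loop_spec wl_ge M_ge NX_lt HD_lt HD_0 HE_le nbE nb_uniq nb_sum rn tb_le nw_le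
  term_lt WE rW gi3 p3 o3 tm3 hok' hre) _.
move=> s4 _ [Hs [uH hH] [hF ot lt]]; split.
  exists Hs => //; apply: uniq_perm => //; first exact: enum_uniq.
  move=> T; rewrite mem_enum inE; apply/idP/idP => /hH //.
by rewrite /delay_le rcons_path; apply/andP; split.
Qed.

End Run.

(** The start at [t + 10] accounts for the assignment of the base address, of cost 10, executed from
    time [t] on. *)
Lemma prog_spec wl B M n (E : {set {set 'I_n}}) (W : {set 'I_n}) es ws t :
  is_graph E -> lists_edges E es -> lists_vertices W ws ->
  B = 3 + (size es).*2 + size ws -> B + n + (size es).*2 + 100 < wl ->
  n + (size es).*2 + 1 < M ->
  wp wl B M prog (fun s => prog_post E W (size es).*2 t s)
    (HSt (fun=> 0) (fun k i => if k is 0 then nth 0 (instance_words es ws) i else 0)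
         (t + 10) [::] [::]).
Proof.
move=> gE lE lW eB wlB MB.
have v0 : nth 0 (instance_words es ws) 0 = n by [].
have v1 : nth 0 (instance_words es ws) 1 = size es by [].
have v2 : nth 0 (instance_words es ws) 2 = size ws by [].
rewrite /prog; do 3 (wstep; rewrite ?v0 ?v1 ?v2); wstep.
wstep => h.
  clear v0 v1 v2; have wsn := ws_le lW.
  case: n E W es ws gE lE lW eB wlB MB h wsn => [|n'] E W es ws gE lE lW eB wlB MB h wsn.
    by case: h; move: wsn; rewrite leqn0 => /eqP ->.
  apply: run_spec => //; hs; try lia.
  by split=> //; lia.
have ws0 : ws = [::] by apply: size0nil.
have W0 : W = set0 by apply/setP => x; rewrite (mem_W lW) ws0 in_set0.
do 2 wstep; split; hs.
  rewrite /enumerates_trees minimal_no_terminals // enum_set1.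
  exists [:: (set0, set0)] => //; constructor=> //.
  exists [::], [::]; split=> //=; by rewrite /lists_vertices /lists_edges /= enum_set0.
by rewrite /delay_le /=; tlia.
Qed.

(** * Start of the machine, word size and final bounds *)

Definition enum_cmd : cmd :=
  Seq (Assign 0 (Bin OpAdd (Bin OpAdd (Const 3) (Bin OpMul (Const 2) (Read (Const 1))))
                           (Read (Const 2))))
      (compile prog).

Lemma eval_const wl sz s k : k < wl -> eval wl sz s (Const k) = Some k.
Proof. by move=> h /=; rewrite /word h. Qed.

Lemma eval_read wl sz s a i : eval wl sz s a = Some i -> i < sz -> memory s i < wl ->
  eval wl sz s (Read a) = Some (memory s i).
Proof. by move=> /= -> ->; rewrite /word => ->. Qed.

Lemma eval_bin wl sz s op a b x y : eval wl sz s a = Some x -> eval wl sz s b = Some y ->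
  binop_val op x y < wl -> eval wl sz s (Bin op a b) = Some (binop_val op x y).
Proof. by move=> /= -> ->; rewrite /word => ->. Qed.

Lemma instance_words_le n (es : seq ('I_n * 'I_n)) (ws : seq 'I_n) i :
  nth 0 (instance_words es ws) i <= n + size es + size ws.
Proof.
have [h|h] := ltnP i (size (instance_words es ws)); last by rewrite nth_default.
move: (mem_nth 0 h); move: (nth 0 _ i) => x; rewrite /instance_words mem_cat !inE => /orP[|].
  by case/or3P=> /eqP ->; lia.
rewrite mem_cat => /orP[/flattenP [l /mapP [[u v] _ ->]]|/mapP [u _ ->]].
  have := ltn_ord u; have := ltn_ord v.
  by rewrite !inE => hv hu /orP[] /eqP -> /=; lia.
by have := ltn_ord u; move=> /=; lia.
Qed.

(** 35 covers the [3 + 2 m + |W|] words of the input and sixteen arrays of [n + 2 m + 2] cells,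
    since [|W| <= n]. *)
Lemma enum_run wl sz n (E : {set {set 'I_n}}) (W : {set 'I_n}) es ws t :
  is_graph E -> lists_edges E es -> lists_vertices W ws ->
  35 * (n + size es + 1) <= sz -> 200 * (n + size es + 1) < wl ->
  exists2 s, exec wl sz enum_cmd (tick t (init (instance_words es ws))) s &
    enumerates_trees E W (outs s) /\
    delay_le (ticks (60 * (n + (size es).*2 + 1))) t (outs s) (clock s).
Proof.
move=> gE lE lW szB wlB; have wsn := ws_le lW.
set B := 3 + (size es).*2 + size ws; set M := n + (size es).*2 + 2.
have eB : B = 3 + 2 * size es + size ws by rewrite /B -mul2n.
have wl1 : B + n + (size es).*2 + 100 < wl by rewrite /B; lia.
have M1 : n + (size es).*2 + 1 < M by rewrite /M; lia.
have wl16 : 16 < wl by lia.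
have szM : B + 16 * M <= sz by rewrite /B /M; lia.
have wlM : B + 16 * M <= wl by rewrite /B /M; lia.
set s0 := tick t _.
have ev : eval wl sz s0 (Bin OpAdd (Bin OpAdd (Const 3) (Bin OpMul (Const 2) (Read (Const 1))))
    (Read (Const 2))) = Some B.
  have m1 : memory s0 1 = size es by [].
  have m2 : memory s0 2 = size ws by [].
  have r1 : eval wl sz s0 (Read (Const 1)) = Some (size es).
    by rewrite -m1; apply: eval_read; rewrite ?m1 ?eval_const //; lia.
  have r2 : eval wl sz s0 (Read (Const 2)) = Some (size ws).
    by rewrite -m2; apply: eval_read; rewrite ?m2 ?eval_const //; lia.
  have l2 : 2 < wl by lia.
  have l3 : 3 < wl by lia.
  have la : binop_val OpMul 2 (size es) < wl by rewrite /=; lia.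
  have lb : binop_val OpAdd 3 (2 * size es) < wl by rewrite /=; lia.
  have lc : binop_val OpAdd (3 + 2 * size es) (size ws) < wl by rewrite /=; lia.
  rewrite eB; exact: (eval_bin (eval_bin (eval_const sz s0 l3)
    (eval_bin (eval_const sz s0 l2) r1 la) lb) r2 lc).
have /wpE [h x [hE hD]] := prog_spec t gE lE lW (erefl B) wl1 M1.
have si : sim wl B M (HSt (fun=> 0)
    (fun k i => if k is 0 then nth 0 (instance_words es ws) i else 0) (t + 10) [::] [::])
    (set_reg 0 B (tick 10 s0)).
  split; [by [] | split=> // k i _ _ | split=> [[|i]|i] | by []].
  - change (nth 0 (instance_words es ws) (B + (16 * i + k)) = 0).
    by rewrite nth_default // size_inp leq_addr.
  - by rewrite /= /upd /=; lia.
  - by rewrite /= /upd /=; lia.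
  - by apply: leq_ltn_trans (instance_words_le es ws i) _; lia.
have [s xs [_ _ _ [e1 _ e2]]] := sim_exec wl16 szM wlM x si.
exists s; last by rewrite e1 e2.
by apply: ExSeq xs; apply: ExAssign ev.
Qed.

Lemma delay_leW d d' t os t' : d <= d' -> delay_le d t os t' -> delay_le d' t os t'.
Proof.
move=> dd; apply: sub_path => x y /andP[-> h] /=.
by apply: leq_trans h _; rewrite leq_add2l.
Qed.

Lemma delay_le_total d t os t' : delay_le d t os t' -> t' <= t + (size os).+1 * d.
Proof.
rewrite /delay_le; elim: os t => [|o os IH] t /=; first by rewrite mul1n andbT => /andP[].
by move=> /andP[/andP[_ h] /IH]; rewrite [in X in _ -> X]mulSn; lia.
Qed.

Lemma enumerates_size n (E : {set {set 'I_n}}) W os : enumerates_trees E W os ->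
  size os = #|minimal_steiner_trees E W|.
Proof.
by case=> Hs /perm_size; rewrite -cardE => <-; elim=> //= a b xs ys _ _ ->.
Qed.

(** With [K > n] and [K >= 2], eight factors [K] exceed the constant 200 and two give the square;
    hence the 10. *)
Lemma wlim_log_gt c n : 10 <= c -> 200 * (n.+1 ^ 2) < wlim_log c n.
Proof.
move=> c10; set K := 2 ^ (trunc_log 2 n).+1.
have nK : n < K by apply: trunc_log_ltn.
have K2 : 2 <= K by rewrite /K expnS; have := expn_gt0 2 (trunc_log 2 n); lia.
have -> : wlim_log c n = K ^ c by rewrite /K -expnM mulnC.
have h1 : K ^ 10 <= K ^ c by rewrite leq_pexp2l //; lia.
have h2 : 2 ^ 8 <= K ^ 8 by rewrite leq_exp2r.
have h3 : n.+1 ^ 2 <= K ^ 2 by rewrite leq_exp2r.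
have h4 : 0 < n.+1 ^ 2 by rewrite expn_gt0.
have h5 : 2 ^ 8 * n.+1 ^ 2 <= K ^ 8 * K ^ 2 by apply: leq_mul.
have e : 2 ^ 8 = 256 by [].
by rewrite -expnD e in h5; move: h1 h4 h5; rewrite (_ : 8 + 2 = 10) //; move: (n.+1 ^ 2) (K ^ 10) (K ^ c); lia.
Qed.

Theorem theorem1p2 :
  (exists (pre main : cmd) (c : nat),
     forall (n : nat) (E : {set {set 'I_n}}) (W : {set 'I_n}) (inp : seq nat),
       is_graph E -> encodes_instance E W inp ->
       let m := #|E| in
       let run := exec (wlim_log c n) (c * (n ^ 2 + 1)) in
       exists s1 s2 : state,
         [/\ run pre (init inp) s1 /\ run main s1 s2,
             clock s1 <= c * (n * m + 1),
             pending s1 = [::] /\ outs s1 = [::],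
             enumerates_trees E W (outs s2) &
             delay_le (c * (n + m + 1)) (clock s1) (outs s2) (clock s2)])
  /\
  (exists (main : cmd) (c : nat),
     forall (n : nat) (E : {set {set 'I_n}}) (W : {set 'I_n}) (inp : seq nat),
       is_graph E -> encodes_instance E W inp ->
       let m := #|E| in
       let run := exec (wlim_log c n) (c * (n + m + 1)) in
       exists s : state,
         [/\ run main (init inp) s,
             enumerates_trees E W (outs s) &
             clock s <= c * (maxn #|minimal_steiner_trees E W| 1 * (n + m + 1))]).
Proof.
(* The delay factor 60 is doubled because the lists have [2 m] cells, and doubled again because
   [N + 1 <= 2 * maxn N 1]; 250 rounds up the resulting 240. Known only through an inequality, [c]
   is never expanded in unary. *)
have [c hc] : exists c, 200 * 250 <= c by exists (200 * 250); apply: leqnn.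
have cw n m : m <= n * n -> 200 * (n + m + 1) < wlim_log c n.
  move=> mn; apply: leq_ltn_trans (wlim_log_gt n _); last by lia.
  by rewrite leq_mul2l /= expnS expn1; nia.
have cK k : 200 * 250 * k <= c * k by rewrite leq_mul2r hc orbT.
split.
  exists Skip, enum_cmd, c => n E W inp gE [es [ws [lE lW ->]]] m run.
  have em : size es = m := size_es lE.
  have mn := es_le lE.
  have sz : 35 * (n + size es + 1) <= c * (n ^ 2 + 1).
    apply: leq_trans (cK _); rewrite expnS expn1; move: mn; clear; nia.
  (* The preprocessing [Skip] takes one unit of time, hence the start at time 1. *)
  have [s x [hE hD]] := enum_run 1 gE lE lW sz (cw _ _ mn).
  exists (tick 1 (init (instance_words es ws))), s; split=> //.
  - by split; [apply: ExSkip | exact: x].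
  - by change (0 < c * (n * m + 1)); rewrite muln_gt0 addn1 andbT; lia.
  - apply: delay_leW hD; rewrite -em.
    by apply: leq_trans (cK _); tlia.
exists enum_cmd, c => n E W inp gE [es [ws [lE lW ->]]] m run.
have em : size es = m := size_es lE.
have sz : 35 * (n + size es + 1) <= c * (n + m + 1).
  by rewrite em; apply: leq_trans (cK _); rewrite leq_mul2r orbC.
have [s x [hE hD]] := enum_run 0 gE lE lW sz (cw _ _ (es_le lE)).
exists s; split; [exact: x | exact: hE |].
have := delay_le_total hD; rewrite add0n (enumerates_size hE) ticksE em => h.
apply: leq_trans h _; set N := #|_|.
have h1 : N.+1 <= 2 * maxn N 1 by lia.
have h2 : 200 * (60 * (n + m.*2 + 1)) <= 200 * 120 * (n + m + 1) by lia.
apply: leq_trans (leq_mul h1 h2) _; apply: leq_trans (cK _).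
by move: (maxn N 1) (n + m + 1); clear; nia.
Qed.
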